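(* Let $n\ge1$, let $J:\mathbb{R}^n\to\mathbb{R}$ be locally Lipschitz, let $a,k,\omega>0$, and let $\hat\omega_1,\dots,\hat\omega_n>0$ be rationally independent, i.e. $\ell^\top\hat\omega\neq0$ for every $\ell\in\mathbb{Q}^n\setminus\{0\}$, where $\hat\omega=(\hat\omega_1,\dots,\hat\omega_n)^\top$. Let $\phi:\mathbb{R}\to[-1,1]$ be Lipschitz and $2\pi$-periodic, and let $m_i:[-1,1]^n\to\mathbb{R}$, $i=1,\dots,n$, be Lipschitz. Define $\theta_i(t)=\omega\hat\omega_i t$, $u_i(t)=\phi(\theta_i(t))$, $u(t)=(u_1(t),\dots,u_n(t))^\top$, and the signals $$S_i(t)=a\,u_i(t),\qquad M_i(t)=\frac1a\,m_i(u(t)),\qquad i=1,\dots,n.$$ Suppose there exists a nonnegative integrable function $\rho:[-1,1]^n\to\mathbb{R}_{\ge0}$ such that $$\frac{1}{(2\pi)^n}\int_{[0,2\pi]^n}h\bigl(\phi(\theta_1),\dots,\phi(\theta_n)\bigr)\,\mathrm{d}\theta=\int_{[-1,1]^n}h(u)\rho(u)\,\mathrm{d}u$$ for every Lipschitz function $h:[-1,1]^n\to\mathbb{R}$. Let $\kappa:[-1,1]^n\to\mathbb{R}_{\ge0}$ be continuous with $\int_{[-1,1]^n}\kappa(u)\,\mathrm{d}u=1$ and, for every $i=1,\dots,n$, $\kappa(u)=0$ whenever $u_i\in\{-1,1\}$. Suppose also that $\kappa$ is absolutely continuous in each coordinate, that its almost-everywhere-defined partial derivatives are integrable, and that $$m_i(u)\rho(u)=-\partial_i\kappa(u),\qquad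 i=1,\dots,n,$$ for almost every $u\in[-1,1]^n$. Define $$J_{a,\kappa}(x)=\int_{[-1,1]^n}J(x+au)\kappa(u)\,\mathrm{d}u .$$ Then the following hold. 1. For every $t_0\in\mathbb{R}$ (and every $x\in\mathbb{R}^n$) the following limit exists: $$\lim_{T\to\infty}\frac1T\int_{t_0}^{t_0+T}J\bigl(x+S(t)\bigr)M(t)\,\mathrm{d}t=\int_{[-1,1]^n}\nabla J(x+au)\kappa(u)\,\mathrm{d}u=\nabla J_{a,\kappa}(x),$$ where $\nabla J$ is understood almost everywhere. The convergence is uniform with respect to $x$ on compact subsets of $\mathbb{R}^n$ and $t_0\in\mathbb{R}$. 2. Suppose, in addition, that $x_{a,\kappa}\in\mathbb{R}^n$ is a globally uniformly asymptotically stable (GUAS) equilibrium of the gradient flow $$\frac{\mathrm{d}z}{\mathrm{d}s}=-\nabla J_{a,\kappa}(z).$$ Then $x_{a,\kappa}$ is practically globally uniformly asymptotically stable (PGUAS) with respect to $\varepsilon=k/\omega$, in slow time $s=kt$, for the system $$\dot{\hat x}(t)=-k\,J\bigl(\hat x(t)+S(t)\bigr)M(t).$$ In particular, there exists $\beta\in\mathcal{KL}$ such that for every $\Delta,\nu>0$ there exists $\varepsilon^*(\Delta,\nu)>0$ such that, whenever $0<k/\omega<\varepsilon^*(\Delta,\nu)$, every solution with $\|\hat x(t_0)-x_{a,\kappa}\|\le\Delta$ (for any $t_0\in\mathbb{R}$) satisfies $$\|\hat x(t)-x_{a,\kappa}\|\le\beta\bigl(\|\hat x(t_0)-x_{a,\kappa}\|,\,k(t-t_0)\bigr)+\nu,\qquad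 t\ge t_0.$$
   Context: All integrals are Lebesgue integrals, ''almost everywhere'' refers to Lebesgue measure, and $\|\cdot\|$ is the Euclidean norm. By Rademacher's theorem $\nabla J$ exists almost everywhere. In part 2, $k$ and $\omega$ are free positive parameters (with $J,a,\hat\omega,\phi,m_i$ fixed) entering through $\varepsilon=k/\omega$; $\beta$ and $\varepsilon^*$ do not depend on $k,\omega$ individually. A function $\beta:\mathbb{R}_{\ge0}\times\mathbb{R}_{\ge0}\to\mathbb{R}_{\ge0}$ is of class $\mathcal{KL}$ if it is continuous, for each fixed $s\ge0$ the map $r\mapsto\beta(r,s)$ is strictly increasing with $\beta(0,s)=0$, and for each fixed $r>0$ the map $s\mapsto\beta(r,s)$ is decreasing with $\beta(r,s)\to0$ as $s\to\infty$. GUAS: a point $p$ is GUAS for $\dot z=g(t,z)$, $z(t_0)=x_0$, if there exists $\beta\in\mathcal{KL}$ such that every solution is defined for all $t\ge t_0$ and satisfies $\|z(t)-p\|\le\beta(\|x_0-p\|,t-t_0)$ for $t\ge t_0$. PGUAS: a point $p$ is PGUAS for a parameter-dependent system $\dot x=f(t,x,\varepsilon)$, $x(t_0)=x_0$, $0<\varepsilon\le\varepsilon_0$, if there exists $\beta\in\mathcal{KL}$ such that for every $\Delta,\nu>0$ there exists $\varepsilon^*(\Delta,\nu)\in(0,\varepsilon_0]$ such that for every $t_0\in\mathbb{R}$, every $x_0$ with $\|x_0-p\|\le\Delta$ and every $0<\varepsilon<\varepsilon^*(\Delta,\nu)$, the corresponding solution is defined for all $t\ge t_0$ and satisfies $\|x(t,\varepsilon)-p\|\le\beta(\|x_0-p\|,t-t_0)+\nu$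 for all $t\ge t_0$; here $\beta$ is independent of $\Delta$, $\nu$ and $\varepsilon$. In slow time, $\tilde x(s)=\hat x(s/k)$ solves $\frac{\mathrm{d}\tilde x}{\mathrm{d}s}=-G(\tilde x,\hat\omega s/\varepsilon)$ with $G_i(x,\theta)=\frac1a J(x+a\Phi(\theta))\,m_i(\Phi(\theta))$, $\Phi(\theta)=(\phi(\theta_1),\dots,\phi(\theta_n))^\top$; ''PGUAS in slow time'' refers to this $\varepsilon$-dependent system. *)

(* Defs.v *)
From HB Require Import structures.
From mathcomp Require Import all_boot all_order all_algebra.
From mathcomp Require Import all_classical all_reals all_analysis.

Set Implicit Arguments.
Unset Strict Implicit.
Unset Printing Implicit Defensive.

Import Order.TTheory GRing.Theory Num.Theory.
Import numFieldNormedType.Exports.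

Local Open Scope classical_set_scope.
Local Open Scope ring_scope.

Section rV_measurable.
Context {R : realType} (n : nat).

Definition rV_coord (i : 'I_n) (v : 'rV[R]_n) : measurableTypeR R := v ord0 i.

Definition rV_measurable : set (set 'rV[R]_n) := g_sigma_preimage rV_coord.

Let rV_measurable0 : rV_measurable set0.
Proof. exact: sigma_algebra0. Qed.

Let rV_measurableC A : rV_measurable A -> rV_measurable (~` A).
Proof. exact: sigma_algebraC. Qed.

Let rV_measurable_bigcup (F : (set 'rV[R]_n)^nat) :
  (forall i, rV_measurable (F i)) -> rV_measurable (\bigcup_i F i).
Proof. exact: sigma_algebra_bigcup. Qed.

(* The sigma-algebra generated by the coordinates, i.e. the Borel one. *)
HB.instance Definition _ := @isMeasurable.Build default_measure_display
  'rV[R]_n rV_measurable rV_measurable0 rV_measurableC rV_measurable_bigcup.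

End rV_measurable.

Section rV_measurable_theory.
Context {R : realType}.

Lemma measurable_rV_coord n (i : 'I_n) :
  measurable_fun [set: 'rV[R]_n] (@rV_coord R n i).
Proof.
move=> _ Y mY; rewrite setTI; apply: sub_sigma_algebra => /=.
rewrite -bigcup_seq/=; exists i => /=; first by rewrite mem_index_enum.
by exists Y => //; rewrite setTI.
Qed.

Lemma measurable_fun_rVP d (T : measurableType d) n (f : T -> 'rV[R]_n) :
  (forall i, measurable_fun [set: T] (rV_coord i \o f)) ->
  measurable_fun [set: T] f.
Proof.
move=> mf _ A mA; rewrite setTI.
have : g_sigma_preimage (fun i => @rV_coord R n i \o f) (f @^-1` A).
  by rewrite g_sigma_preimage_comp; exists A => //; rewrite setTI.
apply: smallest_sub; first exact: sigma_algebra_measurable.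
rewrite -bigcup_seq => B [i _] [C mC <-]; exact: mf.
Qed.

End rV_measurable_theory.

Section lebesgue_rV.
Context {R : realType}.

Definition rV_cons n (p : measurableTypeR R * 'rV[R]_n) : 'rV[R]_n.+1 :=
  \row_i if unlift ord0 i is Some j then p.2 ord0 j else p.1.

Lemma measurable_rV_cons n : measurable_fun setT (@rV_cons n).
Proof.
apply: measurable_fun_rVP => i; case: (unliftP ord0 i) => [j|] ->.
  rewrite (_ : _ \o _ = @rV_coord R n j \o snd).
    by apply: measurableT_comp; [exact: measurable_rV_coord|].
  by apply/funext => p /=; rewrite /rV_coord mxE liftK.
rewrite (_ : _ \o _ = fst); first exact: measurable_fst.
by apply/funext => p /=; rewrite /rV_coord mxE unlift_none.
Qed.

Section step.
Variables (n : nat) (mu : {sigma_finite_measure set 'rV[R]_n -> \bar R}).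

Definition lebesgue_rV_step : set 'rV[R]_n.+1 -> \bar R :=
  pushforward (@lebesgue_measure R \x mu)%E (@rV_cons n).

Let step0 : lebesgue_rV_step set0 = 0%E.
Proof. by rewrite /lebesgue_rV_step /pushforward preimage_set0 measure0. Qed.

Let step_ge0 A : (0 <= lebesgue_rV_step A)%E.
Proof. exact: (@measure_ge0 _ _ _ (@lebesgue_measure R \x mu)%E). Qed.

Let step_sigma_additive : semi_sigma_additive lebesgue_rV_step.
Proof.
move=> F mF tF mUF; rewrite /lebesgue_rV_step /pushforward preimage_bigcup.
have mS := @measurable_rV_cons n measurableT.
apply: measure_semi_sigma_additive.
- by move=> k; rewrite -[X in measurable X]setTI; exact: mS.
- apply/trivIsetP => /= i j _ _ ij; rewrite -preimage_setI.
  by move/trivIsetP : tF => /(_ _ _ _ _ ij) ->//; rewrite preimage_set0.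
- by rewrite -preimage_bigcup -[X in measurable X]setTI; exact: mS.
Qed.

HB.instance Definition _ := isMeasure.Build _ _ _ lebesgue_rV_step
  step0 step_ge0 step_sigma_additive.

Let step_sigma_finite : sigma_finite setT lebesgue_rV_step.
Proof.
have [F TF Foo] : sigma_finite setT (@lebesgue_measure R \x mu)%E.
  have /sigma_finiteP[F [TF ndF Foo]] := sigma_finiteT (@lebesgue_measure R).
  have /sigma_finiteP[G [TG ndG Goo]] := sigma_finiteT mu.
  exists (fun k => F k `*` G k).
    rewrite -setXTT TF TG predeqE => -[x y]; split; last first.
      by move=> [k _ []/= ? ?]; split; exists k.
    move=> [/= [i _ Fix] [j _ Gjy]]; exists (maxn i j) => //; split.
    - by move: x Fix; exact/subsetPset/ndF/leq_maxl.
    - by move: y Gjy; exact/subsetPset/ndG/leq_maxr.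
  move=> k; have [? ?] := Foo k; have [? ?] := Goo k.
  split; first exact: measurableX.
  by rewrite product_measure1E// lte_mul_pinfty// ge0_fin_numE.
pose g (v : 'rV[R]_n.+1) : measurableTypeR R * 'rV[R]_n :=
  (v ord0 ord0, \row_j v ord0 (lift ord0 j)).
have gK : cancel (@rV_cons n) g.
  move=> [x v]; rewrite /g /rV_cons mxE unlift_none; congr pair.
  by apply/rowP => j; rewrite !mxE liftK.
have mg : measurable_fun setT g.
  apply/prod_measurable_funP; split.
    exact: (@measurable_rV_coord _ n.+1 ord0).
  apply: measurable_fun_rVP => i.
  rewrite (_ : _ \o _ = rV_coord (lift ord0 i)); first exact: measurable_rV_coord.
  by apply/funext => v; rewrite /rV_coord /= mxE.
exists (fun k => g @^-1` F k).
  by rewrite -preimage_bigcup -TF preimage_setT.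
move=> k; have [mFk Fkoo] := Foo k; split.
  by rewrite -[X in measurable X]setTI; exact: mg.
rewrite /lebesgue_rV_step /pushforward -comp_preimage.
by rewrite (_ : g \o _ = id)// funeqE.
Qed.

HB.instance Definition _ := Measure_isSigmaFinite.Build _ _ _ lebesgue_rV_step
  step_sigma_finite.

End step.

(* Lebesgue measure on (the Borel sets of) R^n, as the iterated product of the
   Lebesgue measure on the line. *)
Fixpoint lebesgue_rV n : {sigma_finite_measure set 'rV[R]_n -> \bar R} :=
  if n is n'.+1 then lebesgue_rV_step (lebesgue_rV n')
  else \d_(0 : 'rV[R]_0).

End lebesgue_rV.

Lemma lebesgue_rV_prod (R : realType) n (A : 'I_n -> set (measurableTypeR R)) :
  (forall i, measurable (A i)) ->
  lebesgue_rV n [set v : 'rV[R]_n | forall i, A i (v ord0 i)] =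
  (\prod_(i < n) lebesgue_measure (A i))%E.
Proof.
elim: n A => [|n IHn] A mA.
  rewrite big_ord0 /= diracE mem_set//; first by case.
rewrite big_ord_recl /= /lebesgue_rV_step /pushforward.
rewrite (_ : _ @^-1` _ = A ord0 `*`
    [set v : 'rV[R]_n | forall i, A (lift ord0 i) (v ord0 i)]); last first.
  rewrite predeqE => -[x v]; split => /=.
    move=> Av; split=> [|i]; first by have := Av ord0; rewrite mxE unlift_none.
    by have := Av (lift ord0 i); rewrite mxE liftK.
  by move=> [A0 Av] i; rewrite mxE; case: unliftP => [j|] ->.
rewrite product_measure1E//.
  by congr (_ * _)%E; exact: (IHn (fun i => A (lift ord0 i))).
rewrite (_ : mkset _ =
    \bigcap_(i in [set: 'I_n]) (rV_coord i @^-1` A (lift ord0 i))).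
  apply: fin_bigcap_measurable; first exact: finite_finset.
  move=> i _; rewrite -[X in measurable X]setTI.
  exact: measurable_rV_coord.
by rewrite predeqE => v; split=> Av i; [move=> _|]; exact: Av.
Qed.

Section analysis_rV.
Context {R : realType} {n : nat}.
Implicit Types (D : set 'rV[R]_n) (f : 'rV[R]_n -> R) (x u v : 'rV[R]_n).

(* The library norm `|x| on row vectors is the sup norm. *)
Definition enorm x : R := Num.sqrt (\sum_(i < n) x ord0 i ^+ 2).

Definition cube (c d : R) : set 'rV[R]_n :=
  [set u | forall i, c <= u ord0 i <= d].

(* Stated with the library norm; equivalent to the Euclidean version. *)
Definition locally_lipschitz f :=
  forall x, exists2 U, nbhs x U & [lipschitz f y | y in U].

Definition partial (i : 'I_n) f x : R := 'D_(delta_mx ord0 i) f x.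

Definition grad f x : 'rV[R]_n := \row_i partial i f x.

(* [lebesgue_rV n] lives on the Borel sets: a function is Lebesgue integrable
   when it is almost everywhere equal to a Borel integrable one. *)
Definition lebesgue_integrable D f :=
  exists2 g : 'rV[R]_n -> R, (lebesgue_rV n).-integrable D (EFin \o g) &
    {ae lebesgue_rV n, forall u, D u -> f u = g u}.

Definition Rintegral_rV d (T : measurableType d)
    (mu : {measure set T -> \bar R}) (D : set T) (F : T -> 'rV[R]_n) : 'rV[R]_n :=
  \row_i (\int[mu]_(t in D) F t ord0 i).

Definition set_coord u (i : 'I_n) (s : R) : 'rV[R]_n :=
  \row_j if j == i then s else u ord0 j.

End analysis_rV.

Definition abs_continuous (R : realType) (c d : R) (g : R -> R) :=
  forall e, 0 < e -> exists2 delta, 0 < delta &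
    forall (N : nat) (x y : 'I_N -> R),
      (forall j, c <= x j /\ x j <= y j /\ y j <= d) ->
      (forall j l, j != l -> y j <= x l \/ y l <= x j) ->
      \sum_(j < N) (y j - x j) < delta ->
      \sum_(j < N) `|g (y j) - g (x j)| < e.

Section stability.
Context {R : realType} {n : nat}.
Implicit Types (g : R -> 'rV[R]_n -> 'rV[R]_n) (x p : 'rV[R]_n) (t : R).

(* "Decreasing" in the second argument is read non-strictly. *)
Definition class_KL (beta : R -> R -> R) :=
  [/\ forall r s, 0 <= r -> 0 <= s -> 0 <= beta r s,
      {within [set q : R * R | 0 <= q.1 /\ 0 <= q.2],
        continuous (fun q => beta q.1 q.2)},
      forall s, 0 <= s -> beta 0 s = 0 /\
        (forall r r', 0 <= r -> r < r' -> beta r s < beta r' s) &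
      forall r, 0 < r ->
        (forall s s', 0 <= s -> s <= s' -> beta r s' <= beta r s) /\
        beta r s @[s --> +oo] --> (0 : R)].

(* z is a (classical) solution of z' = g(t, z), z(t0) = x0, on [t0, b[. *)
Definition solves g t0 x0 (b : \bar R) (z : R -> 'rV[R]_n) :=
  [/\ z t0 = x0,
      {within [set t | t0 <= t /\ (t%:E < b)%E], continuous z} &
      forall t, t0 < t -> (t%:E < b)%E -> is_derive t 1 z (g t (z t))].

(* Solutions exist, every solution is (extends to one) defined for all t >= t0,
   and satisfies P. *)
Definition solutions_global g t0 x0 (P : R -> 'rV[R]_n -> Prop) :=
  [/\ exists z, solves g t0 x0 +oo%E z,
      forall b z, (t0%:E < b)%E -> solves g t0 x0 b z ->
        exists2 z', solves g t0 x0 +oo%E z' &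
          forall t, t0 <= t -> (t%:E < b)%E -> z' t = z t &
      forall z, solves g t0 x0 +oo%E z -> forall t, t0 <= t -> P t (z t)].

Definition GUAS g p :=
  exists2 beta, class_KL beta & forall t0 x0,
    solutions_global g t0 x0 (fun t z =>
      enorm (z - p) <= beta (enorm (x0 - p)) (t - t0)).

(* f t x eps is the right-hand side. *)
Definition PGUAS (eps0 : R) (f : R -> 'rV[R]_n -> R -> 'rV[R]_n) p :=
  exists2 beta, class_KL beta & forall Delta nu, 0 < Delta -> 0 < nu ->
    exists2 epss, 0 < epss <= eps0 & forall t0 x0 eps,
      enorm (x0 - p) <= Delta -> 0 < eps -> eps < epss ->
      solutions_global (fun t x => f t x eps) t0 x0 (fun t x =>
        enorm (x - p) <= beta (enorm (x0 - p)) (t - t0) + nu).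

End stability.

Section extremum_seeking.
Context {R : realType} {n : nat}.
Variables (J : 'rV[R]_n -> R) (a : R) (homega : 'rV[R]_n) (phi : R -> R).
Variables (m : 'I_n -> 'rV[R]_n -> R) (kappa : 'rV[R]_n -> R).

Definition rationally_independent :=
  forall l : 'rV[rat]_n, l != 0 ->
    \sum_(i < n) ratr (l ord0 i) * homega ord0 i != 0.

Definition dither (theta : 'rV[R]_n) : 'rV[R]_n := \row_i phi (theta ord0 i).

Definition signal_u (omega t : R) := dither ((omega * t) *: homega).

Definition signal_S (omega t : R) : 'rV[R]_n := a *: signal_u omega t.

Definition signal_M (omega t : R) : 'rV[R]_n :=
  \row_i (a^-1 * m i (signal_u omega t)).

Definition time_average (omega T t0 : R) (x : 'rV[R]_n) : 'rV[R]_n :=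
  T^-1 *: Rintegral_rV (@lebesgue_measure R) `[t0, t0 + T]
    (fun t => J (x + signal_S omega t) *: signal_M omega t).

Definition smoothed (x : 'rV[R]_n) : R :=
  \int[lebesgue_rV n]_(u in cube (-1) 1) (J (x + a *: u) * kappa u).

Definition fast_field (k omega t : R) (x : 'rV[R]_n) : 'rV[R]_n :=
  - ((k * J (x + signal_S omega t)) *: signal_M omega t).

Definition G_field (x theta : 'rV[R]_n) : 'rV[R]_n :=
  \row_i (a^-1 * J (x + a *: dither theta) * m i (dither theta)).

Definition slow_field (s : R) (x : 'rV[R]_n) (eps : R) : 'rV[R]_n :=
  - G_field x ((s / eps) *: homega).

End extremum_seeking.

(* Main.v *)
(* J is differentiable almost everywhere along coordinate lines, and kappa is
   absolutely continuous and vanishes at the ends of those lines, so integration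
   by parts turns the integral of (d_i J)(x + a u) kappa(u) into that of
   a^-1 J(x + a u) m_i(u) rho(u), which is the mean over the torus of the field
   theta |-> a^-1 J(x + a Phi(theta)) m_i(Phi(theta)).  That torus mean depends
   on x in a locally Lipschitz way, so the smoothed function has continuous
   partial derivatives.  The torus mean is also the time average along the
   dither, uniformly in the starting time: Lipschitz functions of Phi(theta) are
   uniform limits of trigonometric polynomials, for which nonresonance gives the
   rate O(1/T).

   For the stability part, averaging over steps of a fixed small length shows
   that on a fixed time horizon T the solutions follow those of the averaged
   gradient flow.  Choose r with beta(r, 0) <= nu / 2 and T with
   beta(Delta, T) <= r / 2: each time interval of length T then brings the
   solution back into the ball of radius r, where it stays nu-close to the
   equilibrium until the next restart.  Hence the function beta of the averaged
   flow also serves for the perturbed one. *)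

From HB Require Import structures.
Require Import Defs.
From mathcomp Require Import all_boot all_order all_algebra.
From mathcomp Require Import all_classical all_reals all_analysis.
From mathcomp Require Import measurable_realfun.
From mathcomp Require Import ring lra zify.

Set Implicit Arguments.
Unset Strict Implicit.
Unset Printing Implicit Defensive.

Import Order.TTheory GRing.Theory Num.Theory.
Import numFieldNormedType.Exports.

Local Open Scope classical_set_scope.
Local Open Scope ring_scope.

(** * Absolutely continuous functions on the line *)

(** [J] is only locally Lipschitz, whereas differentiation under the integral, Picard iteration and
    averaging want global bounds. They are applied to functions composed with [clamp], the
    coordinatewise projection onto a cube, and the cube is chosen so large that the clamped objects
    agree with the original ones wherever it matters; for trajectories this is read off the
    stability estimate itself. Integration by parts needs only partial derivatives, so
    differentiability of Lipschitz functions on lines and Fubini are enough, provided that the set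
    of bad points is Borel; as the derivatives exist only almost everywhere, each is traded for a
    Borel representative before integrals are split. Since [kappa] is merely absolutely continuous
    on lines, the fundamental theorem of calculus is proved for such functions. On an infinite
    horizon averaging errors would accumulate. Comparing each time window with a fresh averaged
    solution that starts at the current point avoids this: the contraction given by [beta] absorbs
    the error of one window before the next begins. *)

Lemma ae_imp d (T : measurableType d) (R : realType)
    (mu : {measure set T -> \bar R}) (P Q : T -> Prop) :
  (forall x, P x -> Q x) -> {ae mu, forall x, P x} -> {ae mu, forall x, Q x}.
Proof. by move=> PQ; apply: negligibleS => x /= nQ /PQ. Qed.

Lemma ae_imp2 d (T : measurableType d) (R : realType)
    (mu : {measure set T -> \bar R}) (P Q S : T -> Prop) :
  (forall x, P x -> Q x -> S x) ->
  {ae mu, forall x, P x} -> {ae mu, forall x, Q x} -> {ae mu, forall x, S x}.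
Proof.
move=> PQS aP aQ; have := negligibleU aP aQ; apply: negligibleS => x /= nS.
by case: (pselect (P x)) => Px; [right => Qx; apply: nS; exact: PQS|left].
Qed.

Section absolutely_continuous.
Context {R : realType}.
Notation mu := (@lebesgue_measure R).

Lemma is_derive_approx (f : R -> R) (t df e : R) : is_derive t 1 f df -> 0 < e ->
  exists2 r, 0 < r & forall u, `|u - t| < r ->
    `|f u - f t - df * (u - t)| <= e * `|u - t|.
Proof.
move=> [ft ftE] e0; move: ft; rewrite /derivable => /cvg_ex[l fl].
have {ftE}lE : l = df by rewrite -ftE; apply/esym/cvg_lim.
move/cvgrPdist_le : fl => /(_ _ e0); rewrite near_withinE => /nbhs_ballP[r /= r0 fr].
exists r => // u ur; have [->|ut] := eqVneq u t.
  by rewrite !subrr mulr0 subrr !normr0 mulr0.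
have ut0 : u - t != 0 by rewrite subr_eq0.
have := fr (u - t); rewrite /ball/= sub0r normrN => /(_ ur ut0).
rewrite /= [(u - t)%:A]mulr1 subrK lE /GRing.scale /= => H.
have -> : f u - f t - df * (u - t) = - ((df - (u - t)^-1 * (f u - f t)) * (u - t)).
  by field.
by rewrite normrN normrM ler_wpM2r.
Qed.

Definition increment_sum (h : R -> R) (s : seq (R * R)) :=
  \sum_(p <- s) `|h p.2 - h p.1|.

(** Lists replace families indexed by ['I_N] because the exhaustion argument below adds one interval
    at a time. The [pairwise] condition lists the intervals from right to left, so a new rightmost
    interval is simply consed. *)
Lemma abs_continuous_increment_sum (c d : R) (h : R -> R) (e : R) :
  abs_continuous c d h -> 0 < e ->
  exists2 del, 0 < del & forall s : seq (R * R),
    all (fun p => [&& c <= p.1, p.1 <= p.2 & p.2 <= d]) s ->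
    pairwise (fun p q => q.2 <= p.1) s ->
    \sum_(p <- s) (p.2 - p.1) < del -> increment_sum h s < e.
Proof.
move=> ach e0; have [del del0 hd] := ach e e0.
exists del => // s sin spw slt.
rewrite /increment_sum (big_nth (0, 0)) big_mkord.
apply: (hd (size s) (fun j => (nth (0, 0) s j).1) (fun j => (nth (0, 0) s j).2)).
- by move=> j; have /(_ _ (ltn_ord j))/and3P[] := all_nthP (0, 0) sin.
- move=> j l jl; have pw := pairwiseP (0, 0) spw.
  case: (ltngtP j l) => [jl'|lj|/val_inj jl'].
  + by right; apply: pw => //=; exact: ltn_ord.
  + by left; apply: pw => //=; exact: ltn_ord.
  + by rewrite jl' eqxx in jl.
- by move: slt; rewrite (big_nth (0, 0)) big_mkord.
Qed.

(* Exhausts [c, d] by steps on which either h is almost flat or which lie in the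
   set O (later an open set of small measure around the exceptional points). *)
Section cousin.
Variables (c d e : R) (h : R -> R) (O : set R).
Hypotheses (cd : c <= d) (e_ge0 : 0 <= e) (mO : measurable O).
Hypothesis flat : forall t, c <= t <= d -> exists2 r, 0 < r &
  forall u v, c <= u -> u <= v -> v <= d -> t - r < u -> v < t + r ->
    u <= t -> t <= v ->
    (`|h t - h u| <= e * (t - u) /\ `|h v - h t| <= e * (v - t)) \/
    `]u, v] `<=` O.

(** The total length is bounded by the measure of [O] up to [x], not of all of [O]: a new interval
    inside [O] then raises both sides by exactly its length. *)
Let good (x : R) := c <= x <= d /\ exists s : seq (R * R),
  [/\ all (fun p => [&& c <= p.1, p.1 <= p.2 & p.2 <= x]) s,
      pairwise (fun p q => q.2 <= p.1) s,
      ((\sum_(p <- s) (p.2 - p.1))%:E <= mu (O `&` `]c, x]))%E &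
      `|h x - h c| <= e * (x - c) + increment_sum h s].

Let good_c : good c.
Proof.
split; first by rewrite lexx cd.
exists [::]; split => //=; first by rewrite big_nil.
by rewrite /increment_sum big_nil !subrr normr0 mulr0 addr0.
Qed.

Let good_step u v : good u -> u <= v -> v <= d ->
  `|h v - h u| <= e * (v - u) \/ `]u, v] `<=` O -> good v.
Proof.
move=> [/andP[cu ud] [s [sin spw slen sinc]]] uv vd hO.
split; first by rewrite vd (le_trans cu).
have mOI x y : measurable (O `&` `]x, y]) by apply: measurableI.
have tri : `|h v - h c| <= `|h v - h u| + `|h u - h c|.
  by rewrite (le_trans _ (ler_normD _ _))// addrA subrK.
case: hO => [huv|uvO].
  exists s; split => //.
  - by apply: sub_all sin => p /and3P[-> -> pu]; rewrite (le_trans pu).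
  - apply: (le_trans slen); apply: le_measure; rewrite ?inE; [exact: mOI|exact: mOI|].
    apply: setIS => x /=; rewrite !in_itv/= => /andP[-> /le_trans]; exact.
  - apply: (le_trans tri); move: huv sinc; nra.
exists ((u, v) :: s); split => /=.
- rewrite cu uv lexx /=.
  by apply: sub_all sin => p /and3P[-> -> pu]; rewrite (le_trans pu).
- by rewrite spw andbT; apply: sub_all sin => p /and3P[].
- rewrite big_cons /= EFinD.
  have -> : O `&` `]c, v] = `]u, v] `|` (O `&` `]c, u]).
    apply/seteqP; split => x /=; rewrite !in_itv/=.
      by move=> [Ox /andP[cx ->]]; case: (ltP u x) => [|xu]; [left|right; rewrite cx].
    move=> [uxv|[Ox /andP[-> xu]]]; last by rewrite (le_trans xu).
    split; first exact: uvO.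
    by move/andP: uxv => [/(le_lt_trans cu) -> ->].
  have dis : `]u, v] `&` (O `&` `]c, u]) = set0 :> set R.
    apply/seteqP; split => x //=; rewrite !in_itv/=.
    by move=> [/andP[ux _] [_ /andP[_]]]; rewrite leNgt ux.
  have -> : mu (`]u, v] `|` (O `&` `]c, u])) = (mu `]u, v] + mu (O `&` `]c, u]))%E.
    by apply: measureU => //; exact: mOI.
  have -> : mu `]u, v] = if u < v then (v - u)%:E else 0%E.
    by rewrite lebesgue_measure_itv/= lte_fin.
  case: ltP => [_|vu]; first by rewrite leeD2l.
  have -> : v = u by apply/eqP; rewrite eq_le uv vu.
  by rewrite subrr leeD2l.
- rewrite /increment_sum big_cons /=; apply: (le_trans tri).
  have : 0 <= e * (v - u) by rewrite mulr_ge0// subr_ge0.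
  by move: sinc; rewrite /increment_sum; nra.
Qed.

Lemma cousin_increment : exists s : seq (R * R),
  [/\ all (fun p => [&& c <= p.1, p.1 <= p.2 & p.2 <= d]) s,
      pairwise (fun p q => q.2 <= p.1) s,
      ((\sum_(p <- s) (p.2 - p.1))%:E <= mu O)%E &
      `|h d - h c| <= e * (d - c) + increment_sum h s].
Proof.
suff [_ [s [sin spw slen sinc]]] : good d.
  exists s; split => //; apply: (le_trans slen).
  by apply: le_measure; rewrite ?inE//; exact: measurableI.
(* At the supremum [t], [flat] covers a step from a good point just left of [t] to any point just
   right of it, so goodness cannot stop before [d]. A flat step is split at [t], since flatness only
   compares values with [h t]. *)
pose S := [set x | good x]; pose t := sup S.
have S0 : S !=set0 by exists c.
have hsS : has_sup S by split => //; exists d => x [/andP[]].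
have ct : c <= t by apply: sup_upper_bound.
have td : t <= d by apply: sup_le_ub => // x [/andP[]].
have [r r0 hr] : exists2 r, 0 < r &
  forall u v, c <= u -> u <= v -> v <= d -> t - r < u -> v < t + r ->
    u <= t -> t <= v ->
    (`|h t - h u| <= e * (t - u) /\ `|h v - h t| <= e * (v - t)) \/
    `]u, v] `<=` O by apply: flat; rewrite ct td.
have [u Su ru] := sup_adherent r0 hsS.
have ut : u <= t by apply: sup_upper_bound.
have [/andP[cu ud] _] := Su.
have gv v : t <= v -> v <= d -> v < t + r -> good v.
  move=> tv vd vr; have uv := le_trans ut tv.
  case: (hr u v cu uv vd ru vr ut tv) => [[h1 h2]|uvO].
    apply: (@good_step t v) => //; last by left.
    by apply: (@good_step u t) => //; left.
  by apply: (@good_step u v) => //; right.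
have [dt|tdr] := ltP d (t + r); first exact: gv.
have : good (t + r / 2) by apply: gv; lra.
move=> /(sup_upper_bound hsS); rewrite -/t; lra.
Qed.

End cousin.

(** Where the derivative vanishes [h] is nearly flat, and the exceptional null set lies in an open
    set so small that absolute continuity bounds the increments over it by [e1]. The total is at
    most [e1 * (d - c) + e1], which explains the choice of [e1]. *)
Lemma abs_continuous_derive0 (c d : R) (h : R -> R) : c <= d ->
  abs_continuous c d h ->
  {ae mu, forall s, s \in `]c, d[ -> is_derive s 1 h 0} -> h d = h c.
Proof.
move=> cd ach [N [mN N0 dN]]; apply/eqP; rewrite -subr_eq0 -normr_le0.
apply/ler_addgt0Pl => _/posnumP[e]; rewrite addr0.
pose e1 := e%:num / (d - c + 1).
have dc1 : 0 < d - c + 1 by lra.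
have e1_gt0 : 0 < e1 by rewrite divr_gt0.
have [del del0 hdel] := abs_continuous_increment_sum ach e1_gt0.
(* The derivative is only known inside the interval, so the endpoints join the exceptional set. *)
pose N' := N `|` [set c] `|` [set d].
have mN' : measurable N' by apply: measurableU => //; apply: measurableU.
have N'0 : mu N' = 0.
  rewrite /N' !measureU0//; first exact: lebesgue_measure_set1.
    exact: measurableU.
  exact: lebesgue_measure_set1.
have [W [oW NW Wdel]] : exists U : set R,
    [/\ open U, N' `<=` U & (mu (U `\` N') < del%:E)%E].
  have N'lt : (mu N' < +oo)%E by rewrite N'0.
  exact: lebesgue_regularity_outer.
have mW : measurable W by exact: open_measurable.
have muW : (mu W < del%:E)%E.
  have -> : W = (W `\` N') `|` N' :> set R.
    by apply/seteqP; split => [x Wx|x [[]//|/NW//]]; case: (pselect (N' x)); [right|left].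
  apply: le_lt_trans Wdel; rewrite -[leRHS]adde0 -N'0.
  by apply: measureU2 => //; exact: measurableD.
have e1_ge0 := ltW e1_gt0.
have [|s [sin spw slen sinc]] := @cousin_increment c d e1 h W cd e1_ge0 mW.
  move=> t /andP[ct td]; have [Wt|nWt] := pselect (W t).
    have /nbhs_ballP[r /= r0 rW] : nbhs t W by exact: open_nbhs_nbhs.
    exists r => // u v cu uv vd tu vt ut tv; right => x /=; rewrite in_itv/= =>
      /andP[ux xv].
    by apply: rW; rewrite /ball/= ltr_norml; lra.
  have tcd : t \in `]c, d[.
    rewrite in_itv/= !lt_neqAle ct td !andbT; apply/andP; split; apply/eqP => tt.
      by apply: nWt; apply: NW; left; right; rewrite tt.
    by apply: nWt; apply: NW; right; rewrite tt.
  have [ht h0] : is_derive t 1 h 0.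
    apply: contrapT => nd; apply: nWt; apply: NW; left; left; apply: dN => /=.
    by move=> /(_ tcd).
  have [r r0 hr] := is_derive_approx (DeriveDef ht h0) e1_gt0.
  exists r => // u v cu uv vd tu vt ut tv; left; split.
    have : `|u - t| < r by rewrite ler0_norm; lra.
    move=> /hr; rewrite mul0r subr0 distrC => /le_trans; apply.
    by rewrite ler0_norm ?opprB//; lra.
  have : `|v - t| < r by rewrite ger0_norm; lra.
  move=> /hr; rewrite mul0r subr0 => /le_trans; apply.
  by rewrite ger0_norm//; lra.
apply: (le_trans sinc).
have : increment_sum h s < e1.
  by apply: hdel => //; rewrite -lte_fin (le_lt_trans slen).
have : e1 * (d - c + 1) = e%:num by rewrite /e1 divfK// gt_eqF.
lra.
Qed.

Lemma bigsetU_itv_measure (N : nat) (x y : 'I_N -> R) :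
  (forall j, x j <= y j) ->
  (forall j l, j != l -> y j <= x l \/ y l <= x j) ->
  trivIset setT (fun j => `]x j, y j]%classic) /\
  mu (\big[setU/set0]_(j < N) `]x j, y j]%classic) = (\sum_(j < N) (y j - x j))%:E.
Proof.
move=> xy dis.
have tr : trivIset setT (fun j => `]x j, y j]%classic).
  apply/trivIsetP => j l _ _ jl; apply/seteqP; split => // z /=.
  rewrite !in_itv/= => -[/andP[xz zy] /andP[xz' zy']].
  by case: (dis j l jl) => h; lra.
split => //.
have -> : mu (\big[setU/set0]_(j < N) `]x j, y j]%classic) =
    (\sum_(j < N) mu `]x j, y j])%E by apply: measure_bigsetU_ord.
rewrite -sumEFin; apply: eq_bigr => j _.
have -> : mu `]x j, y j] = if x j < y j then (y j - x j)%:E else 0%E.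
  by rewrite lebesgue_measure_itv/= lte_fin.
have := xy j; rewrite le_eqVlt => /orP[/eqP->|->//].
by rewrite ltxx subrr.
Qed.

Lemma abs_continuous_integral (g : R -> R) (c d : R) :
  mu.-integrable setT (EFin \o g) ->
  abs_continuous c d (fun x => \int[mu]_(t in `]-oo, x]) g t).
Proof.
move=> ig e e0.
have [del [del0 hdel]] := integral_normr_continuous ig e0.
exists del => // N x y cxyd dis slt.
have xy j : x j <= y j by have [_ []] := cxyd j.
have [tr muU] := bigsetU_itv_measure xy dis.
pose U := \big[setU/set0]_(j < N) `]x j, y j]%classic.
have mU : measurable U by apply: bigsetU_measurable.
have ig' A : measurable A -> mu.-integrable A (EFin \o g).
  by move=> mA; apply: integrableS ig.
have ign A : measurable A -> mu.-integrable A (EFin \o (fun x => `|g x|)).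
  move=> mA; have := integrable_abse (ig' _ mA); apply: eq_integrable => //.
have Ult : (mu U < del%:E)%E by rewrite muU lte_fin.
apply: le_lt_trans (hdel U mU Ult).
have -> : \int[mu]_(t in U) `|g t| = \sum_(j < N) \int[mu]_(t in `]x j, y j]) `|g t|.
  rewrite /Rintegral integral_bigsetU_EFin//=.
  - rewrite -sum_fine//= => j _; apply: integrable_fin_num => //.
    exact: ign.
  - by rewrite index_enum_uniq.
  - by apply: sub_trivIset tr.
  - by apply: measurable_int (ign _ mU).
apply: ler_sum => j _.
  rewrite Rintegral_itvB//; first by apply: le_normr_Rintegral => //; exact: ig'.
    exact: ig'.
  by rewrite bnd_simp xy.
Qed.

Lemma abs_continuousB (c d : R) (f g : R -> R) :
  abs_continuous c d f -> abs_continuous c d g -> abs_continuous c d (f \- g).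
Proof.
move=> acf acg e e0; have e20 : 0 < e / 2 by rewrite divr_gt0.
have [d1 d10 h1] := acf _ e20; have [d2 d20 h2] := acg _ e20.
exists (Num.min d1 d2); first by rewrite lt_min d10.
move=> N x y xyb dis; rewrite lt_min => /andP[s1 s2].
rewrite [e]splitr; apply: le_lt_trans (ltrD (h1 N x y xyb dis s1) (h2 N x y xyb dis s2)).
rewrite -big_split/=; apply: ler_sum => j _.
by rewrite opprD addrACA -opprD ler_normB.
Qed.

(** The difference between [f] and a primitive of [g] is absolutely continuous with derivative zero
    almost everywhere, hence takes equal values at both ends. The primitive is that of [g] extended
    by zero, taken from minus infinity. *)
Lemma abs_continuous_FTC (c d : R) (f g : R -> R) : c <= d ->
  abs_continuous c d f -> mu.-integrable `[c, d] (EFin \o g) ->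
  {ae mu, forall s, s \in `]c, d[ -> is_derive s 1 f (g s)} ->
  \int[mu]_(s in `[c, d]) g s = f d - f c.
Proof.
move=> cd acf ig df.
pose g0 := g \_ `[c, d].
have ig0 : mu.-integrable setT (EFin \o g0).
  have /integrable_mkcond := ig; rewrite -restrict_EFin; exact.
pose G x := \int[mu]_(t in `]-oo, x]) g0 t.
have acG : abs_continuous c d G by exact: abs_continuous_integral.
have := abs_continuous_derive0 cd (abs_continuousB acf acG).
have dG : {ae mu, forall x, derivable G x 1 /\ (G^`() x = g0 x)%classic}.
  apply: FTC1Ny; first by move=> y; apply: integrableS ig0.
  by rewrite /g0; apply: integrable_locally.
have dh : {ae mu, forall s, s \in `]c, d[ -> is_derive s 1 (f \- G) 0}.
  apply: ae_imp2 dG df => s [dG1 dG2] h scd.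
  apply: is_derive_eq.
    apply: is_deriveB; first exact: h.
    by apply: DeriveDef dG1 _; rewrite -derive1E.
  rewrite dG2 /g0 patchE mem_set ?subrr//=.
  by move: scd; apply: subset_itv_oo_cc.
move=> /(_ dh) /= fG; have -> : f d - f c = G d - G c by lra.
rewrite Rintegral_itvB//; last by apply: integrableS ig0.
rewrite -(@Rintegral_itv_obnd_cbnd _ c (BRight d)).
  apply: eq_Rintegral => s; rewrite inE => scd.
  rewrite /g0 patchE mem_set//=; move: scd; rewrite /= !in_itv/= => /andP[/ltW -> ->]//.
by apply: integrableS ig => //; apply: subset_itv_oc_cc.
Qed.

Lemma abs_continuousM (c d : R) (f g : R -> R) B :
  (forall s, c <= s <= d -> `|f s| <= B) -> (forall s, c <= s <= d -> `|g s| <= B) ->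
  abs_continuous c d f -> abs_continuous c d g -> abs_continuous c d (f \* g).
Proof.
move=> fB gB acf acg e e0.
have B1 : 0 < `|B| + 1 by rewrite ltr_wpDl.
have e20 : 0 < e / 2 / (`|B| + 1) by rewrite !divr_gt0.
have [d1 d10 h1] := acf _ e20; have [d2 d20 h2] := acg _ e20.
exists (Num.min d1 d2); first by rewrite lt_min d10.
move=> N x y xyb dis; rewrite lt_min => /andP[s1 s2].
have {}h1 := h1 N x y xyb dis s1; have {}h2 := h2 N x y xyb dis s2.
apply: (@le_lt_trans _ _ ((`|B| + 1) * (\sum_(j < N) `|f (y j) - f (x j)| +
   \sum_(j < N) `|g (y j) - g (x j)|))).
  rewrite -big_split mulr_sumr/=; apply: ler_sum => j _.
  have [cx [xy yd]] := xyb j.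
  have -> : f (y j) * g (y j) - f (x j) * g (x j) =
    (f (y j) - f (x j)) * g (y j) + f (x j) * (g (y j) - g (x j)) by ring.
  apply: (le_trans (ler_normD _ _)); rewrite !normrM mulrDr.
  have gy : `|g (y j)| <= `|B| + 1.
    by rewrite (le_trans (gB _ _)) ?(le_trans cx)// (le_trans (ler_norm _))// lerDl.
  have fx : `|f (x j)| <= `|B| + 1.
    by rewrite (le_trans (fB _ _)) ?cx ?(le_trans xy)// (le_trans (ler_norm _))// lerDl.
  by apply: lerD; [rewrite mulrC|]; apply: ler_wpM2r.
have -> : e = (`|B| + 1) * (e / 2 / (`|B| + 1) + e / 2 / (`|B| + 1)).
  by field; rewrite gt_eqF.
by rewrite ltr_pM2l// ltrD.
Qed.

Lemma lipschitz_abs_continuous (c d : R) (f : R -> R) (L : R) :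
  (forall s t, c <= s <= d -> c <= t <= d -> `|f s - f t| <= L * `|s - t|) ->
  abs_continuous c d f.
Proof.
move=> fL e e0; have L1 : 0 < `|L| + 1 by rewrite ltr_wpDl.
exists (e / (`|L| + 1)); first by rewrite divr_gt0.
move=> N x y xyb _; rewrite ltr_pdivlMr// mulrC mulr_sumr; apply: le_lt_trans.
apply: ler_sum => j _; have [cx [xy yd]] := xyb j.
rewrite (le_trans (fL _ _ _ _)) ?(le_trans cx xy) ?cx ?(le_trans xy yd)//.
rewrite [`|y j - _|]ger0_norm ?subr_ge0// ler_wpM2r ?subr_ge0//.
by rewrite (le_trans (ler_norm _))// lerDl.
Qed.

End absolutely_continuous.

Lemma lipschitz_continuous (R : realType) (V W : normedModType R) (f : V -> W) (L : R) :
  (forall x y, `|f x - f y| <= L * `|x - y|) -> continuous f.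
Proof.
move=> fL x; have L1 : 0 < `|L| + 1 by rewrite ltr_wpDl.
apply/cvgrPdist_le => e e0; apply/nbhs_ballP; exists (e / (`|L| + 1)) => /=.
  by rewrite divr_gt0.
move=> y; rewrite -ball_normE/= ltr_pdivlMr// mulrC => /ltW; apply: le_trans.
rewrite (le_trans (fL _ _))// ler_wpM2r//.
by rewrite (le_trans (ler_norm _))// lerDl.
Qed.

(** * Almost everywhere differentiability of Lipschitz functions of one variable *)

Section lipschitz_derivable.
Context {R : realType}.
Notation mu := (@lebesgue_measure R).

Section one_lipschitz.
Variable f : R -> R.
Hypothesis f1 : forall s t, `|f s - f t| <= `|s - t|.

Let F (c : R) x := (x + c * f x) / 2.

Let F_nd (c : R) : c = 1 \/ c = -1 -> {homo F c : x y / x <= y}.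
Proof.
move=> c1 x y xy; rewrite /F ler_pM2r ?invr_gt0//.
have := f1 y x; rewrite [`|y - x|]ger0_norm ?subr_ge0// ler_norml.
by case: c1 => ->; lra.
Qed.

Let F_cont (c : R) : c = 1 \/ c = -1 -> continuous (F c).
Proof.
move=> c1; apply: (@lipschitz_continuous _ _ _ _ 1) => x y; rewrite /F.
rewrite -mulrBl normrM normfV mul1r [`|2|]ger0_norm// ler_pdivrMr//.
have -> : x + c * f x - (y + c * f y) = (x - y) + c * (f x - f y) by ring.
rewrite (le_trans (ler_normD _ _))// mulr_natr mulr2n lerD2l normrM.
by case: c1 => ->; rewrite ?normrN normr1 mul1r.
Qed.

Let F_rc (c : R) : c = 1 \/ c = -1 -> right_continuous (F c).
Proof. by move=> c1 x; apply: right_continuousW; exact: F_cont. Qed.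

Let c1 : 1 = 1 :> R \/ 1 = -1 :> R. Proof. by left. Qed.
Let cN1 : -1 = 1 :> R \/ -1 = -1 :> R. Proof. by right. Qed.

(* Lebesgue measure is the sum of the Stieltjes measures of (x + f x) / 2 and
   (x - f x) / 2, so the first one has a density, and its primitive F 1 is
   differentiable almost everywhere. *)
Let F1 : cumulative R R := HB.pack (F 1) (isCumulative.Build R _ R (F 1) (F_nd c1)
  (F_rc c1)).
Let FN1 : cumulative R R := HB.pack (F (-1)) (isCumulative.Build R _ R (F (-1)) (F_nd
  cN1) (F_rc cN1)).

Let nu := lebesgue_stieltjes_measure F1.
Let nu' := lebesgue_stieltjes_measure FN1.

Let nuE (G : cumulative R R) a b : a <= b ->
  lebesgue_stieltjes_measure G `]a, b]%classic = (G b - G a)%:E.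
Proof.
move=> ab; rewrite /lebesgue_stieltjes_measure /measure_extension/=.
rewrite measurable_mu_extE/=; last exact: is_ocitv.
by rewrite wlength_itv_bnd.
Qed.

Let mu_nu A : measurable A -> mu A = (nu A + nu' A)%E.
Proof.
move=> mA; rewrite -measure_addE.
apply: lebesgue_measure_unique => // X [[a b] _ <-].
suff E : mu `]a, b]%classic = (nu `]a, b]%classic + nu' `]a, b]%classic)%E.
  by rewrite [LHS]E; exact/esym/measure_addE.
have [ab|ba] := leP a b; last first.
  by rewrite set_itv_ge -?leNgt ?bnd_simp ?(ltW ba)// /nu /nu' !measure0 adde0.
rewrite [LHS](_ : _ = (b - a)%:E); last first.
  rewrite lebesgue_measure_itv/= lte_fin.
  by move: ab; rewrite le_eqVlt => /orP[/eqP->|->//]; rewrite ltxx subrr.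
rewrite /nu /nu' !nuE// -EFinD; congr EFin.
by rewrite /F1 /FN1 /= /F; field.
Qed.

(** Absolute continuity is immediate from [mu_nu], as [nu] is one of two summands of [mu]. The
    restriction to [D] supplies a finite measure for Radon-Nikodym. *)
Let nu_dom (D : set (measurableTypeR R)) (mD : measurable D) (Doo : (nu D < +oo)%E) :
  (mfrestr mD Doo : {finite_measure set _ -> \bar R}) `<< mu.
Proof.
apply/null_content_dominatesP => A mA A0; rewrite /mfrestr /mrestr.
have mAD : measurable (A `&` D) by exact: measurableI.
apply/eqP; rewrite eq_le measure_ge0 andbT.
have A0' : mu A = 0 by exact: A0.
rewrite -A0' mu_nu// (le_trans (y := nu A))//.
  by apply: le_measure; rewrite ?inE//; exact: subIsetl.
by rewrite leeDl.
Qed.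

Let derivable_F_itv (k : nat) :
  {ae mu, forall x, x \in `](- k%:R), k%:R[ -> derivable (F 1) x 1}.
Proof.
have kk : (- k%:R : R) <= k%:R by rewrite (@le_trans _ _ 0)// oppr_le0.
pose D : set (measurableTypeR R) := `](- k%:R), k%:R]%classic.
have mD : measurable D by exact: measurable_itv.
have Doo : (nu D < +oo)%E by rewrite /nu nuE// ltry.
have [g [g0 gfin ig gE]] := radon_nikodym_sigma_finite (nu_dom mD Doo).
pose g1 : R -> R := fine \o g.
have ig1 : mu.-integrable setT (EFin \o g1).
  by apply: eq_integrable ig => // x _ /=; rewrite fineK.
have lg1 : locally_integrable setT g1.
  have -> : g1 = g1 \_ setT by apply/funext => x; rewrite patchE mem_setT.
  exact: integrable_locally.
pose I (x : R) : R := \int[mu]_(t in `](- k%:R), x]) g1 t.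
have H1 : {ae mu, forall x, - k%:R < x -> derivable I x 1}.
  have ig1y y : mu.-integrable [set` Interval (BRight (- k%:R)) (BRight y)] (EFin \o g1).
    by apply: integrableS ig1.
  apply: ae_imp (@FTC1 R g1 (BRight (- k%:R)) ig1y lg1) => x h kx.
  by have [] := h _; rewrite ?bnd_simp.
apply: ae_imp H1 => x dx xk.
have {}dx := dx _.
(* On the window, [F 1 y] is its value at the left end plus [nu] of the interval up to [y], which is
   the primitive [I] of the density. *)
pose H x : R := I x + F 1 (- k%:R).
apply: (@near_eq_derivable _ _ _ H).
  have : \forall y \near x, y \in `](- k%:R), k%:R[ by exact: near_in_itvoo.
  apply: filterS => y; rewrite in_itv/= => /andP[ky yk].
  rewrite /H /I /Rintegral; under eq_integral do rewrite /= fineK//.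
  rewrite -gE//= /mfrestr /mrestr setIidl ?nuE ?subrK//; first exact: ltW.
  by apply: subset_itvl; rewrite bnd_simp ltW.
apply: derivableD => //; apply: dx.
by move: xk; rewrite in_itv/= => /andP[].
Qed.

Lemma one_lipschitz_derivable_ae : {ae mu, forall x, derivable f x 1}.
Proof.
have : {ae mu, forall x, forall k : nat,
    x \in `](- k%:R), k%:R[ -> derivable (F 1) x 1}.
  by apply: ae_foralln => k; exact: derivable_F_itv.
apply: ae_imp => x dF.
have dFx : derivable (F 1) x 1.
  by apply: (dF (Num.bound `|x|)); rewrite in_itv/= -ltr_norml archi_boundP.
have -> : f = (fun y => 2 * F 1 y - y).
  by apply/funext => y; rewrite /F; field.
by apply: derivableB => //; apply: derivableM.
Qed.

End one_lipschitz.

Lemma lipschitz_derivable_ae (f : R -> R) (L : R) :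
  (forall s t, `|f s - f t| <= L * `|s - t|) -> {ae mu, forall x, derivable f x 1}.
Proof.
move=> fL; have L1 : 0 < `|L| + 1 by rewrite ltr_wpDl.
have := @one_lipschitz_derivable_ae (fun x => (`|L| + 1)^-1 * f x).
have fL1 s t : `|(`|L| + 1)^-1 * f s - (`|L| + 1)^-1 * f t| <= `|s - t|.
  rewrite -mulrBr normrM normfV (gtr0_norm L1) mulrC ler_pdivrMr//.
  rewrite mulrC (le_trans (fL _ _))// ler_wpM2r//.
  by rewrite (le_trans (ler_norm _))// lerDl.
move=> /(_ fL1); apply: ae_imp => x dx.
have -> : f = (fun x => (`|L| + 1) * ((`|L| + 1)^-1 * f x)).
  by apply/funext => y; rewrite mulVKf// gt_eqF.
exact: derivableM.
Qed.

End lipschitz_derivable.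

(** * Lebesgue measure on row vectors *)

Section ae_integral.
Import HBNNSimple.

(** A simple function below [f], set to zero on the exceptional null set, lies below [g] and keeps
    its integral; so the supremum defining the integral of [g] is at least as large, whether or not
    [f] and [g] are measurable. *)
Lemma ge0_ae_le_integral d (T : measurableType d) (R : realType)
    (mu : {measure set T -> \bar R}) (f g : T -> \bar R) :
  (forall x, 0 <= f x)%E -> (forall x, 0 <= g x)%E ->
  {ae mu, forall x, (f x <= g x)%E} ->
  (\int[mu]_x f x <= \int[mu]_x g x)%E.
Proof.
move=> f0 g0 [N [mN N0 fgN]].
rewrite (ge0_integralTE mu f0) (ge0_integralTE mu g0).
apply: ge_ereal_sup => _ [h /= hf <-].
have mNC : measurable (~` N) by exact: measurableC.
apply: ereal_sup_ubound; exists (proj_nnsfun h mNC) => /=.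
  move=> x; rewrite mindicE; have [xN|xN] := boolP (x \in ~` N); last by rewrite mulr0.
  rewrite mulr1; apply: le_trans (hf x) _.
  by move: xN; rewrite inE => xN; apply: contrapT => fg; apply: xN; exact: fgN.
rewrite -!integralT_nnsfun; apply: ae_eq_integral => //.
- exact/measurable_EFinP.
- exact/measurable_EFinP.
exists N; split => // x /= h0; apply: contrapT => nN; apply: h0 => _.
by rewrite /= mindicE mem_set// mulr1.
Qed.

End ae_integral.

(* The Lebesgue integral of the library is a supremum over simple functions, so
   neither side has to be measurable. *)
Lemma ae_eq_integral_nonmeasurable d (T : measurableType d) (R : realType)
    (mu : {measure set T -> \bar R}) (D : set T) (f g : T -> \bar R) :
  {ae mu, forall x, D x -> f x = g x} ->
  (\int[mu]_(x in D) f x = \int[mu]_(x in D) g x)%E.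
Proof.
move=> fg; rewrite integral_mkcond [RHS]integral_mkcond [LHS]integralE [RHS]integralE.
have fgD x : (D x -> f x = g x) -> (f \_ D) x = (g \_ D) x.
  by move=> h; rewrite !patchE /=; case: ifPn => // /set_mem /h ->.
congr (_ - _)%E; apply/eqP; rewrite eq_le; apply/andP; split;
  apply: ge0_ae_le_integral => //; apply: ae_imp fg => x h;
  by rewrite !(funeposE, funenegE) fgD.
Qed.

Lemma ae_eq_Rintegral_nonmeasurable d (T : measurableType d) (R : realType)
    (mu : {measure set T -> \bar R}) (D : set T) (f g : T -> R) :
  {ae mu, forall x, D x -> f x = g x} ->
  \int[mu]_(x in D) f x = \int[mu]_(x in D) g x.
Proof.
move=> fg; rewrite /Rintegral; congr fine; apply: ae_eq_integral_nonmeasurable.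
by apply: ae_imp fg => x h /h ->.
Qed.

Section boxes.
Context {R : realType}.
Notation mu := (@lebesgue_measure R).

Definition box n (A : 'I_n -> set (measurableTypeR R)) : set 'rV[R]_n :=
  [set v | forall i, A i (v ord0 i)].

Lemma measurable_box n (A : 'I_n -> set (measurableTypeR R)) :
  (forall i, measurable (A i)) -> measurable (box A).
Proof.
move=> mA; rewrite (_ : box A = \bigcap_(i in [set: 'I_n]) (rV_coord i @^-1` A i)).
  apply: fin_bigcap_measurable; first exact: finite_finset.
  by move=> i _; rewrite -[X in measurable X]setTI; exact: measurable_rV_coord.
by rewrite predeqE => v; split=> Av i; [move=> _|]; exact: Av.
Qed.

Lemma lebesgue_rV_box n (A : 'I_n -> set (measurableTypeR R)) :
  (forall i, measurable (A i)) ->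
  lebesgue_rV n (box A) = (\prod_(i < n) mu (A i))%E.
Proof. exact: lebesgue_rV_prod. Qed.

(** Boxes generate the sigma-algebra and are stable under intersection, and the boxes with sides []-
    k, k]] exhaust the space with finite measure. *)
Lemma lebesgue_rV_unique n (m : {measure set 'rV[R]_n -> \bar R}) :
  (forall A : 'I_n -> set (measurableTypeR R), (forall i, measurable (A i)) ->
    m (box A) = (\prod_(i < n) mu (A i))%E) ->
  forall E, measurable E -> lebesgue_rV n E = m E.
Proof.
move=> mbox.
pose G : set (set 'rV[R]_n) :=
  [set B | exists2 A : 'I_n -> set (measurableTypeR R),
     forall i, measurable (A i) & B = box A].
pose K (k : nat) : set (measurableTypeR R) := `]- k%:R, k%:R]%classic.
have mK k : measurable (K k) by exact: measurable_itv.
apply: (measure_unique G (fun k => box (fun=> K k))).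
- apply/seteqP; split.
    apply: smallest_sub; first exact: smallest_sigma_algebra.
    rewrite -bigcup_seq => B [i _] [C mC <-]; rewrite setTI.
    apply: sub_sigma_algebra; exists (fun j => if j == i then C else setT).
      by move=> j; case: ifP.
    apply/seteqP; split => [v Cv j|v /(_ i)]; last by rewrite /= eqxx.
    by case: eqP => [->|].
  apply: smallest_sub; first exact: sigma_algebra_measurable.
  by move=> _ [A mA ->]; exact: measurable_box.
- move=> _ _ [A mA ->] [B mB ->]; exists (fun i => A i `&` B i).
    by move=> i; exact: measurableI.
  apply/seteqP; split => [v [Av Bv] i|v ABv]; first by split; [exact: Av|exact: Bv].
  by split=> i; have [] := ABv i.
- by move=> k; exists (fun=> K k).
- apply/seteqP; split => // v _.
  exists (\max_(i < n) (Num.bound `|v ord0 i|)) => // i; rewrite /K /= in_itv/=.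
  have : `|v ord0 i| < (\max_(i < n) (Num.bound `|v ord0 i|))%:R.
    rewrite (lt_le_trans (archi_boundP _))// ler_nat.
    exact: (leq_bigmax (F := fun i => Num.bound `|v ord0 i|)).
  by rewrite ltr_norml => /andP[-> /ltW].
- by move=> _ [A mA ->]; rewrite mbox//; exact: lebesgue_rV_box.
- move=> k; suff : (\prod_(i < n) mu (K k) < +oo)%E.
    by rewrite -(@lebesgue_rV_box n (fun=> K k)).
  have kk : (- k%:R : R) <= k%:R by rewrite (@le_trans _ _ 0)// oppr_le0.
  have -> : mu (K k) = (k%:R - - k%:R)%:E.
    rewrite lebesgue_measure_itv/= lte_fin.
    by case: ltP => // h; congr EFin; lra.
  by rewrite prodEFin ltry.
Qed.

End boxes.

Section insertion.
Context {R : realType}.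
Notation mu := (@lebesgue_measure R).
Variables (n : nat) (i : 'I_n.+1).

Definition rV_insert (p : 'rV[R]_n * measurableTypeR R) : 'rV[R]_n.+1 :=
  \row_j if unlift i j is Some k then p.1 ord0 k else p.2.

Lemma rV_insertE w s : rV_insert (w, s) ord0 i = s.
Proof. by rewrite mxE unlift_none. Qed.

Lemma rV_insert_lift w s k : rV_insert (w, s) ord0 (lift i k) = w ord0 k.
Proof. by rewrite mxE liftK. Qed.

Lemma set_coord_rV_insert w s t :
  set_coord (rV_insert (w, s)) i t = rV_insert (w, t).
Proof.
apply/rowP => j; rewrite mxE; case: (unliftP i j) => [k|] ->.
  by rewrite !rV_insert_lift eq_sym (negbTE (neq_lift _ _)).
by rewrite eqxx rV_insertE.
Qed.

Lemma cube_rV_insert c d w s :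
  cube c d (rV_insert (w, s)) <-> cube c d w /\ c <= s <= d.
Proof.
split=> [h|[hw hs] j].
  by split=> [k|]; [have := h (lift i k); rewrite rV_insert_lift|have := h i;
    rewrite rV_insertE].
by case: (unliftP i j) => [k|] ->; rewrite ?rV_insert_lift ?rV_insertE.
Qed.

Lemma measurable_rV_insert : measurable_fun setT rV_insert.
Proof.
apply: measurable_fun_rVP => j; case: (unliftP i j) => [k|] ->.
  rewrite (_ : _ \o _ = @rV_coord R n k \o fst).
    by apply: measurableT_comp; [exact: measurable_rV_coord|].
  by apply/funext => -[w s] /=; rewrite /rV_coord rV_insert_lift.
rewrite (_ : _ \o _ = snd); first exact: measurable_snd.
by apply/funext => -[w s] /=; rewrite /rV_coord rV_insertE.
Qed.

Let ins_mfun : {mfun ('rV[R]_n * measurableTypeR R)%type >-> 'rV[R]_n.+1} :=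
  HB.pack rV_insert (isMeasurableFun.Build _ _ _ _ rV_insert measurable_rV_insert).

(** The measure is built by splitting off coordinate 0, but integration in direction [i] needs
    coordinate [i] to be split off. On boxes both constructions give the same product of lengths. *)
Lemma lebesgue_rV_insert (E : set 'rV[R]_n.+1) : measurable E ->
  lebesgue_rV n.+1 E = (lebesgue_rV n \x mu)%E (rV_insert @^-1` E).
Proof.
move=> mE.
pose m := pushforward (lebesgue_rV n \x mu)%E ins_mfun.
rewrite -[RHS]/(m E); apply: lebesgue_rV_unique => // A mA.
have pre : rV_insert @^-1` box A = box (fun k => A (lift i k)) `*` A i.
  apply/seteqP; split => [[w s] h|[w s] [/= hw hs] j].
    split=> [k|] /=; first by have := h (lift i k); rewrite rV_insert_lift.
    by have := h i; rewrite rV_insertE.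
  by case: (unliftP i j) => [k|] ->; rewrite ?rV_insert_lift ?rV_insertE.
rewrite -[LHS]/((lebesgue_rV n \x mu)%E (rV_insert @^-1` box A)) pre.
rewrite [LHS]product_measure1E//; last exact: measurable_box.
rewrite [X in (X * _)%E]lebesgue_rV_box// [RHS](bigD1_ord i)//= muleC.
by congr (_ * _)%E; apply: eq_bigl => k; rewrite neq_lift.
Qed.

End insertion.

Section rV_norm.
Context {R : realType}.

Lemma rV_coord_le n (x : 'rV[R]_n) i : `|x ord0 i| <= `|x|.
Proof.
rewrite [leRHS]/Num.norm/= mx_normrE; exact: (le_bigmax _ (fun ij =>
  `|x ij.1 ij.2|) (ord0, i)).
Qed.

Lemma rV_norm_le n (x : 'rV[R]_n) (e : R) : 0 <= e -> (forall i, `|x ord0 i| <= e) ->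
  `|x| <= e.
Proof.
move=> e0 xe; rewrite /Num.norm/= mx_normrE; apply/bigmax_leP; split => // -[j k] _ /=.
by rewrite (ord1 j).
Qed.

Lemma rV_norm_lt n (x : 'rV[R]_n) (e : R) : 0 < e -> (forall i, `|x ord0 i| < e) ->
  `|x| < e.
Proof.
move=> e0 xe; rewrite /Num.norm/= mx_normrE; apply/bigmax_ltP; split => // -[j k] _ /=.
by rewrite (ord1 j).
Qed.

(** Measurability refers to the sigma-algebra of the coordinates, so [U] is exhibited as a countable
    union of boxes with rational centres and radii [1 / (m + 1)]; in [F], boxes not contained in [U]
    are replaced by the empty set. *)
Lemma open_measurable_rV n (U : set 'rV[R]_n) : open U -> measurable U.
Proof.
move=> oU; pose r (m : nat) : R := m.+1%:R^-1.
pose B (p : {ffun 'I_n -> rat} * nat) : set 'rV[R]_n :=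
  box (fun i => `](ratr (p.1 i) - r p.2), (ratr (p.1 i) + r p.2)[%classic).
pose F p := if pselect (B p `<=` U) is left _ then B p else set0.
have -> : U = \bigcup_p F p.
  apply/seteqP; split => [x Ux|x [p _]]; last by rewrite /F; case: pselect => // h /h.
  have /nbhs_ballP[e /= e0 xeU] : nbhs x U by exact: open_nbhs_nbhs.
  have [m me] : exists m, r m < e / 2.
    have e20 : 0 < e / 2 by rewrite divr_gt0.
    have [m _ me] := near_infty_natSinv_lt (PosNum e20).
    by exists m; apply: me => /=.
  have r0 : 0 < r m by rewrite invr_gt0.
  have hq i : exists q : rat, ratr q \in `](x ord0 i - r m), (x ord0 i + r m)[.
    by apply: rat_in_itvoo; rewrite ltrBlDr -addrA ltrDl addr_gt0.
  pose q := [ffun i => projT1 (cid (hq i))].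
  have qE i : x ord0 i - r m < ratr (q i) < x ord0 i + r m.
    by rewrite /q ffunE; case: cid => z /=; rewrite in_itv/=.
  exists (q, m) => //; rewrite /F; case: pselect => /= [_ i|nBU].
    by rewrite /= in_itv/=; have := qE i; lra.
  exfalso; apply: nBU => y By; apply: xeU; rewrite -ball_normE /=.
  apply: rV_norm_lt => // i; rewrite !mxE.
  have := By i; have := qE i; rewrite /= in_itv/= ltr_norml; lra.
apply: countable_bigcupT_measurable => [|p]; first exact: countableP.
rewrite /F; case: pselect => // _.
by apply: measurable_box => i; exact: measurable_itv.
Qed.

Lemma continuous_measurable_rV n (f : 'rV[R]_n -> R) :
  continuous f -> measurable_fun setT f.
Proof.
move=> cf; apply: (measurability _ (RGenOpens.measurableE R)).
move=> _ [_ [a [b ->] <-]]; rewrite setTI; apply: open_measurable_rV.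
by apply: open_comp => [x _|]; [exact: cf|exact: interval_open].
Qed.

Lemma cubeE n c d : cube c d = box (fun=> `[c, d]%classic) :> set 'rV[R]_n.
Proof. by apply/seteqP; split => v h i; have := h i; rewrite /= in_itv. Qed.

Lemma measurable_cube n c d : measurable (cube c d : set 'rV[R]_n).
Proof. by rewrite cubeE; apply: measurable_box => i; exact: measurable_itv. Qed.

Lemma lebesgue_rV_cube n c d : c <= d ->
  lebesgue_rV n (cube c d : set 'rV[R]_n) = ((d - c) ^+ n)%:E.
Proof.
move=> cd; rewrite cubeE lebesgue_rV_box => [|i]; last exact: measurable_itv.
have -> : lebesgue_measure (`[c, d]%classic : set R) = (d - c)%:E.
  by rewrite lebesgue_measure_itv/= lte_fin; case: ltP => // h; congr EFin; lra.
by rewrite prodEFin prodr_const card_ord.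
Qed.

Lemma lebesgue_rV_cube_lty n c d : (lebesgue_rV n (cube c d : set 'rV[R]_n) < +oo)%E.
Proof.
have [cd|dc] := leP c d; first by rewrite lebesgue_rV_cube// ltry.
(* With [d < c] the cube is empty, except in dimension 0, where it is a single point. *)
case: n => [|n].
  rewrite (_ : cube c d = cube 0 0) ?lebesgue_rV_cube ?ltry//.
  by apply/seteqP; split => v _ [].
rewrite (_ : cube c d = set0) ?measure0//.
by apply/seteqP; split => // v /(_ ord0) /andP[]; lra.
Qed.

Lemma compact_cube n c d : compact (cube c d : set 'rV[R]_n).
Proof.
rewrite cubeE; apply: (@rV_compact _ _ (fun=> `[c, d]%classic)) => _.
exact: segment_compact.
Qed.

(** For [c <= d] this is a 1-Lipschitz retraction onto the cube for the sup norm. Composition with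
    it extends functions from the cube to the whole space, keeping continuity, Lipschitz constants
    and bounds. *)
Definition clamp n c d (x : 'rV[R]_n) : 'rV[R]_n :=
  \row_i Num.max c (Num.min d (x ord0 i)).

Lemma clamp_cube n c d (x : 'rV[R]_n) : c <= d -> cube c d (clamp c d x).
Proof. by move=> cd i; rewrite mxE le_max lexx ge_max cd ge_min lexx. Qed.

Lemma clamp_id n c d (x : 'rV[R]_n) : cube c d x -> clamp c d x = x.
Proof.
move=> cx; apply/rowP => i; rewrite mxE; have /andP[? ?] := cx i.
by rewrite min_r// max_r.
Qed.

Lemma lipschitz_clamp n c d (x y : 'rV[R]_n) : `|clamp c d x - clamp c d y| <= `|x - y|.
Proof.
apply: rV_norm_le => // i; rewrite !mxE.
have := rV_coord_le (x - y) i; rewrite !mxE; apply: le_trans.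
set u := x ord0 i; set v := y ord0 i.
have h := ler_norm (u - v); have h' : v - u <= `|u - v| by rewrite distrC ler_norm.
case: (leP d u) => ?; case: (leP d v) => ?; case: (leP c d) => ?;
  case: (leP c u) => ?; case: (leP c v) => ?; rewrite ler_norml; lra.
Qed.

Lemma continuous_clamp n c d : continuous (@clamp n c d).
Proof.
apply: (@lipschitz_continuous _ _ _ _ 1) => x y.
by rewrite mul1r lipschitz_clamp.
Qed.

Lemma continuous_cube_bounded n c d (f : 'rV[R]_n -> R) : continuous f ->
  exists2 M, 0 < M & forall x, cube c d x -> `|f x| <= M.
Proof.
move=> cf; have : compact (f @` cube c d).
  by apply: continuous_compact; [exact: continuous_subspaceT|exact: compact_cube].
move=> /compact_bounded[M [_ hM]].
exists (`|M| + 1) => [|x cx]; first by rewrite ltr_wpDl.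
by apply: hM; [rewrite (le_lt_trans (ler_norm _))// ltrDl|exists x].
Qed.

Lemma continuous_cube_integrable n c d (f : 'rV[R]_n -> R) : continuous f ->
  (lebesgue_rV n).-integrable (cube c d) (EFin \o f).
Proof.
move=> cf; apply: measurable_bounded_integrable.
- exact: measurable_cube.
- exact: lebesgue_rV_cube_lty.
- by apply: measurable_funTS; exact: continuous_measurable_rV.
have [M M0 hM] := continuous_cube_bounded c d cf.
exists M; split => [|N MN x cx]; first exact: num_real.
by rewrite /= (le_trans (hM x cx))// ltW.
Qed.

Lemma within_cube_clamp n c d (f : 'rV[R]_n -> R) : c <= d ->
  {within cube c d, continuous f} -> continuous (f \o clamp c d).
Proof.
move=> cd cf x; apply: (@cvg_comp _ _ _ (clamp c d) f _ (within (cube c d) (nbhs (clamp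
  c d x)))).
  move=> A /=; rewrite /within /= => wA.
  have : \forall y \near x, cube c d (clamp c d y) -> A (clamp c d y).
    exact: (@continuous_clamp n c d x _ wA).
  by apply: filterS => y; apply; exact: clamp_cube.
by have /subspace_continuousP := cf; apply; exact: clamp_cube.
Qed.

End rV_norm.

Section fubini.
Context {R : realType}.
Notation mu := (@lebesgue_measure R).
Variables (n : nat) (i : 'I_n.+1).
Notation ins := (rV_insert i).

Let ins_mfun : {mfun ('rV[R]_n * measurableTypeR R)%type >-> 'rV[R]_n.+1} :=
  HB.pack ins (isMeasurableFun.Build _ _ _ _ ins (@measurable_rV_insert R n i)).

Lemma measurable_rV_insert_preimage (N : set 'rV[R]_n.+1) :
  measurable N -> measurable (ins @^-1` N).
Proof. by move=> mN; rewrite -[X in measurable X]setTI; exact: measurable_rV_insert. Qed.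

Lemma null_lines (N : set 'rV[R]_n.+1) : measurable N ->
  (forall w, mu [set s | N (ins (w, s))] = 0%E) -> lebesgue_rV n.+1 N = 0%E.
Proof.
move=> mN N0; rewrite (lebesgue_rV_insert i)// /product_measure1.
rewrite integral0_eq// => w _ /=; rewrite -[RHS](N0 w); congr (mu _).
by apply/seteqP; split => s; rewrite /xsection /= inE.
Qed.

Lemma ae_lines (P : 'rV[R]_n.+1 -> Prop) :
  {ae lebesgue_rV n.+1, forall u, P u} ->
  {ae lebesgue_rV n, forall w, {ae mu, forall s, P (ins (w, s))}}.
Proof.
move=> [N [mN N0 PN]]; have mN' := measurable_rV_insert_preimage mN.
have : (\int[lebesgue_rV n]_w `|(mu \o xsection (ins @^-1` N)) w| = 0)%E.
  rewrite -N0 (lebesgue_rV_insert i)//; apply: eq_integral => w _.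
  by rewrite gee0_abs//; exact: measure_ge0.
move=> /(ae_eq_integral_abs _ measurableT); move=> /(_ (measurable_fun_xsection _ mN')).
apply: ae_imp => w /= /(_ I) w0; exists (xsection (ins @^-1` N) w); split => //.
  exact: measurable_xsection.
by move=> s /= nP; rewrite /xsection /= inE; exact: PN.
Qed.

(** Fubini in a form suited to explicit line integrals: [G] may be any function agreeing with them
    on almost every line, measurable or not, and its values have to be justified only on lines along
    which [f] is integrable. *)
Lemma integral_lines (c d : R) (f : 'rV[R]_n.+1 -> R) (G : 'rV[R]_n -> R) :
  (lebesgue_rV n.+1).-integrable (cube c d) (EFin \o f) ->
  {ae lebesgue_rV n, forall w, cube c d w ->
    mu.-integrable `[c, d] (EFin \o (fun s => f (ins (w, s)))) ->
    \int[mu]_(s in `[c, d]) f (ins (w, s)) = G w} ->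
  \int[lebesgue_rV n.+1]_(u in cube c d) f u = \int[lebesgue_rV n]_(w in cube c d) G w.
Proof.
move=> fi fG; have mC := @measurable_cube R n.+1 c d.
pose g := (EFin \o f) \_ (cube c d).
have gi : (lebesgue_rV n.+1).-integrable setT g by apply/(integrable_mkcond _ mC).
have mg : measurable_fun setT g := measurable_int _ gi.
have mgi : measurable_fun setT (g \o ins).
  by apply: measurableT_comp => //; exact: measurable_rV_insert.
have gii : (lebesgue_rV n \x mu)%E.-integrable setT (g \o ins).
  apply/integrableP; split => //.
  have /integrableP[_] := gi; apply: le_lt_trans.
  rewrite (eq_measure_integral (pushforward (lebesgue_rV n \x mu)%E ins_mfun));
    last first.
    by move=> A mA _; exact: lebesgue_rV_insert.
  by rewrite ge0_integral_pushforward//; apply: measurableT_comp.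
have gE w s : g (ins (w, s)) =
    if w \in cube c d then ((EFin \o (fun s => f (ins (w, s)))) \_ `[c, d]) s else 0%E.
  rewrite /g !patchE; have [wc|wc] := boolP (w \in cube c d); last first.
    case: ifPn => // /set_mem /cube_rV_insert[wc' _]; move: wc.
    by rewrite mem_set.
  move/set_mem: wc => wc; case: ifPn => [/set_mem /cube_rV_insert[_ ws]|nws].
    by rewrite mem_set//= in_itv.
  case: ifPn => // /set_mem; rewrite /= in_itv/= => ws.
  by move: nws; rewrite mem_set//; apply/cube_rV_insert.
rewrite /Rintegral; congr fine; rewrite integral_mkcond -/g.
transitivity (\int[lebesgue_rV n \x mu]_p (g \o ins) p)%E.
  rewrite (eq_measure_integral (pushforward (lebesgue_rV n \x mu)%E ins_mfun));
    last first.
    by move=> A mA _; exact: lebesgue_rV_insert.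
  by rewrite integral_pushforward.
rewrite -(integral12_prod_meas1 gii) [RHS]integral_mkcond.
apply: ae_eq_integral_nonmeasurable.
apply: ae_imp2 fG (ae_integrable1 gii) => w wG wi _.
rewrite /fubini_F patchE; case: ifPn => wc; last first.
  rewrite integral0_eq// => s _ /=.
  by rewrite gE (negbTE wc).
have gw : (fun s => (g \o ins) (w, s)) = (EFin \o (fun s => f (ins (w, s)))) \_ `[c, d].
  by apply/funext => s; rewrite /= gE wc.
rewrite gw in wi *.
have fwi : mu.-integrable `[c, d] (EFin \o (fun s => f (ins (w, s))))
  by apply/integrable_mkcond.
rewrite -integral_mkcond -wG//; last exact/set_mem.
by rewrite /Rintegral fineK//; exact: integrable_fin_num.
Qed.

End fubini.

(** * Smoothing of Lipschitz functions *)

Section continuous_ops.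
Context {R : realType} (T : topologicalType).
Implicit Types f g : T -> R.

Lemma continuous_addf f g :
  continuous f -> continuous g -> continuous (fun x => f x + g x).
Proof. by move=> cf cg x; apply: cvgD; [exact: cf|exact: cg]. Qed.

Lemma continuous_subf f g :
  continuous f -> continuous g -> continuous (fun x => f x - g x).
Proof. by move=> cf cg x; apply: cvgB; [exact: cf|exact: cg]. Qed.

Lemma continuous_mulf f g :
  continuous f -> continuous g -> continuous (fun x => f x * g x).
Proof. by move=> cf cg x; apply: cvgM; [exact: cf|exact: cg]. Qed.

Lemma continuous_scalef (c : R) f : continuous f -> continuous (fun x => c * f x).
Proof. by move=> cf x; apply: cvgM; [exact: cvg_cst|exact: cf]. Qed.

Lemma continuous_normf f : continuous f -> continuous (fun x => `|f x|).
Proof. by move=> cf x; apply: cvg_norm; exact: cf. Qed.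

End continuous_ops.

Section insert_step.
Context {R : realType} (n : nat).
Variable i : 'I_n.+1.
Implicit Type w : 'rV[R]_n.

Lemma rV_insert_step w (h s : R) : h *: (delta_mx ord0 i : 'rV[R]_n.+1) + rV_insert i
  (w, s) = rV_insert i (w, h + s).
Proof.
apply/rowP => j; rewrite 2!mxE; case: (unliftP i j) => [k|] ->.
  by rewrite !rV_insert_lift mxE [lift i k == i]eq_sym (negbTE (neq_lift _ _)) andbF
    mulr0 add0r.
by rewrite !rV_insertE mxE !eqxx mulr1.
Qed.

Lemma rV_insert_sub w (s t : R) : `|rV_insert i (w, s) - rV_insert i (w, t)| <= `|s - t|.
Proof.
apply: rV_norm_le => // j; rewrite mxE [X in _ + X]mxE; case: (unliftP i j) => [k|] ->.
  by rewrite !rV_insert_lift subrr normr0.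
by rewrite !rV_insertE.
Qed.

End insert_step.

(** * Partial derivatives of Lipschitz functions: existence almost everywhere and Borel
    representatives *)

Section lipschitz_partial.
Context {R : realType} (n : nat).
Notation mu := (@lebesgue_measure R).
Variables (F : 'rV[R]_n.+1 -> R) (L : R) (i : 'I_n.+1).
Hypothesis FL : forall x y, `|F x - F y| <= L * `|x - y|.
Notation e := (delta_mx ord0 i : 'rV[R]_n.+1).

Definition diff_quot (h : R) (u : 'rV[R]_n.+1) : R := h^-1 * (F (h *: e + u) - F u).
Notation Q := diff_quot.

Lemma norm_delta_mx_le : `|e| <= 1.
Proof.
by apply: rV_norm_le => // j; rewrite mxE; case: (_ && _); rewrite ?normr1 ?normr0.
Qed.

Lemma L_ge0 : 0 <= L.
Proof.
have := FL e 0; have -> : `|e - 0| = 1.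
  apply/eqP; rewrite subr0 eq_le norm_delta_mx_le /=.
  by have := rV_coord_le e i; rewrite mxE !eqxx normr1.
by rewrite mulr1; apply: le_trans.
Qed.

Lemma diff_quot_le h u : h != 0 -> `|Q h u| <= L.
Proof.
move=> h0; rewrite /Q normrM normfV mulrC ler_pdivrMr ?normr_gt0//.
rewrite (le_trans (FL _ _))// addrK normrZ ler_wpM2l ?L_ge0//.
by rewrite ler_piMr// norm_delta_mx_le.
Qed.

Lemma continuous_diff_quot h : continuous (Q h).
Proof.
have cF := lipschitz_continuous FL.
apply: continuous_scalef; apply: continuous_subf => //.
apply: (@lipschitz_continuous _ _ _ _ L) => x y.
by rewrite (le_trans (FL _ _))// opprD addrACA subrr add0r.
Qed.

Lemma continuous_diff_quot_step u h : h != 0 -> {for h, continuous (Q ^~ u)}.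
Proof.
move=> h0; apply: cvgM; first exact: cvgV.
apply: cvgB; last exact: cvg_cst.
have cg : continuous (fun h : R => F (h *: e + u)).
  apply: (@lipschitz_continuous _ _ _ _ (L * `|e|)) => x y.
  by rewrite (le_trans (FL _ _))// opprD addrACA subrr addr0 -scalerBl normrZ mulrAC
    mulrA.
exact: cg.
Qed.

(* The complement of the set of convergence of the difference quotients; since
   these are continuous in h, rational increments suffice. *)
Definition partial_bad : set 'rV[R]_n.+1 :=
  \bigcup_k \bigcap_m \bigcup_(p : rat * rat)
    [set u | [/\ 0 < `|ratr p.1 : R| < m.+1%:R^-1, 0 < `|ratr p.2 : R| < m.+1%:R^-1 &
      k.+1%:R^-1 < `|Q (ratr p.1) u - Q (ratr p.2) u| ]].

Lemma measurable_partial_bad : measurable partial_bad.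
Proof.
apply: bigcupT_measurable => k; apply: bigcapT_measurable => m.
apply: countable_bigcupT_measurable => [|p]; first exact: countableP.
have [p1|p1] := boolP (0 < `|ratr p.1 : R| < m.+1%:R^-1); last first.
  by rewrite (_ : mkset _ = set0)//; apply/seteqP; split => // u [].
have [p2|p2] := boolP (0 < `|ratr p.2 : R| < m.+1%:R^-1); last first.
  by rewrite (_ : mkset _ = set0)//; apply/seteqP; split => // u [].
rewrite (_ : mkset _ = (fun u => `|Q (ratr p.1) u - Q (ratr p.2) u|) @^-1`
  `]k.+1%:R^-1, +oo[); last first.
  by apply/seteqP; split => u /=; rewrite in_itv/= andbT; [case|].
rewrite -[X in measurable X]setTI.
have mq : measurable_fun setT (fun u => `|Q (ratr p.1) u - Q (ratr p.2) u|).
  apply: continuous_measurable_rV; apply: continuous_normf.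
  by apply: continuous_subf; exact: continuous_diff_quot.
by apply: mq => //; exact: measurable_itv.
Qed.

Lemma derivable_partial_bad u : derivable F u e -> ~ partial_bad u.
Proof.
move=> /cvg_ex[l Fl] [k _ bad].
have k0 : 0 < k.+1%:R^-1 / 2 :> R by rewrite divr_gt0.
move/cvgrPdist_lt : Fl => /(_ _ k0); rewrite near_withinE => /nbhs_ballP[r /= r0 Fr].
have [m _ mr] := near_infty_natSinv_lt (PosNum r0).
have {}mr := mr m (leqnn _).
have [[p q] _ [/= /andP[p0 pm] /andP[q0 qm]]] := bad m I.
have Qp : `|l - Q (ratr p) u| < k.+1%:R^-1 / 2.
  by apply: Fr; rewrite ?/ball/= ?sub0r ?normrN ?(lt_trans pm)// -normr_gt0.
have Qq : `|l - Q (ratr q) u| < k.+1%:R^-1 / 2.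
  by apply: Fr; rewrite ?/ball/= ?sub0r ?normrN ?(lt_trans qm)// -normr_gt0.
apply/negP; rewrite -leNgt.
have -> : Q (ratr p) u - Q (ratr q) u = (l - Q (ratr q) u) - (l - Q (ratr p) u) by ring.
by rewrite (le_trans (ler_normB _ _))// [leRHS]splitr lerD// ltW.
Qed.

Lemma rat_near (h r : R) : 0 < r -> exists q : rat, `|ratr q - h| < r.
Proof.
move=> r0; have /rat_in_itvoo[q] : h - r < h + r by lra.
by rewrite in_itv/= => hq; exists q; rewrite ltr_norml; lra.
Qed.

Lemma not_partial_bad_derivable u : ~ partial_bad u -> derivable F u e.
Proof.
move=> nbad; apply/cauchy_cvgP; apply: cauchy_exP => eps eps0.
have [k _ ke] := near_infty_natSinv_lt (PosNum eps0).
have {}ke := ke k (leqnn _); rewrite /= in ke.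
have [m hm] : exists m : nat, forall p q : rat,
    0 < `|ratr p : R| < m.+1%:R^-1 -> 0 < `|ratr q : R| < m.+1%:R^-1 ->
    `|Q (ratr p) u - Q (ratr q) u| <= k.+1%:R^-1.
  apply: contrapT => /forallNP nm; apply: nbad; exists k => // m _.
  apply: contrapT => np; apply: (nm m) => p q hp hq; rewrite leNgt; apply/negP => pq.
  by apply: np; exists (p, q).
have m0 : 0 < m.+1%:R^-1 / 2 :> R by rewrite divr_gt0.
have [p0 hp0] : exists p0 : rat, 0 < `|ratr p0 : R| < m.+1%:R^-1.
  have [p hp] := @rat_near (m.+1%:R^-1 / 2) _ m0; exists p.
  move: hp m0; set r := m.+1%:R^-1; rewrite ltr_norml => /andP[h1 h2] m0.
  have p0 : 0 < ratr p :> R by lra.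
  by rewrite gtr0_norm// p0; lra.
exists (Q (ratr p0) u).
suff : \forall h \near 0^', ball (Q (ratr p0) u) eps (Q h u) by [].
rewrite near_withinE; apply/nbhs_ballP; exists m.+1%:R^-1 => [/=|h]; first
  by rewrite invr_gt0.
rewrite /ball/= sub0r normrN => hm' h0.
apply: le_lt_trans ke; rewrite leNgt; apply/negP => lt.
pose del := `|Q (ratr p0) u - Q h u| - k.+1%:R^-1.
have del0 : 0 < del by rewrite subr_gt0.
have := @continuous_diff_quot_step u h h0 => /cvgrPdist_lt /(_ _ del0) /nbhs_ballP[r /=
  r0 hr].
(* A rational [q] this close to [h] changes the quotient by less than [del], is nonzero, and still
   has absolute value below [1 / (m + 1)], so [hm] applies to it. *)
have hr' : 0 < Num.min r (Num.min `|h| (m.+1%:R^-1 - `|h|)).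
  by rewrite !lt_min r0 normr_gt0 h0 subr_gt0.
have [q] := rat_near h hr'; rewrite !lt_min => /and3P[qr qh qm].
have Qq : `|Q h u - Q (ratr q) u| < del by apply: hr; rewrite /ball/= distrC.
have q0 : 0 < `|ratr q : R| < m.+1%:R^-1.
  rewrite normr_gt0; apply/andP; split.
    by apply/eqP => q0; move: qh; rewrite q0 sub0r normrN ltxx.
  have -> : ratr q = (ratr q - h) + h by ring.
  by rewrite (le_lt_trans (ler_normD _ _))// -ltrBrDr.
have := hm p0 q hp0 q0; apply/negP; rewrite -ltNge.
have : `|Q (ratr p0) u - Q h u| <= `|Q (ratr p0) u - Q (ratr q) u| + `|Q (ratr q) u - Q
  h u|.
  by rewrite (le_trans _ (ler_normD _ _))// addrA subrK.
move: Qq lt; rewrite distrC /del; set z := k.+1%:R^-1; lra.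
Qed.

End lipschitz_partial.

Section line_derivative.
Context {R : realType} (n : nat).
Variables (F : 'rV[R]_n.+1 -> R) (i : 'I_n.+1) (w : 'rV[R]_n) (s : R).
Notation e := (delta_mx ord0 i : 'rV[R]_n.+1).

Lemma line_quot : (fun h : R => h^-1 *: ((F \o shift (rV_insert i (w,
  s))) (h *: e) - F (rV_insert i (w, s)))) =
  (fun h => h^-1 *: (((fun s => F (rV_insert i (w,
    s))) \o shift s) (h *: 1) - F (rV_insert i (w, s)))).
Proof.
by apply/funext => h /=; rewrite rV_insert_step [h%:A]mulr1.
Qed.

Lemma derivable_line : derivable F (rV_insert i (w, s)) e =
  derivable (fun s => F (rV_insert i (w, s))) s 1.
Proof. by rewrite /derivable line_quot. Qed.

Lemma partial_line : partial i F (rV_insert i (w, s)) =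
  'D_1 (fun s => F (rV_insert i (w, s))) s.
Proof. by rewrite /partial /derive line_quot. Qed.

End line_derivative.

Section lipschitz_partial_ae.
Context {R : realType} (n : nat).
Notation mu := (@lebesgue_measure R).
Variables (F : 'rV[R]_n.+1 -> R) (L : R) (i : 'I_n.+1).
Hypothesis FL : forall x y, `|F x - F y| <= L * `|x - y|.
Notation e := (delta_mx ord0 i : 'rV[R]_n.+1).

(** On every line in direction [i] the function is Lipschitz in one variable, so the bad points on
    that line form a null set; the bad set being Borel, Fubini applies. *)
Lemma partial_bad_null : lebesgue_rV n.+1 (partial_bad F i) = 0%E.
Proof.
have mN := measurable_partial_bad i FL.
apply: (@null_lines _ _ i) => // w.
have [N [mN' N0 hN]] : {ae mu, forall s, derivable (fun s => F (rV_insert i (w, s))) s 1}.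
  apply: (@lipschitz_derivable_ae _ _ L) => s t.
  by rewrite (le_trans (FL _ _))// ler_wpM2l ?(L_ge0 i FL)// rV_insert_sub.
apply/eqP; rewrite -measure_le0 -N0; apply: le_measure; rewrite ?inE//.
  have := measurable_xsection w (measurable_rV_insert_preimage i mN).
  by rewrite /xsection; congr measurable; apply/seteqP; split => s /=; rewrite inE.
move=> s bad; apply: hN => /= ds; apply: derivable_partial_bad bad.
by rewrite derivable_line.
Qed.

(** [partial] takes a default value where the limit fails to exist. Setting it to zero there gives a
    Borel function bounded by [L], since off the bad set it is a pointwise limit of difference
    quotients. *)
Definition partial_rep (u : 'rV[R]_n.+1) : R :=
  (partial i F \_ (~` partial_bad F i)) u.

Lemma partial_repE u : ~ partial_bad F i u -> partial_rep u = partial i F u.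
Proof. by move=> nb; rewrite /partial_rep patchE mem_set. Qed.

Lemma diff_quot_cvg u : ~ partial_bad F i u ->
  diff_quot F i h u @[h --> 0^'] --> partial_rep u.
Proof. by move=> nb; rewrite partial_repE//; exact: (not_partial_bad_derivable FL nb).
  Qed.

Lemma measurable_partial_rep : measurable_fun setT partial_rep.
Proof.
have mN := measurable_partial_bad i FL.
rewrite /partial_rep; apply/(measurable_restrictT _ _).1; first exact: measurableC.
apply: (@measurable_fun_cvg _ _ _ _ (fun k => diff_quot F i k.+1%:R^-1)).
  move=> k; apply: measurable_funTS; apply: continuous_measurable_rV.
  exact: (continuous_diff_quot FL).
move=> u nb; have := diff_quot_cvg nb; rewrite partial_repE//.
move/cvgr_dnbhsP; apply; split => [k|]; first by rewrite invr_eq0.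
exact: cvg_harmonic.
Qed.

Lemma partial_rep_le u : `|partial_rep u| <= L.
Proof.
have [b|nb] := pselect (partial_bad F i u).
  by rewrite /partial_rep patchE memNset ?normr0 ?(L_ge0 i FL)// => /(_ b).
have /cvg_norm Qc := diff_quot_cvg nb.
rewrite -(cvg_lim (@Rhausdorff R) Qc); apply: limr_le.
  by apply/cvg_ex; eexists; exact: Qc.
by rewrite near_withinE; apply: nearW => h h0; exact: diff_quot_le.
Qed.

Lemma partial_rep_ae : {ae lebesgue_rV n.+1, forall u,
  derivable F u e /\ partial i F u = partial_rep u}.
Proof.
exists (partial_bad F i); split.
- exact: (measurable_partial_bad i FL).
- exact: partial_bad_null.
move=> u /= h; apply: contrapT => nb; apply: h; split.
  exact: (not_partial_bad_derivable FL).
by rewrite partial_repE.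
Qed.

End lipschitz_partial_ae.

Section affine_derive.
Context {R : realType} (n : nat).
Variables (J : 'rV[R]_n.+1 -> R) (a : R) (x : 'rV[R]_n.+1) (i : 'I_n.+1).
Hypothesis a_gt0 : 0 < a.
Notation e := (delta_mx ord0 i : 'rV[R]_n.+1).

(** The implication runs from the composed function to [J] because the exceptional null set is found
    in the integration variable [u], for fixed [x]. *)
Lemma is_derive_affine (u : 'rV[R]_n.+1) :
  derivable (fun u => J (x + a *: u)) u e ->
  derivable J (x + a *: u) e /\
  partial i J (x + a *: u) = a^-1 * partial i (fun u => J (x + a *: u)) u.
Proof.
move=> /cvg_ex[l Fl].
have Jl : h^-1 *: ((J \o shift (x + a *: u)) (h *: e) - J (x + a *: u)) @[h --> 0^']
  --> a^-1 * l.
  apply/cvgr_dnbhsP => v [v0 vc].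
  have w0 k : a^-1 * v k != 0 by rewrite mulf_neq0// invr_neq0// gt_eqF.
  have wc : a^-1 * v k @[k --> \oo] --> 0.
    by rewrite -[X in _ --> X](mulr0 a^-1); apply: cvgM => //; exact: cvg_cst.
  have := (cvgr_dnbhsP _ _ _).1 Fl (fun k => a^-1 * v k) (conj w0 wc).
  move=> Fv; apply: cvg_trans (cvgM (cvg_cst a^-1) Fv).
  apply: near_eq_cvg; apply: nearW => k /=.
  have -> : a *: ((a^-1 * v k) *: e + u) = v k *: e + a *: u.
    by rewrite scalerDr scalerA mulVKf// gt_eqF.
  rewrite addrCA /GRing.scale/= invfM invrK !mulrA.
  by rewrite mulVf ?mul1r// gt_eqF.
split; first by apply/cvg_ex; exists (a^-1 * l).
by rewrite /partial /derive (cvg_lim _ Jl)// (cvg_lim _ Fl).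
Qed.

End affine_derive.

(** * Integration by parts and differentiation of the smoothed function, for globally Lipschitz
    [J] *)

Section smoothing.
Context {R : realType} (n : nat).
Notation mu := (@lebesgue_measure R).
Variables (J : 'rV[R]_n.+1 -> R) (L a : R) (kappa : 'rV[R]_n.+1 -> R).
Hypothesis JL : forall x y, `|J x - J y| <= L * `|x - y|.
Hypothesis a_gt0 : 0 < a.
Hypothesis kappa_cont : {within cube (-1) 1, continuous kappa}.
Hypothesis kappa_bnd : forall i u, cube (-1) 1 u ->
    u ord0 i = -1 \/ u ord0 i = 1 -> kappa u = 0.
Hypothesis kappa_ac : forall i u, cube (-1) 1 u ->
    abs_continuous (-1) 1 (fun s => kappa (set_coord u i s)).
Hypothesis kappa_partial : forall i, {ae lebesgue_rV n.+1, forall u, cube (-1) 1 u ->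
    derivable kappa u (delta_mx ord0 i)}.
Hypothesis kappa_partial_int : forall i,
    lebesgue_integrable (cube (-1) 1) (partial i kappa).
Variables (x : 'rV[R]_n.+1) (i : 'I_n.+1).
Notation e := (delta_mx ord0 i : 'rV[R]_n.+1).
Notation C := (cube (-1) 1 : set 'rV[R]_n.+1).

Let F (u : 'rV[R]_n.+1) := J (x + a *: u).
(** [kappa] is continuous only relative to the cube; [kc] has the same values there and is
    continuous, hence Borel, everywhere. *)
Let kc := kappa \o clamp (-1) 1.

Let FL u v : `|F u - F v| <= (L * a) * `|u - v|.
Proof.
rewrite (le_trans (JL _ _))// opprD addrACA subrr add0r -scalerBr normrZ.
by rewrite gtr0_norm// mulrA.
Qed.

Let cF : continuous F. Proof. exact: lipschitz_continuous FL. Qed.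

Let N11 : (-1 : R) <= 1. Proof. by lra. Qed.

Let ckc : continuous kc. Proof. exact: within_cube_clamp. Qed.

Let kcE u : C u -> kc u = kappa u.
Proof. by move=> Cu; rewrite /kc /= clamp_id. Qed.

Let mC : measurable C. Proof. exact: measurable_cube. Qed.

Let g u := partial_rep F i u * kc u.

Let mg : measurable_fun setT g.
Proof.
apply: measurable_funM; first exact: (measurable_partial_rep i FL).
exact: continuous_measurable_rV.
Qed.

Let ig : (lebesgue_rV n.+1).-integrable C (EFin \o g).
Proof.
have [M M0 hM] := continuous_cube_bounded (-1) 1 ckc.
apply: measurable_bounded_integrable => //.
- exact: lebesgue_rV_cube_lty.
- exact: measurable_funTS.
exists (L * a * M); split => [|N MN u Cu]; first exact: num_real.
rewrite /= (le_trans _ (ltW MN))// normrM ler_pM//; first exact: (partial_rep_le i FL).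
exact: hM.
Qed.

Let partialJ_ae : {ae lebesgue_rV n.+1, forall u,
  derivable J (x + a *: u) e /\ partial i J (x + a *: u) = a^-1 * partial_rep F i u}.
Proof.
apply: ae_imp (partial_rep_ae i FL) => u [dF <-].
exact: is_derive_affine.
Qed.

Lemma integrable_partial_kappa :
  lebesgue_integrable C (fun u => partial i J (x + a *: u) * kappa u).
Proof.
exists (fun u => a^-1 * g u).
  have := integrableZl mC a^-1 ig; exact: eq_integrable.
by apply: ae_imp partialJ_ae => u [_ ->] Cu; rewrite /g kcE// mulrA.
Qed.

Let partial_kappaE : \int[lebesgue_rV n.+1]_(u in C) (partial i J (x + a *: u) * kappa
  u) =
  a^-1 * \int[lebesgue_rV n.+1]_(u in C) g u.
Proof.
rewrite -RintegralZl//; apply: ae_eq_Rintegral_nonmeasurable.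
by apply: ae_imp partialJ_ae => u [_ ->] Cu; rewrite /g kcE// mulrA.
Qed.

Lemma partial_kappa_ibp :
  \int[lebesgue_rV n.+1]_(u in C) (partial i J (x + a *: u) * kappa u) =
  - (a^-1 * \int[lebesgue_rV n.+1]_(u in C) (J (x + a *: u) * partial i kappa u)).
Proof.
have [kp ikp kpE] := kappa_partial_int i.
rewrite partial_kappaE -mulrN; congr (_ * _).
have [M M0 hM] := continuous_cube_bounded (-1) 1 cF.
have iFk : (lebesgue_rV n.+1).-integrable C (EFin \o (fun u => F u * kp u)).
  have := @integrableMr _ _ _ (lebesgue_rV n.+1) C mC F (EFin \o kp); apply.
  - by apply: measurable_funTS; exact: continuous_measurable_rV.
  - by exists M; split => [|N MN u Cu]; [exact: num_real|rewrite /= (le_trans (hM _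
    Cu))// ltW].
  - exact: ikp.
rewrite (_ : \int[lebesgue_rV n.+1]_(u in C) (J (x + a *: u) * partial i kappa u) =
  \int[lebesgue_rV n.+1]_(u in C) (F u * kp u)); last first.
  by apply: ae_eq_Rintegral_nonmeasurable; apply: ae_imp kpE => u h Cu; rewrite h.
(* The sum of the two integrands is almost everywhere the derivative of [F * kappa] in direction
   [i]. On almost every line it integrates to a difference of boundary values, which are zero
   because [kappa] is zero on the faces. *)
apply/eqP; rewrite -subr_eq0 opprK -RintegralD//; apply/eqP.
transitivity (\int[lebesgue_rV n]_(w in cube (-1) 1) (0 : R)); last first.
  by rewrite /Rintegral integral0.
apply: (@integral_lines _ _ i).
  by have := integrableD mC ig iFk.
have P1 : {ae lebesgue_rV n.+1, forall u,
    [/\ derivable F u e, partial i F u = partial_rep F i u &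
     C u -> derivable kappa u e /\ partial i kappa u = kp u]}.
  apply: ae_imp2 (partial_rep_ae i FL) (ae_imp2 _ (kappa_partial i) kpE).
    by move=> u [dF pF] h; split; [exact: dF|exact: pF|exact: h].
  by move=> u h1 h2 Cu; split; [exact: h1|exact: h2].
apply: ae_imp (ae_lines i P1) => w Pw Cw iw.
have Cws s : -1 <= s <= 1 -> C (rV_insert i (w, s)) by move=> hs; apply/cube_rV_insert.
rewrite (@abs_continuous_FTC R (-1) 1
    (fun s => F (rV_insert i (w, s)) * kappa (rV_insert i (w, s))))//.
- have k1 : kappa (rV_insert i (w, 1)) = 0.
    apply: (kappa_bnd (i := i)); first by apply: Cws; rewrite lexx andbT.
    by right; rewrite rV_insertE.
  have k2 : kappa (rV_insert i (w, -1)) = 0.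
    apply: (kappa_bnd (i := i)); first by apply: Cws; rewrite lexx.
    by left; rewrite rV_insertE.
  by rewrite k1 k2 !mulr0 subrr.
- have [M' M'0 hM'] := continuous_cube_bounded (-1) 1 ckc.
  apply: (@abs_continuousM _ _ _ _ _ (M + M')).
  + by move=> s hs; rewrite (le_trans (hM _ (Cws _ hs)))// lerDl ltW.
  + by move=> s hs; rewrite -kcE ?(le_trans (hM' _ (Cws _ hs)))// ?lerDr ?ltW//;
    exact: Cws.
  + apply: (@lipschitz_abs_continuous _ _ _ _ (L * a)) => s t _ _.
    by rewrite (le_trans (FL _ _))// ler_wpM2l ?(L_ge0 i FL)// rV_insert_sub.
  + have C0 : C (rV_insert i (w, 0)) by apply: Cws; lra.
    have := kappa_ac i C0; congr abs_continuous; apply/funext => s.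
    by rewrite set_coord_rV_insert.
apply: ae_imp Pw => s [dF pF h]; rewrite in_itv/= => /andP[s1 s2].
have Cs : C (rV_insert i (w, s)) by apply: Cws; rewrite !ltW.
have [dk pk] := h Cs.
have d1 : is_derive (s : R) 1 (fun s => F (rV_insert i (w,
  s))) (partial_rep F i (rV_insert i (w, s))).
  by apply: DeriveDef; [rewrite -derivable_line|rewrite -partial_line].
have d2 : is_derive (s : R) 1 (fun s => kappa (rV_insert i (w,
  s))) (kp (rV_insert i (w, s))).
  by apply: DeriveDef; [rewrite -derivable_line|rewrite -partial_line].
have d3 := is_deriveM d1 d2.
have -> : g (rV_insert i (w, s)) + F (rV_insert i (w, s)) * kp (rV_insert i (w, s)) =
    F (rV_insert i (w, s)) *: kp (rV_insert i (w, s)) +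
    kappa (rV_insert i (w, s)) *: partial_rep F i (rV_insert i (w, s)).
  by rewrite /GRing.scale /= /g kcE// [RHS]addrC [X in _ = X + _]mulrC.
exact: d3.
Qed.

(** Dominated convergence along an arbitrary null sequence of increments: the difference quotients
    of [J] are bounded by [L], the weight [kc] by [M], and the quotients converge for almost every
    [u]. *)
Lemma smoothed_is_derive : is_derive x e (smoothed J a kappa)
  (\int[lebesgue_rV n.+1]_(u in C) (partial i J (x + a *: u) * kappa u)).
Proof.
have [M M0 hM] := continuous_cube_bounded (-1) 1 ckc.
have sE y : smoothed J a kappa y = \int[lebesgue_rV n.+1]_(u in C) (J (y + a *: u) * kc
  u).
  rewrite /smoothed; apply: eq_Rintegral => u; rewrite inE => Cu; by rewrite kcE.
pose q h (u : 'rV[R]_n.+1) : R := h^-1 * (J (h *: e + (x + a *: u)) - J (x + a *: u)) *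
  kc u.
have cJy (y : 'rV[R]_n.+1) : continuous (fun u : 'rV[R]_n.+1 => J (y + a *: u)).
  apply: (@lipschitz_continuous _ _ _ _ (L * a)) => u v.
  rewrite (le_trans (JL _ _))// opprD addrACA subrr add0r -scalerBr normrZ.
  by rewrite gtr0_norm// mulrA.
have cq h : continuous (q h).
  apply: continuous_mulf => //; apply: continuous_scalef; apply: continuous_subf => //.
  have -> : (fun u : 'rV[R]_n.+1 => J (h *: e + (x + a *: u))) = (fun u =>
    J (h *: e + x + a *: u)).
    by apply/funext => u; rewrite addrA.
  exact: cJy.
have main : h^-1 * (smoothed J a kappa (h *: e + x) - smoothed J a kappa x) @[h -->
  0^'] -->
    a^-1 * \int[lebesgue_rV n.+1]_(u in C) g u.
  apply/cvgr_dnbhsP => v [v0 vc].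
  have vE k : (v k)^-1 * (smoothed J a kappa (v k *: e + x) - smoothed J a kappa x) =
      \int[lebesgue_rV n.+1]_(u in C) q (v k) u.
    rewrite !sE -RintegralB//; last 2 first.
    - by apply: continuous_cube_integrable; apply: continuous_mulf.
    - by apply: continuous_cube_integrable; apply: continuous_mulf.
    rewrite -RintegralZl//; last first.
      apply: continuous_cube_integrable; apply: continuous_subf; exact: continuous_mulf.
    by apply: eq_Rintegral => u _; rewrite /q addrA -mulrBl mulrA.
  under eq_fun do rewrite vE.
  have := @dominated_convergence _ _ _ (lebesgue_rV n.+1) C mC
    (fun k => EFin \o q (v k)) (EFin \o (fun u => a^-1 * g u)) (cst (L * M)%:E).
  case.
  - by move=> k; apply/measurable_EFinP; apply: measurable_funTS;
    exact: continuous_measurable_rV.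
  - apply/measurable_EFinP; apply: measurable_funTS; apply: measurable_funM => //.
  - apply: ae_imp partialJ_ae => u [dJ pJ] Cu; apply: cvg_EFin; first exact: nearW.
    rewrite /g mulrA -pJ; apply: cvgM; last exact: cvg_cst.
    by have := (cvgr_dnbhsP _ _ _).1 dJ v (conj v0 vc).
  - have cc : continuous (fun _ : 'rV[R]_n.+1 => L * M) by exact: cst_continuous.
    exact: (continuous_cube_integrable (-1) 1 cc).
  - apply: aeW => u k Cu; rewrite lee_fin /q normrM ler_pM//; last exact: hM.
    rewrite -/(diff_quot J i (v k) (x + a *: u)); exact: (diff_quot_le i JL).
  move=> i1 _; rewrite -RintegralZl// -(fineK (integrable_fin_num mC i1)).
  by move/fine_cvgP => [_].
split.
  by apply/cvg_ex; eexists; exact: main.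
by rewrite partial_kappaE; apply: cvg_lim main.
Qed.

End smoothing.

(** * Equidistribution *)

Section trig.
Context {R : realType}.

Lemma cos_mul (x y : R) : cos x * cos y = (cos (x + y) + cos (x - y)) / 2.
Proof. by rewrite cosD cosB; field. Qed.

Lemma periodic2pin (f : R -> R) : (forall s, f (s + 2 * pi) = f s) ->
  forall (s : R) (m : int), f (s + 2 * pi * m%:~R) = f s.
Proof.
move=> fp; have H (y : R) (k : nat) : f (y + 2 * pi * k%:R) = f y.
  elim: k => [|k IH]; first by rewrite mulr0 addr0.
  have -> : y + 2 * pi * k.+1%:R = y + 2 * pi * k%:R + 2 * pi by rewrite -natr1; ring.
  by rewrite fp.
move=> x; case=> k; first exact: H.
by rewrite NegzE mulrNz mulrN -[LHS](H _ k.+1) subrK.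
Qed.

Lemma cosD2pin (x : R) (m : int) : cos (x + 2 * pi * m%:~R) = cos x.
Proof.
by apply: periodic2pin => s; rewrite mulr_natl; exact: cosD2pi.
Qed.

Lemma sinD2pin (x : R) (m : int) : sin (x + 2 * pi * m%:~R) = sin x.
Proof.
by have := cosD2pin (x - pi / 2) m; rewrite addrAC !cosBpihalf.
Qed.

(** This is the square of [cos (t / 2)], equal to 1 exactly at the multiples of [2 * pi]. Its
    powers, suitably normalized, are the de la Vallee-Poussin kernels. *)
Definition hat (t : R) : R := (1 + cos t) / 2.

Lemma hat_ge0 t : 0 <= hat t.
Proof. by rewrite /hat; have := cos_geN1 t; lra. Qed.

Lemma hat_le1 t : hat t <= 1.
Proof. by rewrite /hat; have := cos_le1 t; lra. Qed.

(** Trigonometric polynomials of degree at most [p]; the phase [b] produces the sines. *)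
Inductive trig1 (p : nat) : (R -> R) -> Prop :=
| Trig1_cos (c : R) (r : int) (b : R) : (`|r| <= p)%N ->
    trig1 p (fun t => c * cos (r%:~R * t + b))
| Trig1_add f g : trig1 p f -> trig1 p g -> trig1 p (fun t => f t + g t).

Lemma trig1_hat p f : trig1 p f -> trig1 p.+1 (fun t => hat t * f t).
Proof.
elim=> [c r b rp|{}f g _ IHf _ IHg]; last first.
  have -> : (fun t => hat t * (f t + g t)) = (fun t => hat t * f t + hat t * g t).
    by apply/funext => t; rewrite mulrDr.
  exact: Trig1_add.
have -> : (fun t => hat t * (c * cos (r%:~R * t + b))) =
    (fun t => c / 2 * cos (r%:~R * t + b) + (c / 4 * cos ((r + 1)%:~R * t + b) +
      c / 4 * cos ((r - 1)%:~R * t + b))).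
  apply/funext => t; rewrite /hat.
  have -> : (r + 1)%:~R * t + b = r%:~R * t + b + t by rewrite intrD; ring.
  have -> : (r - 1)%:~R * t + b = r%:~R * t + b - t by rewrite intrB; ring.
  by move: (r%:~R * t + b) => y; rewrite cosD cosB; field.
by apply: Trig1_add; [|apply: Trig1_add]; apply: Trig1_cos; lia.
Qed.

Lemma trig1_hatX p : trig1 p (fun t => hat t ^+ p).
Proof.
elim: p => [|p /trig1_hat]; last by congr trig1; apply/funext => t; rewrite exprS.
have := @Trig1_cos 0 1 0 0 (leqnn _); congr trig1; apply/funext => t.
by rewrite mul0r add0r cos0 mulr1 expr0.
Qed.

Variable N : nat.
Definition grid (j : nat) : R := 2 * pi * (j%:R / N%:R).

Lemma sum_cos_grid (r : int) (x : R) : (0 < `|r| < N)%N ->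
  \sum_(j < N) cos (x - r%:~R * grid j) = 0.
Proof.
move=> /andP[r0 rN]; have N0 : (N%:R : R) != 0 by rewrite pnatr_eq0; lia.
pose al : R := r%:~R * (2 * pi / N%:R).
have s0 : sin (al / 2) != 0.
  have -> : al / 2 = r%:~R * (pi / N%:R) by rewrite /al; field.
  have H k : (0 < k < N)%N -> sin (k%:R * (pi / N%:R)) != 0 :> R.
    move=> /andP[k0 kN]; rewrite gt_eqF//; apply: sin_gt0_pi; apply/andP; split.
      by rewrite mulr_gt0 ?ltr0n// divr_gt0 ?pi_gt0// ltr0n; lia.
    rewrite mulrCA gtr_pMr ?pi_gt0// ltr_pdivrMr ?mul1r ?ltr_nat// ltr0n; lia.
  case: r r0 rN {al} => k /= k0 kN; first by apply: H; rewrite k0.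
  by rewrite NegzE mulrNz mulNr sinN oppr_eq0; apply: H.
(* Multiplied by [2 * sin (al / 2)], each cosine is a difference of two sines, and the sum
   telescopes over a whole number of turns. The factor is nonzero because [al / 2] is [r * pi / N]
   with [|r|] strictly between 0 and [N]. *)
apply: (mulfI (x := 2 * sin (al / 2))); first by rewrite mulf_neq0.
rewrite mulr0 mulr_sumr.
transitivity (\sum_(0 <= j < N) (- sin (x + al / 2 - al * j.+1%:R) - - sin (x + al / 2
  - al * j%:R))).
  rewrite big_mkord; apply: eq_bigr => j _.
  have -> : x - r%:~R * grid j = x - al * j%:R by rewrite /grid /al; field.
  have -> : x + al / 2 - al * j.+1%:R = (x - al * j%:R) - al / 2.
    by rewrite -natr1; field.
  have -> : x + al / 2 - al * j%:R = (x - al * j%:R) + al / 2 by ring.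
  by move: (x - al * _) (al / 2) => y z; rewrite sinB sinD; ring.
rewrite telescope_sumr// mulr0 subr0.
have -> : x + al / 2 - al * N%:R = x + al / 2 + 2 * pi * (- r)%:~R.
  by rewrite /al mulrNz; field.
by rewrite sinD2pin addrN.
Qed.

(** Summation over the [N] grid translates kills every frequency [r] with [0 < |r| < N], so below
    degree [N] only the constant term survives. *)
Lemma trig1_grid_const p f : trig1 p f -> (p < N)%N ->
  forall t t', \sum_(j < N) f (t - grid j) = \sum_(j < N) f (t' - grid j).
Proof.
move=> fp pN; elim: fp => [c r b rp t t'|{}f g _ IHf _ IHg t t']; last first.
  by rewrite !big_split /= (IHf t t') (IHg t t').
have [->|r0] := eqVneq r 0; first by apply: eq_bigr => j _; rewrite !mul0r.
have H s : \sum_(j < N) c * cos (r%:~R * (s - grid j) + b) = 0.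
  rewrite -mulr_sumr (eq_bigr (fun j : 'I_N => cos (r%:~R * s + b - r%:~R * grid j))).
    by rewrite sum_cos_grid ?mulr0//; lia.
  by move=> j _; congr cos; ring.
by rewrite !H.
Qed.

Definition hat_sum (p : nat) := \sum_(j < N) hat (- grid j) ^+ p.

Lemma hat_sumE p t : (p < N)%N -> \sum_(j < N) hat (t - grid j) ^+ p = hat_sum p.
Proof.
move=> pN; rewrite (trig1_grid_const (trig1_hatX p) pN t 0).
by apply: eq_bigr => j _; rewrite sub0r.
Qed.

Lemma hat_sum_ge1 p : (0 < N)%N -> 1 <= hat_sum p.
Proof.
move=> N0; rewrite /hat_sum (bigD1 (Ordinal N0))//= {1}/grid mul0r mulr0 oppr0.
rewrite {1}/hat cos0 -[1 + 1]/(2 : R) divff// expr1n lerDl sumr_ge0// => j _.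
by rewrite exprn_ge0// hat_ge0.
Qed.

Lemma hat_sum_le p : hat_sum p <= N%:R.
Proof.
rewrite /hat_sum -[N in N%:R]card_ord -sum1_card natr_sum ler_sum// => j _.
by rewrite exprn_ile1 ?hat_ge0 ?hat_le1.
Qed.

End trig.

Section kernel.
Context {R : realType}.

Lemma expr_bernoulli (e : R) M : 0 <= e <= 1 -> (1 - e) ^+ M * (1 + M%:R * e) <= 1.
Proof.
move=> /andP[e0 e1]; elim: M => [|M IH]; first by rewrite mul0r addr0 mulr1.
rewrite exprSr -mulrA; apply: le_trans IH; rewrite ler_wpM2l//.
  by rewrite exprn_ge0// subr_ge0.
rewrite -natr1; have := ler0n R M; nra.
Qed.

(* hat_sum N p stays in [1, N], so its successive ratios for p < N cannot all be
   below 1 - e once N (1 - e)^(N - 1) < 1. *)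
Lemma hat_concentration (e : R) : 0 < e < 1 -> exists N p,
  (p.+1 < N)%N /\ (1 - e) * hat_sum N p <= (hat_sum N p.+1 : R).
Proof.
move=> /andP[e0 e1]; have e2 : 0 < e ^+ 2 by rewrite exprn_gt0.
(* With [N = 2 * M + 1], Bernoulli gives [(1 - e) ^ (2 * M) <= 1 / (1 + M * e) ^ 2], which is below
   [1 / (3 * M)] as [M * e ^ 2 > 3]. Since [2 * M + 1 <= 3 * M], the product [N * (1 - e) ^ (N - 1)]
   is below 1. *)
pose M := (Num.trunc (3 / e ^+ 2)).+1; have M3 : 3 < M%:R * e ^+ 2.
  by rewrite -ltr_pdivrMr// truncnS_gt.
pose N := (M + M).+1; apply: contrapT => H.
have {}H p : (p.+1 < N)%N -> hat_sum N p.+1 < (1 - e) * hat_sum N p :> R.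
  by move=> pN; rewrite ltNge; apply/negP => K; apply: H; exists N, p.
have H1 p : (p < N)%N -> hat_sum N p <= (1 - e) ^+ p * N%:R.
  elim: p => [|p IH] pN; first by rewrite mul1r hat_sum_le.
  apply: (le_trans (ltW (H _ pN))); rewrite exprS -mulrA ler_wpM2l ?subr_ge0//.
    exact: ltW.
  by apply: IH; apply: ltnW.
have /(_ isT) h1 := @hat_sum_ge1 R N (M + M).
have := H1 (M + M)%N (ltnSn _) => h2.
have B : (1 - e) ^+ M * (1 + M%:R * e) <= 1 by apply: expr_bernoulli; rewrite !ltW.
have q0 : 0 <= (1 - e) ^+ M by rewrite exprn_ge0// subr_ge0 ltW.
have := le_trans h1 h2; rewrite exprD /N -natr1 natrD leNgt => /negP; apply.
have M1 : 1 <= M%:R :> R by rewrite ler1n.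
move: ((1 - e) ^+ M) (M%:R) q0 B M1 M3 => q m q0 B m1 m3.
have B2 : (q * (1 + m * e)) ^+ 2 <= 1 by rewrite exprn_ile1// mulr_ge0//; nra.
have B3 : (q * q) * (m * (m * e ^+ 2)) <= 1 by apply: le_trans B2; nra.
have m0 : 0 < m by lra.
have qm : q * q * (m * 3) <= 1.
  apply: le_trans B3; rewrite ler_wpM2l ?mulr_ge0// ler_wpM2l//; lra.
have [q00|q00] := eqVneq q 0; first by rewrite q00 !mul0r.
have qq : 0 < q * q by rewrite mulr_gt0// lt_def q00.
nra.
Qed.

Lemma hat2pin (x : R) (m : int) : hat (x + 2 * pi * m%:~R) = hat x.
Proof. by rewrite /hat cosD2pin. Qed.

Lemma reduce_2pi (s : R) : exists2 m : int, True & `|s - 2 * pi * m%:~R| <= pi.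
Proof.
have p0 := pi_gt0 R; exists (Num.floor ((s + pi) / (2 * pi))) => //.
have := floor_itv ((s + pi) / (2 * pi)); rewrite intrD.
rewrite ler_pdivlMr ?ltr_pdivrMr ?mulr_gt0// => /andP[h1 h2].
by rewrite ler_norml; apply/andP; split; lra.
Qed.

(** If [s - t] is within [d] of a multiple of [2 * pi], the Lipschitz bound gives [e]; otherwise
    [1 - hat] is at least [(1 - cos d) / 2] while [f] varies by at most 2, so [C = 4 / (1 - cos d)]
    suffices. A modulus linear in [1 - hat] is what the concentrated kernel can average. *)
Lemma hat_modulus (f : R -> R) (L : R) : (forall s, -1 <= f s <= 1) ->
  (forall s, f (s + 2 * pi) = f s) -> 0 < L ->
  (forall s t, `|f s - f t| <= L * `|s - t|) ->
  forall e, 0 < e -> exists2 C, 0 <= C &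
    forall s t, `|f s - f t| <= e + C * (1 - hat (s - t)).
Proof.
move=> f1 fp L0 fL e e0; have p0 := pi_gt0 R.
pose d := Num.min (e / L) (pi / 2).
have d0 : 0 < d by rewrite lt_min !divr_gt0.
have dp : d <= pi / 2 by rewrite ge_min lexx orbT.
have c0 : cos d < 1 by rewrite -cos0 ltr_cos ?in_itv //=; apply/andP; split; lra.
exists (4 / (1 - cos d)); first by rewrite divr_ge0// subr_ge0 ltW.
move=> s t; have [k _] := reduce_2pi (s - t); set r := s - t - _ => rp.
have -> : s - t = r + 2 * pi * k%:~R by rewrite /r; ring.
rewrite hat2pin; have -> : f s = f (t + r).
  by rewrite -[LHS](periodic2pin fp _ (- k)); congr f; rewrite /r mulrNz; ring.
have [rd|rd] := leP `|r| d.
  have := fL (t + r) t; rewrite addrAC subrr add0r => h; apply: (le_trans h).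
  have h1 : L * `|r| <= e.
    by rewrite mulrC -ler_pdivlMr//; apply: le_trans rd _; rewrite ge_min lexx.
  apply: (le_trans h1); rewrite lerDl; apply: mulr_ge0; last by rewrite subr_ge0 hat_le1.
  by rewrite divr_ge0// subr_ge0 ltW.
have h1 : `|f (t + r) - f t| <= 2.
  have := f1 (t + r); have := f1 t; rewrite ler_norml => /andP[? ?] /andP[? ?].
  by apply/andP; split; lra.
have h2 : cos r <= cos d.
  have <- : cos `|r| = cos r by case: (ger0P r) => // _; rewrite cosN.
  by rewrite ltW// ltr_cos ?in_itv/= ?normr_ge0//; apply/andP; split; lra.
apply: (le_trans h1); apply: (@le_trans _ _ (4 / (1 - cos d) * ((1 - cos d) / 2))).
  rewrite (_ : _ * _ = 2) ?lexx//; field; lra.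
apply: ler_wpDl; first exact: ltW.
rewrite ler_wpM2l//; last by rewrite /hat; lra.
Qed.

End kernel.

Lemma lipschitz_onP (R : realType) (V W : normedModType R) (A : set V) (f : V -> W) :
  [lipschitz f x | x in A] <->
  exists2 L : R, 0 < L & forall x y, A x -> A y -> `|f x - f y| <= L * `|x - y|.
Proof.
split.
  move=> [M [Mr HM]]; exists (Num.max (M + 1) 1); first by rewrite lt_max ltr01 orbT.
  move=> x y Ax Ay; have ML : M < Num.max (M + 1) 1 by rewrite lt_max ltrDl ltr01.
  exact: (HM _ ML (x, y)).
move=> [L L0 HL]; exists L; split; first exact: num_real.
move=> M LM [x y] [Ax Ay] /=; apply: (le_trans (HL _ _ Ax Ay)).
by rewrite ler_wpM2r// ltW.
Qed.

Section trig.
Context {R : realType} {n : nat}.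
Implicit Types f g : 'rV[R]_n -> R.

Inductive trig : ('rV[R]_n -> R) -> Prop :=
| Trig_cos (c : R) (l : 'rV[int]_n) (b : R) :
    trig (fun th => c * cos (\sum_i (l ord0 i)%:~R * th ord0 i + b))
| Trig_add f g : trig f -> trig g -> trig (fun th => f th + g th).

Lemma trig_cst (c : R) : trig (fun=> c).
Proof.
have := Trig_cos c 0 0; congr trig; apply/funext => th.
by rewrite big1 ?addr0 ?cos0 ?mulr1// => i _; rewrite mxE mul0r.
Qed.

Lemma trig_sum (I : Type) (r : seq I) (f : I -> 'rV[R]_n -> R) :
  (forall i, trig (f i)) -> trig (fun th => \sum_(i <- r) f i th).
Proof.
move=> tf; elim: r => [|i r IH].
  by have := trig_cst 0; congr trig; apply/funext => th; rewrite big_nil.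
have := Trig_add (tf i) IH; congr trig; apply/funext => th.
by rewrite big_cons.
Qed.

Lemma trig_mul f g : trig f -> trig g -> trig (fun th => f th * g th).
Proof.
move=> tf tg; elim: tf => [c l b|{}f1 f2 _ IH1 _ IH2]; last first.
  have := Trig_add IH1 IH2; congr trig; apply/funext => th.
  by rewrite mulrDl.
elim: tg => [c' l' b'|{}g1 g2 _ IH1 _ IH2]; last first.
  have := Trig_add IH1 IH2; congr trig; apply/funext => th.
  by rewrite mulrDr.
have := Trig_add (Trig_cos (c * c' / 2) (l + l') (b + b'))
  (Trig_cos (c * c' / 2) (l - l') (b - b')).
congr trig; apply/funext => th.
rewrite -mulrDr (_ : \sum_i ((l + l') ord0 i)%:~R * th ord0 i =
  \sum_i (l ord0 i)%:~R * th ord0 i + \sum_i (l' ord0 i)%:~R * th ord0 i); last first.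
  by rewrite -big_split; apply: eq_bigr => i _; rewrite !mxE intrD mulrDl.
rewrite (_ : \sum_i ((l - l') ord0 i)%:~R * th ord0 i =
  \sum_i (l ord0 i)%:~R * th ord0 i - \sum_i (l' ord0 i)%:~R * th ord0 i); last first.
  by rewrite -sumrB; apply: eq_bigr => i _; rewrite !mxE intrB mulrBl.
set x := \sum_i _; set y := \sum_i _.
rewrite [RHS]mulrACA cos_mul [RHS]mulrA [RHS]mulrAC.
by congr (_ * (cos _ + cos _)); ring.
Qed.

Lemma trig_prod (I : Type) (r : seq I) (f : I -> 'rV[R]_n -> R) :
  (forall i, trig (f i)) -> trig (fun th => \prod_(i <- r) f i th).
Proof.
move=> tf; elim: r => [|i r IH].
  by have := trig_cst 1; congr trig; apply/funext => th; rewrite big_nil.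
have := trig_mul (tf i) IH; congr trig; apply/funext => th.
by rewrite big_cons.
Qed.

Lemma trig1_coord p (f : R -> R) (i : 'I_n) (tau : R) : trig1 p f ->
  trig (fun th => f (th ord0 i - tau)).
Proof.
elim=> [c r b _|{}f g _ tf _ tg]; last exact: Trig_add.
have := Trig_cos c (r *: delta_mx ord0 i) (b - r%:~R * tau); congr trig.
apply/funext => th; congr (_ * cos _).
rewrite (bigD1 i)//= big1 => [|j ji].
  by rewrite !mxE !eqxx mulr1 addr0; ring.
by rewrite !mxE (negbTE ji) andbF mulr0 mul0r.
Qed.

Lemma trig_continuous f : trig f -> continuous f.
Proof.
elim=> [c l b|{}f g _ cf _ cg]; last exact: continuous_addf.
apply: continuous_scalef.
have cs : continuous (fun th : 'rV[R]_n => \sum_i (l ord0 i)%:~R * th ord0 i + b).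
  apply: continuous_addf; last exact: cst_continuous.
  apply: (@lipschitz_continuous _ _ _ _ (\sum_i `|(l ord0 i)%:~R|)) => x y.
  rewrite -sumrB mulr_suml; apply: le_trans (ler_norm_sum _ _ _) _.
  apply: ler_sum => i _; rewrite -mulrBr normrM ler_wpM2l//.
  by have := rV_coord_le (x - y) i; rewrite !mxE.
by move=> th; apply: (@continuous_comp _ _ _ _ (@cos R) th (cs th));
  exact: continuous_cos.
Qed.

End trig.

(** * Uniform approximation of functions of the dither by trigonometric polynomials *)

Section approximation.
Context {R : realType} {n : nat}.
Variables (phi : R -> R) (H : 'rV[R]_n -> R).
Hypothesis phi_range : forall s, -1 <= phi s <= 1.
Hypothesis phi_lip : [lipschitz phi s | s in [set: R]].
Hypothesis phi_per : forall s, phi (s + 2 * pi) = phi s.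
Hypothesis H_lip : [lipschitz H u | u in cube (-1) 1].

Lemma dither_cube (th : 'rV[R]_n) : cube (-1) 1 (dither phi th).
Proof. by move=> i; rewrite mxE. Qed.

(** A Korovkin-type argument: [H] composed with the dither is sampled on a product grid and averaged
    with product kernels. Their mean of [1 - hat] is at most [eps] in every coordinate, so
    [hat_modulus] bounds the error by the Lipschitz constant of [H] times a sum over coordinates of
    [eta + C * eps]. *)
Lemma dither_trig_approx (e : R) : 0 < e ->
  exists2 g, trig g & forall th, `|H (dither phi th) - g th| <= e.
Proof.
move=> e0; have [L L0 HL] := (lipschitz_onP _ _).1 phi_lip.
have {}HL s t : `|phi s - phi t| <= L * `|s - t| by exact: HL.
have [LH LH0 HLH] := (lipschitz_onP _ _).1 H_lip.
(* The error is shared by the [n] coordinates ([n + 1] keeps the divisor positive) and, in each, by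
   the modulus [eta] and by [C * eps]. Hence [eps] is taken at most [eta / (C + 1)], and at most
   [1 / 2] to lie strictly between 0 and 1. *)
have K0 : 0 < LH * n.+1%:R * 2 by rewrite !mulr_gt0.
have [C C0 HC] := hat_modulus phi_range phi_per L0 HL (divr_gt0 e0 K0).
pose eps := Num.min (2^-1) (e / (LH * n.+1%:R * 2) / (C + 1)).
have eps01 : 0 < eps < 1.
  rewrite lt_min invr_gt0 ltr0n !divr_gt0 ?ltr_wpDl//= gt_min.
  by apply/orP; left; lra.
have [N [p [pN pe]]] := hat_concentration eps01.
have N0 : (0 < N)%N by lia.
have S0 : 0 < hat_sum N p :> R by apply: lt_le_trans (hat_sum_ge1 p N0).
(* The translates of k to the grid points form a partition of unity. *)
pose k (t : R) := hat t ^+ p / hat_sum N p.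
have k0 t : 0 <= k t by rewrite divr_ge0 ?exprn_ge0 ?hat_ge0 ?ltW.
have k1 t : \sum_(j < N) k (t - grid N j) = 1.
  by rewrite -mulr_suml hat_sumE ?divff ?gt_eqF//; apply: ltnW.
have k2 t : \sum_(j < N) (1 - hat (t - grid N j)) * k (t - grid N j) <= eps.
  under eq_bigr do rewrite mulrBl mul1r mulrA -exprS.
  rewrite sumrB k1 -mulr_suml hat_sumE// lerBlDl -lerBlDr ler_pdivlMr//.
pose pt (f : {ffun 'I_n -> 'I_N}) : 'rV[R]_n := \row_i grid N (f i).
pose w (f : {ffun 'I_n -> 'I_N}) (th : 'rV[R]_n) := \prod_i k (th ord0 i - grid N (f i)).
have w0 f th : 0 <= w f th by apply: prodr_ge0.
have w1 th : \sum_f w f th = 1.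
  rewrite /w -(bigA_distr_bigA (fun i (j : 'I_N) => k (th ord0 i - grid N j))).
  by rewrite big1.
(* The extra factor involves coordinate [i] alone, so the sum over all grid points is a product of
   one-dimensional sums, all equal to 1 except the one bounded by [k2]. *)
have w2 (th : 'rV[R]_n) (i : 'I_n) : \sum_(f : {ffun 'I_n ->
  'I_N}) (1 - hat (th ord0 i - grid N (f i))) * w f th <= eps.
  pose F (l : 'I_n) (j : 'I_N) := (if l == i then 1 - hat (th ord0 i - grid N j) else 1) *
    k (th ord0 l - grid N j).
  rewrite (eq_bigr (fun f : {ffun 'I_n -> 'I_N} => \prod_l F l (f l))) => [|f _].
    rewrite -(bigA_distr_bigA F) (bigD1 i)//= [X in _ * X]big1 => [|l li].
      by rewrite mulr1 /F eqxx.
    by rewrite /F (negbTE li) -[RHS](k1 (th ord0 l)); apply: eq_bigr => j _;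
      rewrite mul1r.
  rewrite /F big_split /=; congr (_ * _).
  by rewrite (bigD1 i)//= eqxx big1 ?mulr1// => l /negbTE ->.
exists (fun th => \sum_(f : {ffun 'I_n -> 'I_N}) H (dither phi (pt f)) * w f th).
  apply: trig_sum => f; apply: trig_mul; first exact: trig_cst.
  apply: trig_prod => i; rewrite /k.
  apply: trig_mul; last exact: trig_cst.
  exact: trig1_coord (trig1_hatX p).
move=> th.
rewrite -[H (dither phi th)]mulr1 -(w1 th) mulr_sumr -sumrB.
apply: (le_trans (ler_norm_sum _ _ _)).
pose eta := e / (LH * n.+1%:R * 2).
apply: (@le_trans _ _ (\sum_(f : {ffun 'I_n -> 'I_N}) \sum_i
  LH * (eta * w f th + C * ((1 - hat (th ord0 i - grid N (f i))) * w f th)))).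
  apply: ler_sum => f _; rewrite -mulrBl normrM (ger0_norm (w0 f th)).
  rewrite -mulr_sumr.
  have -> : \sum_i (eta * w f th + C * ((1 - hat (th ord0 i - grid N (f i))) * w f th)) =
    (\sum_i (eta + C * (1 - hat (th ord0 i - grid N (f i))))) * w f th.
    by rewrite mulr_suml; apply: eq_bigr => i _; ring.
  rewrite mulrA ler_wpM2r//; apply: (le_trans (HLH _ _ (dither_cube _) (dither_cube _))).
  rewrite ler_wpM2l ?(ltW LH0)//; have h0 i : 0 <= eta + C * (1 - hat (th ord0 i - grid
    N (f i))).
    by apply: le_trans (HC (th ord0 i) (grid N (f i))).
  apply: rV_norm_le => [|i]; first exact: sumr_ge0.
  rewrite !mxE; apply: (le_trans (HC _ _)).
  by rewrite (bigD1 i)//= lerDl sumr_ge0.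
rewrite exchange_big /=.
apply: (@le_trans _ _ (\sum_(i < n) LH * (eta + C * eps))).
  apply: ler_sum => i _; rewrite -mulr_sumr ler_wpM2l ?(ltW LH0)// big_split /=.
  by rewrite -!mulr_sumr w1 mulr1 lerD2l ler_wpM2l.
rewrite sumr_const card_ord -mulr_natl.
have e1 : C * eps <= eta.
  have h : eps <= eta / (C + 1) by rewrite ge_min lexx orbT.
  have C1 : 0 < C + 1 by rewrite ltr_wpDl.
  have : eps * (C + 1) <= eta by rewrite -ler_pdivlMr.
  by move/andP: eps01 => [? _]; lra.
have eta0 : 0 < eta by rewrite divr_gt0.
have -> : e = n.+1%:R * (LH * (eta + eta)).
  by rewrite /eta; field; rewrite !gt_eqF//.
apply: ler_pM => //.
- by rewrite mulr_ge0 ?(ltW LH0)// addr_ge0 ?(ltW eta0)// mulr_ge0//;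
  case/andP: eps01 => /ltW.
- by rewrite ler_nat.
by rewrite ler_wpM2l ?(ltW LH0)// lerD2l.
Qed.

End approximation.

Lemma Rintegral_dist_le d (T : measurableType d) (R : realType)
    (mu : {measure set T -> \bar R}) (D : set T) (f g : T -> R) (c e : R) :
  measurable D -> mu D = c%:E -> mu.-integrable D (EFin \o f) ->
  mu.-integrable D (EFin \o g) -> (forall x, D x -> `|f x - g x| <= e) ->
  `|\int[mu]_(x in D) f x - \int[mu]_(x in D) g x| <= e * c.
Proof.
move=> mD muD intf intg fge.
have ifg : mu.-integrable D (EFin \o (fun x => f x - g x)).
  exact: (integrableB mD intf intg).
rewrite -RintegralB//; apply: le_trans (le_normr_Rintegral mD ifg) _.
have -> : e * c = \int[mu]_(x in D) e by rewrite Rintegral_cst// muD.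
apply: le_Rintegral => //.
- exact: integrable_norm ifg.
- by apply: measurable_bounded_integrable => //; [rewrite muD ltry|exact: bounded_cst].
Qed.

(** * Torus means and time means along a nonresonant direction *)

Section means.
Context {R : realType} {n : nat}.
Implicit Types f g : 'rV[R]_n.+1 -> R.
Notation mu := (@lebesgue_measure R).

Definition torus_mean f : R :=
  ((2 * pi) ^+ n.+1)^-1 * \int[lebesgue_rV n.+1]_(th in cube 0 (2 * pi)) f th.

Variable nu : 'rV[R]_n.+1.

Definition line_mean f (t0 T : R) : R :=
  T^-1 * \int[mu]_(t in `[t0, t0 + T]) f (t *: nu).

Let pi2 : 0 < 2 * pi :> R. Proof. by rewrite mulr_gt0// pi_gt0. Qed.

Lemma lebesgue_rV_torus :
  lebesgue_rV n.+1 (cube 0 (2 * pi) : set 'rV[R]_n.+1) = ((2 * pi) ^+ n.+1)%:E.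
Proof. by rewrite lebesgue_rV_cube ?subr0// ltW. Qed.

Lemma lebesgue_segment (t0 T : R) : 0 <= T -> mu `[t0, t0 + T]%classic = T%:E.
Proof.
move=> T0; rewrite lebesgue_measure_itv/= lte_fin ltrDl.
case: ltP => [_|T0']; first by congr EFin; ring.
by congr EFin; lra.
Qed.

Lemma torus_mean_dist f g e : continuous f -> continuous g ->
  (forall th, `|f th - g th| <= e) -> `|torus_mean f - torus_mean g| <= e.
Proof.
move=> cf cg fg; rewrite /torus_mean -mulrBr normrM.
have p0 : 0 < (2 * pi) ^+ n.+1 :> R by rewrite exprn_gt0.
rewrite gtr0_norm ?invr_gt0// mulrC ler_pdivrMr//.
apply: Rintegral_dist_le.
- exact: measurable_cube.
- exact: lebesgue_rV_torus.
- exact: continuous_cube_integrable.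
- exact: continuous_cube_integrable.
- by move=> th _; exact: fg.
Qed.

Lemma continuous_line f : continuous f -> continuous (fun t : R => f (t *: nu)).
Proof.
move=> cf t; apply: (@continuous_comp _ _ _ (fun t : R => t *: nu) f); last exact: cf.
exact: scalel_continuous.
Qed.

Lemma continuous_segment_integrable (f : R -> R) (c d : R) : continuous f ->
  mu.-integrable `[c, d] (EFin \o f).
Proof.
move=> cf; apply: continuous_compact_integrable; first exact: segment_compact.
exact: continuous_subspaceT.
Qed.

Lemma line_mean_dist f g e t0 T : 0 < T -> continuous f -> continuous g ->
  (forall th, `|f th - g th| <= e) -> `|line_mean f t0 T - line_mean g t0 T| <= e.
Proof.
move=> T0 cf cg fg; rewrite /line_mean -mulrBr normrM.
rewrite gtr0_norm ?invr_gt0// mulrC ler_pdivrMr//.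
apply: Rintegral_dist_le.
- exact: measurable_itv.
- by apply: lebesgue_segment; exact: ltW.
- by apply: continuous_segment_integrable; exact: continuous_line.
- by apply: continuous_segment_integrable; exact: continuous_line.
- by move=> th _; exact: fg.
Qed.

Lemma is_derive_sin_affine (c p b s : R) : p != 0 ->
  is_derive s 1 (fun s => c / p * sin (p * s + b)) (c * cos (p * s + b)).
Proof.
move=> p0; have A : is_derive s 1 (fun s => p * s + b) p.
  have := is_deriveD (is_deriveZ p (is_derive_id s (1 : R))) (is_derive_cst b s (1 : R)).
  by rewrite addr0 -[p *: 1]/(p * 1) mulr1.
have B := @is_derive1_comp _ (@sin R) (fun s => p * s + b) s _ _ (is_derive_sin _) A.
have := is_deriveZ (c / p) B; rewrite -[(c / p) *: _]/(c / p * _).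
by rewrite (_ : c / p * _ = c * cos (p * s + b)) //; field.
Qed.

Lemma integral_cos_affine (c p b t0 t1 : R) : t0 <= t1 -> p != 0 ->
  \int[mu]_(s in `[t0, t1]) (c * cos (p * s + b)) =
    c / p * (sin (p * t1 + b) - sin (p * t0 + b)).
Proof.
move=> t01 p0; rewrite mulrBr.
have D (s : R) := is_derive_sin_affine c b s p0.
have cg : continuous (fun s => c * cos (p * s + b)).
  apply: continuous_scalef => s.
  apply: (@continuous_comp _ _ _ (fun s => p * s + b) (@cos R));
    last exact: continuous_cos.
  by apply: cvgD; [exact: mulrl_continuous|exact: cvg_cst].
pose F s := c / p * sin (p * s + b).
apply: (@abs_continuous_FTC _ _ _ F) => //.
- apply: (@lipschitz_abs_continuous _ _ _ _ `|c|) => s t _ _.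
  wlog st : s t / s <= t.
    by move=> H; case: (leP s t) => [/H//|/ltW /H]; rewrite distrC [`|t - s|]distrC.
  rewrite distrC [`|s - t|]distrC.
  have [|r _ ->] := @MVT_segment _ F (fun s => c * cos (p * s + b)) _ _ st.
    by apply: derivable_within_continuous => r _; exact: ex_derive.
  rewrite normrM ler_wpM2r// normrM ler_piMr//.
  by rewrite ler_norml cos_le1 cos_geN1.
- exact: continuous_segment_integrable.
- by apply: aeW => s _; exact: D.
Qed.

(** The antiderivative is a bounded sine, so the division by [T] makes the mean small. The bound is
    free of [t0], which is where uniformity in the starting time comes from. *)
Lemma line_mean_cos c (l : 'rV[int]_n.+1) b (t0 T : R) : 0 < T ->
  \sum_i (l ord0 i)%:~R * nu ord0 i != 0 ->
  `|line_mean (fun th => c * cos (\sum_i (l ord0 i)%:~R * th ord0 i + b)) t0 T| <=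
    2 * `|c / \sum_i (l ord0 i)%:~R * nu ord0 i| / T.
Proof.
move=> T0; set p := \sum_i _ => p0; rewrite /line_mean.
under eq_Rintegral.
  move=> t _; rewrite (_ : \sum_i (l ord0 i)%:~R * (t *: nu) ord0 i = p * t); last first.
    by rewrite /p mulr_suml; apply: eq_bigr => i _; rewrite mxE; ring.
  over.
rewrite integral_cos_affine ?lerDl ?(ltW T0)// normrM mulrC [`|T^-1|]gtr0_norm
  ?invr_gt0//.
rewrite ler_wpM2r ?invr_ge0 ?(ltW T0)// normrM mulrC ler_wpM2r//.
rewrite (le_trans (ler_normB _ _))// -[2]/(1 + 1) lerD// ler_norml.
  by rewrite sin_le1 sin_geN1.
by rewrite sin_le1 sin_geN1.
Qed.

(** Integrating first in a coordinate whose frequency is nonzero covers whole periods. *)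
Lemma torus_mean_cos c (l : 'rV[int]_n.+1) b : l != 0 ->
  torus_mean (fun th => c * cos (\sum_i (l ord0 i)%:~R * th ord0 i + b)) = 0.
Proof.
move=> l0; have [i li] : exists i, l ord0 i != 0.
  apply: contrapT => H; move/eqP: l0; apply; apply/rowP => j; rewrite mxE.
  by apply/eqP; apply: contrapT => /negP lj; apply: H; exists j.
rewrite /torus_mean (@integral_lines R n i _ _ _ (fun=> 0)).
- by rewrite Rintegral_cst ?mul0r ?mulr0//; exact: measurable_cube.
- apply: continuous_cube_integrable; exact: trig_continuous (Trig_cos c l b).
apply: aeW => w _ _.
pose r := \sum_k (l ord0 (lift i k))%:~R * w ord0 k + b.
under eq_Rintegral.
  move=> t _; rewrite (_ : \sum_i0 (l ord0 i0)%:~R * _ + b = (l ord0 i)%:~R * t + r);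
    last first.
    rewrite (bigD1_ord i)//= rV_insertE /r addrA; congr (_ + _ + _).
    by apply: eq_bigr => k _; rewrite rV_insert_lift.
  over.
rewrite integral_cos_affine ?intr_eq0//; last exact: ltW.
by rewrite mulr0 add0r (mulrC (_%:~R)) [2 * pi * _ + r]addrC sinD2pin subrr mulr0.
Qed.

Lemma torus_mean_cst c : torus_mean (fun=> c) = c.
Proof.
rewrite /torus_mean Rintegral_cst; last exact: measurable_cube.
rewrite [X in _ * (c * X)](_ : _ = (2 * pi) ^+ n.+1); last first.
  exact: (congr1 fine lebesgue_rV_torus).
by rewrite mulrC mulfK// expf_neq0// gt_eqF.
Qed.

Lemma line_mean_cst c t0 T : 0 < T -> line_mean (fun=> c) t0 T = c.
Proof.
move=> T0; rewrite /line_mean Rintegral_cst; last exact: measurable_itv.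
rewrite [X in _ * (c * X)](_ : _ = T); last first.
  by apply: (congr1 fine (lebesgue_segment t0 _)); exact: ltW.
by rewrite mulrC mulfK// gt_eqF.
Qed.

Lemma torus_meanD f g : continuous f -> continuous g ->
  torus_mean (fun th => f th + g th) = torus_mean f + torus_mean g.
Proof.
move=> cf cg; rewrite /torus_mean RintegralD ?mulrDr//.
- exact: measurable_cube.
- exact: continuous_cube_integrable.
- exact: continuous_cube_integrable.
Qed.

Lemma line_meanD f g t0 T : continuous f -> continuous g ->
  line_mean (fun th => f th + g th) t0 T = line_mean f t0 T + line_mean g t0 T.
Proof.
move=> cf cg; rewrite /line_mean RintegralD ?mulrDr//.
- by apply: continuous_segment_integrable; exact: continuous_line.
- by apply: continuous_segment_integrable; exact: continuous_line.
Qed.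

Hypothesis nu_indep : forall l : 'rV[int]_n.+1, l != 0 ->
  \sum_i (l ord0 i)%:~R * nu ord0 i != 0.

Lemma trig_line_mean f : trig f -> exists2 B, 0 <= B &
  forall t0 T, 0 < T -> `|line_mean f t0 T - torus_mean f| <= B / T.
Proof.
elim=> [c l b|{}f g tf [B B0 HB] tg [C C0 HC]].
  have [->|l0] := eqVneq l 0.
    exists 0 => // t0 T T0; rewrite (_ : (fun _ => _) = (fun=> c * cos b)).
      by rewrite line_mean_cst// torus_mean_cst subrr normr0 mul0r.
    by apply/funext => th; rewrite big1 ?add0r// => i _; rewrite mxE mul0r.
  exists (2 * `|c / \sum_i (l ord0 i)%:~R * nu ord0 i|); first by rewrite mulr_ge0.
  move=> t0 T T0; rewrite torus_mean_cos// subr0; apply: line_mean_cos => //.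
  exact: nu_indep.
exists (B + C); first exact: addr_ge0.
move=> t0 T T0; have cf := trig_continuous tf; have cg := trig_continuous tg.
rewrite line_meanD// torus_meanD// opprD addrACA mulrDl.
by apply: (le_trans (ler_normD _ _)); rewrite lerD ?HB ?HC.
Qed.

Lemma line_mean_cvg f : continuous f ->
  (forall e, 0 < e -> exists2 g, trig g & forall th, `|f th - g th| <= e) ->
  forall e, 0 < e -> exists2 T0, 0 < T0 & forall t0 T, T0 <= T ->
    `|line_mean f t0 T - torus_mean f| <= e.
Proof.
move=> cf fg e e0; have e3 : 0 < e / 3 by rewrite divr_gt0.
have [g tg fge] := fg _ e3; have cg := trig_continuous tg.
have [B B0 HB] := trig_line_mean tg.
exists ((B + 1) / (e / 3)) => [|t0 T TT]; first by rewrite divr_gt0// ltr_wpDl.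
have T0 : 0 < T by apply: lt_le_trans TT; rewrite divr_gt0// ltr_wpDl.
have h1 : `|line_mean f t0 T - line_mean g t0 T| <= e / 3 by exact: line_mean_dist.
have h2 : `|torus_mean g - torus_mean f| <= e / 3.
  by rewrite distrC; exact: torus_mean_dist.
have h3 : `|line_mean g t0 T - torus_mean g| <= e / 3.
  apply: (le_trans (HB _ _ T0)); rewrite ler_pdivrMr//.
  by move: TT; rewrite ler_pdivrMr// => ?; lra.
have -> : line_mean f t0 T - torus_mean f = (line_mean f t0 T - line_mean g t0 T) +
  (line_mean g t0 T - torus_mean g) + (torus_mean g - torus_mean f) by ring.
apply: (le_trans (ler_normD _ _)); apply: (@le_trans _ _ (e / 3 + e / 3 + e / 3));
  last by lra.
by rewrite lerD// (le_trans (ler_normD _ _))// lerD.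
Qed.

End means.

(** * The gradient of the smoothed function *)

Section near_dist.
Context {R : realType} {V W : normedModType R}.
Implicit Types (x y : V) (f : V -> W).

Lemma near_dist_lt x (e : R) : 0 < e -> \forall y \near x, `|x - y| < e.
Proof. by move=> e0; apply/nbhs_ballP; exists e => //= y; rewrite -ball_normE. Qed.

Lemma continuous_near_dist f x : {for x, continuous f} ->
  forall e, 0 < e -> \forall y \near x, `|f x - f y| <= e.
Proof. by move=> cf; exact: cvgr_dist_le. Qed.

Lemma near_dist_continuous f :
  (forall x e, 0 < e -> \forall y \near x, `|f x - f y| <= e) -> continuous f.
Proof. by move=> H x; apply/cvgrPdist_le => e e0; exact: H. Qed.

End near_dist.

Section rV_topology.
Context {R : realType} {n : nat}.
Implicit Types (x y u : 'rV[R]_n) (J : 'rV[R]_n -> R).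

Lemma cube_norm (B : R) x : `|x| <= B -> cube (- B) B x.
Proof. by move=> xB i; rewrite -ler_norml; exact: le_trans (rV_coord_le x i) xB. Qed.

Lemma norm_cube (B : R) x : 0 <= B -> cube (- B) B x -> `|x| <= B.
Proof. by move=> B0 xB; apply: rV_norm_le => // i; rewrite ler_norml. Qed.

Lemma locally_lipschitz_continuous J : locally_lipschitz J -> continuous J.
Proof.
move=> Jl; apply: near_dist_continuous => x e e0.
have [U Ux /lipschitz_onP[L L0 HL]] := Jl x.
have Uxx : U x := nbhs_singleton Ux.
apply: filterS2 Ux (near_dist_lt x (divr_gt0 e0 L0)) => y Uy xy.
apply: (le_trans (HL x y Uxx Uy)).
by rewrite mulrC -ler_pdivlMr// ltW.
Qed.

(** Compactness is applied to pairs of points. Near a diagonal pair the local constant works; near a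
    pair of distinct points at distance [d], the distance stays at least [d / 2] while the increment
    of [J] stays bounded, so a large constant works. *)
Lemma locally_lipschitz_cube J (B : R) : locally_lipschitz J ->
  exists2 L, 0 < L & forall x y, cube (- B) B x -> cube (- B) B y ->
    `|J x - J y| <= L * `|x - y|.
Proof.
move=> Jl; have cJ := locally_lipschitz_continuous Jl.
have cC : compact (cube (- B) B `*` cube (- B) B : set ('rV[R]_n * 'rV[R]_n)).
  by apply: compact_setX; exact: compact_cube.
have := (compact_near_coveringP _).1 cC R (pinfty_nbhs R)
  (fun M p => `|J p.1 - J p.2| <= M * `|p.1 - p.2|) _.
case=> [[x y] _|M [Mr HM]]; last first.
  exists (Num.max (M + 1) 1); first by rewrite lt_max ltr01 orbT.
  move=> x y Cx Cy; apply: (HM (Num.max (M + 1) 1) _ (x, y) (conj Cx Cy)).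
  by rewrite lt_max ltrDl ltr01.
have [<-{y}|xy] := eqVneq x y.
  have [U Ux /lipschitz_onP[L L0 HL]] := Jl x.
  exists ([set p | U p.1 /\ U p.2], [set M | L <= M]).
    split; last exact: nbhs_pinfty_ge (num_real L).
    by exists (U, U).
  move=> [[y z] M] [[Uy Uz] LM] /=; apply: le_trans (HL y z Uy Uz) _.
  by rewrite ler_wpM2r.
have d0 : 0 < `|x - y| by rewrite normr_gt0 subr_eq0.
set d := `|x - y| in d0; have d4 : 0 < d / 4 by rewrite divr_gt0.
pose U (z : 'rV[R]_n) := [set z' : 'rV[R]_n | `|z - z'| < d / 4 /\ `|J z - J z'| <= 1].
have Un (z : 'rV[R]_n) : nbhs z (U z).
  apply: filterI; first exact: (near_dist_lt z d4).
  exact: (@continuous_near_dist _ _ _ J z (cJ z) 1 ltr01).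
exists ([set p | U x p.1 /\ U y p.2], [set M | (`|J x - J y| + 2) / (d / 2) <= M]).
  split; last exact: nbhs_pinfty_ge (num_real _).
  by exists (U x, U y).
move=> [[x' y'] M] [[[/= xx Jx] [yy Jy]]]; rewrite ler_pdivrMr ?divr_gt0// => hM /=.
have h1 : `|J x' - J y'| <= `|J x - J y| + 2.
  have -> : J x' - J y' = - (J x - J x') + (J x - J y) + (J y - J y') by ring.
  by apply: (le_trans (ler_normD _ _)); have := ler_normD (- (J x - J x')) (J x - J y);
    rewrite normrN; lra.
have h2 : d / 2 <= `|x' - y'|.
  have : d <= `|x - x'| + `|x' - y'| + `|y - y'|.
    rewrite /d (_ : x - y = (x - x') + (x' - y') - (y - y')); last first.
      by rewrite opprB addrA addrA subrK subrK.
    by apply: (le_trans (ler_normB _ _)); rewrite lerD2r ler_normD.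
  by lra.
have M0 : 0 <= M.
  have : 0 <= M * (d / 2) by apply: le_trans hM; rewrite addr_ge0.
  by rewrite pmulr_lge0// divr_gt0.
by apply: (le_trans h1); apply: (le_trans hM); rewrite ler_wpM2l.
Qed.

End rV_topology.

Section partials_differentiable.
Context {R : realType} {n : nat}.
Variables (F : 'rV[R]_n -> R) (g : 'I_n -> 'rV[R]_n -> R) (x : 'rV[R]_n).
Hypothesis dF : forall i y, is_derive y (delta_mx ord0 i) F (g i y).
Hypothesis cg : forall i, {for x, continuous (g i)}.

Lemma is_derive_line i (y : 'rV[R]_n) (s : R) :
  is_derive s 1 (fun s => F (s *: delta_mx ord0 i + y)) (g i (s *: delta_mx ord0 i + y)).
Proof.
have [/cvg_ex[l Fl] <-] := dF i (s *: delta_mx ord0 i + y).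
have H : (fun h : R => h^-1 *: (((fun s => F (s *: delta_mx ord0 i + y)) \o shift s) (h
  *: 1) -
   F (s *: delta_mx ord0 i + y))) =
  (fun h => h^-1 *: ((F \o shift (s *: delta_mx ord0 i + y)) (h *: delta_mx ord0 i) - F
    (s *: delta_mx ord0 i + y))).
  apply/funext => h /=; congr (_ *: (F _ - _)).
  by rewrite -[h *: 1]/(h * 1) mulr1 scalerDl addrA.
apply: DeriveDef.
  by rewrite /derivable H; apply/cvg_ex; exists l.
by rewrite /derive H.
Qed.

Lemma MVT_from0 (f df : R -> R) : (forall s : R, is_derive s (1 : R) f (df s)) ->
  forall t, exists2 c, `|c| <= `|t| & f t - f 0 = df c * t.
Proof.
move=> fd t.
have cf : continuous f.
  by move=> s; apply/differentiable_continuous; rewrite -derivable1_diffP; case: (fd s).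
have [t0|t0] := leP 0 t.
  have [|c cI cE] := @MVT_segment _ f df _ _ t0 (fun s _ => fd s).
    exact: continuous_subspaceT.
  exists c; last by rewrite cE subr0.
  by move: cI; rewrite in_itv/= => /andP[c0 ct]; rewrite !ger0_norm.
have [|c cI cE] := @MVT_segment _ f df _ _ (ltW t0) (fun s _ => fd s).
  exact: continuous_subspaceT.
exists c; last by rewrite -opprB cE sub0r mulrN opprK.
by move: cI; rewrite in_itv/= => /andP[c0 ct]; rewrite !ler0_norm ?lerN2// ltW.
Qed.

(** The increment from [x] to [h + x] is telescoped over the points [hk k + x], which switch on the
    coordinates of [h] one at a time. By the mean value theorem each step is a coordinate of [h]
    times a partial derivative at a point within [|h|] of [x]. *)
Lemma continuous_partials_differentiable : differentiable F x.
Proof.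
pose df0 (h : 'rV[R]_n) : R := \sum_i h ord0 i * g i x.
have df_lin : linear df0.
  move=> k u v; transitivity (k * df0 u + df0 v); last by [].
  rewrite /df0 mulr_sumr -big_split.
  by apply: eq_bigr => i _ /=; rewrite !mxE; ring.
pose df : {linear 'rV[R]_n -> R} := HB.pack df0 (GRing.isLinear.Build R _ _ _ df0 df_lin).
have cdf : continuous df.
  apply: (@lipschitz_continuous _ _ _ _ (\sum_i `|g i x|)) => u v.
  rewrite /= /df0 -sumrB mulr_suml; apply: le_trans (ler_norm_sum _ _ _) _.
  apply: ler_sum => i _; rewrite -mulrBl normrM mulrC ler_wpM2l//.
  by have := rV_coord_le (u - v) i; rewrite !mxE.
have := @diff_unique _ _ _ F df x cdf; set Q := (X in (X -> _) -> _) => dfE.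
have Fo : Q.
  apply/eqaddoP => e e0 /=.
  have e1 : 0 < e / n.+1%:R by rewrite divr_gt0.
  have : \forall y \near x, forall i, `|g i x - g i y| <= e / n.+1%:R.
      apply: (@filter_forall _ _ _ (nbhs x) _) => i.
    exact: (continuous_near_dist (@cg i)).
  move=> /nbhs_ballP[r /= r0 Hr].
  apply/nbhs_ballP; exists r => // h; rewrite -ball_normE /= sub0r normrN => hr.
  pose hk (k : nat) : 'rV[R]_n := \row_j if (j < k)%N then h ord0 j else 0.
  have step (i : 'I_n) : `|F (hk i.+1 + x) - F (hk i + x) - h ord0 i * g i x| <= e /
    n.+1%:R * `|h|.
    have [c ch cE] := MVT_from0 (is_derive_line i (hk i + x)) (h ord0 i).
    have -> : F (hk i.+1 + x) - F (hk i + x) = g i (c *: delta_mx ord0 i + (hk i + x))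
      * h ord0 i.
      rewrite -cE scale0r add0r addrA; congr (F (_ + _) - _).
      apply/rowP => j; rewrite !mxE eqxx/= ltnS leq_eqVlt.
      have [->|ji] := eqVneq j i; first by rewrite eqxx ltnn mulr1 addr0.
      by rewrite mulr0 add0r; move: ji; rewrite -val_eqE => /negbTE ->.
    rewrite [h ord0 i * _]mulrC -mulrBl normrM ler_pM//; last exact: rV_coord_le.
    rewrite distrC; apply: Hr; rewrite -ball_normE /= addrA opprD addrCA subrr addr0
      normrN.
    apply: le_lt_trans hr; apply: rV_norm_le => // j; rewrite !mxE eqxx/=.
    have [->|ji] := eqVneq j i.
      by rewrite ltnn mulr1 addr0 (le_trans ch)// rV_coord_le.
    rewrite mulr0 add0r; case: ifP => _; last by rewrite normr0.
    exact: rV_coord_le.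
  have T : F (h + x) - F x = \sum_(i < n) (F (hk i.+1 + x) - F (hk i + x)).
    rewrite -(big_mkord xpredT (fun i => F (hk i.+1 + x) - F (hk i + x)))
      telescope_sumr//.
    congr (F (_ + _) - F _).
      by apply/rowP => j; rewrite mxE ltn_ord.
    by rewrite (_ : hk 0%N = 0) ?add0r//; apply/rowP => j; rewrite !mxE.
  rewrite -[X in `|X|]/(F (h + x) - (F x + df0 h)) opprD addrA T /df0 -sumrB.
  apply: (le_trans (ler_norm_sum _ _ _)).
  apply: (@le_trans _ _ (\sum_(i < n) (e / n.+1%:R * `|h|))); first exact: ler_sum.
  rewrite sumr_const card_ord -[_ *+ n]mulr_natl mulrA ler_wpM2r//.
  rewrite mulrCA ler_piMr ?(ltW e0)//.
  by rewrite ler_pdivrMr// mul1r ler_nat.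
apply/diff_locallyP; rewrite (dfE Fo); split; first exact: cdf.
exact: Fo.
Qed.

End partials_differentiable.

Lemma finite_uniform_bound (R : realType) n (P : 'I_n -> R -> Prop) :
  (forall i M N, M <= N -> P i M -> P i N) ->
  (forall i, exists2 M, 0 < M & P i M) -> exists2 M, 0 < M & forall i, P i M.
Proof.
move=> Pm /(_ _)/cid2-/all_sig2[M M0 PM].
exists (\sum_i M i + 1) => [|i]; first by rewrite ltr_wpDl// sumr_ge0// => i _; exact/ltW.
apply: Pm (PM i); rewrite (bigD1 i)//= -addrA lerDl addr_ge0// sumr_ge0// => j _.
exact/ltW.
Qed.

Section smoothed_gradient.
Context {R : realType} {n : nat}.
Variables (J : 'rV[R]_n.+1 -> R) (a : R) (phi : R -> R).
Variables (m : 'I_n.+1 -> 'rV[R]_n.+1 -> R).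
Hypothesis J_lip : locally_lipschitz J.
Hypothesis a_gt0 : 0 < a.
Hypothesis phi_range : forall s, -1 <= phi s <= 1.
Hypothesis phi_lip : [lipschitz phi s | s in [set: R]].
Hypothesis phi_per : forall s, phi (s + 2 * pi) = phi s.
Hypothesis m_lip : forall i, [lipschitz m i u | u in cube (-1) 1].
Notation C := (cube (-1) 1 : set 'rV[R]_n.+1).
Notation G := (G_field J a phi m).

Let cJ := locally_lipschitz_continuous J_lip.
Let dC th : C (dither phi th). Proof. exact: dither_cube. Qed.

Lemma cube_shift (B : R) x u : cube (- B) B x -> C u ->
  cube (- (B + a)) (B + a) (x + a *: u).
Proof.
move=> hx hu i; rewrite !mxE.
move: (hx i) (hu i); move: (x ord0 i) (u ord0 i) => s t /andP[h1 h2] /andP[h3 h4].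
have h5 : a * t <= a by rewrite ger_pMr.
have h6 : - a <= a * t by rewrite -[- a]mulrN1 ler_pM2l.
by apply/andP; split; lra.
Qed.

Lemma m_bounds : exists2 M, 0 < M & forall i u v, C u -> C v ->
  `|m i u| <= M /\ `|m i u - m i v| <= M * `|u - v|.
Proof.
pose P i M := forall u v, C u -> C v -> `|m i u| <= M /\ `|m i u - m i v| <= M * `|u - v|.
apply: (@finite_uniform_bound R _ P) => [i M N MN H u v Cu Cv|i].
  have [h1 h2] := H u v Cu Cv; split; first exact: le_trans MN.
  by apply: (le_trans h2); rewrite ler_wpM2r.
have [L L0 HL] := (lipschitz_onP _ _).1 (m_lip i).
have C0 : C 0 by move=> j; rewrite mxE; apply/andP; split; lra.
exists (`|m i 0| + L) => [|u v Cu Cv]; first by rewrite ltr_wpDl.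
split; last by apply: (le_trans (HL _ _ Cu Cv)); rewrite ler_wpM2r// lerDr.
have h := HL u 0 Cu C0; have u1 : `|u| <= 1 by exact: norm_cube.
have {}h : `|m i u - m i 0| <= L.
  by apply: (le_trans h); rewrite subr0 ler_piMr// ltW.
have := ler_normD (m i 0) (m i u - m i 0); rewrite addrC subrK => /le_trans; apply.
by rewrite lerD2l.
Qed.

Lemma G_fieldE x th i : G x th ord0 i = a^-1 * (J (x + a *: dither phi th) * m i
  (dither phi th)).
Proof. by rewrite mxE mulrA. Qed.

Lemma G_field_bounds (B : R) : exists2 L, 0 < L & forall x y th i,
  cube (- B) B x -> cube (- B) B y ->
  `|G x th ord0 i| <= L /\ `|G x th ord0 i - G y th ord0 i| <= L * `|x - y|.
Proof.
have [M M0 HM] := m_bounds.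
have [L L0 HL] := locally_lipschitz_cube (B + a) J_lip.
have [N N0 HN] := continuous_cube_bounded (- (B + a)) (B + a) cJ.
exists (a^-1 * (N + L) * M); first by rewrite !mulr_gt0// ?invr_gt0// addr_gt0.
move=> x y th i Bx By; have [mM _] := HM i _ _ (dC th) (dC th).
have ai : 0 <= a^-1 by rewrite invr_ge0 ltW.
have jx := HN _ (cube_shift Bx (dC th)).
rewrite !G_fieldE; split.
  rewrite normrM ger0_norm// -mulrA ler_wpM2l// normrM ler_pM//.
  by apply: (le_trans jx); rewrite lerDl ltW.
rewrite -mulrBr normrM ger0_norm// -!mulrA ler_wpM2l// -mulrBl normrM.
have jl := HL _ _ (cube_shift Bx (dC th)) (cube_shift By (dC th)).
apply: (@le_trans _ _ (L * `|x - y| * M)); last first.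
  by rewrite mulrAC mulrA ler_wpM2r// ler_wpM2r ?(ltW M0)// lerDr ltW.
rewrite ler_pM//; apply: (le_trans jl).
by rewrite opprD addrACA subrr addr0.
Qed.

Lemma lipschitz_J_m x i : [lipschitz J (x + a *: u) * m i u | u in C].
Proof.
have [M M0 HM] := m_bounds.
have [L L0 HL] := locally_lipschitz_cube (`|x| + a) J_lip.
have [N N0 HN] := continuous_cube_bounded (- (`|x| + a)) (`|x| + a) cJ.
have xB := cube_norm (lexx `|x|).
apply/lipschitz_onP; exists (L * a * M + N * M).
  by rewrite addr_gt0// !mulr_gt0.
move=> u v Cu Cv; have [mu mL] := HM i u v Cu Cv.
have -> : J (x + a *: u) * m i u - J (x + a *: v) * m i v =
  (J (x + a *: u) - J (x + a *: v)) * m i u + J (x + a *: v) * (m i u - m i v) by ring.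
rewrite [leRHS]mulrDl; apply: (le_trans (ler_normD _ _)); rewrite !normrM lerD//.
  have jl := HL _ _ (cube_shift xB Cu) (cube_shift xB Cv).
  rewrite mulrAC ler_pM//; apply: (le_trans jl).
  by rewrite opprD addrACA subrr add0r -scalerBr normrZ gtr0_norm// mulrA.
by rewrite -mulrA ler_pM//; exact: HN (cube_shift xB Cv).
Qed.

Lemma dither_lipschitz : exists2 L, 0 < L & forall th th' : 'rV[R]_n.+1,
  `|dither phi th - dither phi th'| <= L * `|th - th'|.
Proof.
have [L L0 HL] := (lipschitz_onP _ _).1 phi_lip; exists L => // th th'.
apply: rV_norm_le => [|i]; first by rewrite mulr_ge0// ltW.
rewrite !mxE; apply: (le_trans (HL _ _ I I)); rewrite ler_wpM2l ?(ltW L0)//.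
by have := rV_coord_le (th - th') i; rewrite !mxE.
Qed.

Lemma continuous_dither_comp (h : 'rV[R]_n.+1 -> R) : [lipschitz h u | u in C] ->
  continuous (fun th => h (dither phi th)).
Proof.
move=> /lipschitz_onP[L L0 HL]; have [K K0 HK] := dither_lipschitz.
apply: (@lipschitz_continuous _ _ _ _ (L * K)) => th th'.
apply: (le_trans (HL _ _ (dC th) (dC th'))).
by rewrite -mulrA ler_wpM2l ?(ltW L0).
Qed.

Lemma continuous_G_field x i : continuous (fun th => G x th ord0 i).
Proof.
rewrite (_ : (fun _ => _) = fun th => a^-1 * (J (x + a *: dither phi th) * m i (dither
  phi th))).
  by apply: continuous_scalef; exact: (continuous_dither_comp (lipschitz_J_m x i)).
by apply/funext => th; rewrite G_fieldE.
Qed.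

Definition avg_field x : 'rV[R]_n.+1 := \row_i torus_mean (fun th => G x th ord0 i).

Lemma avg_field_bounds (B : R) : exists2 L, 0 < L & forall x y i,
  cube (- B) B x -> cube (- B) B y ->
  `|avg_field x ord0 i| <= L /\
  `|avg_field x ord0 i - avg_field y ord0 i| <= L * `|x - y|.
Proof.
have [L L0 HL] := G_field_bounds B; exists L => // x y i Bx By; rewrite !mxE; split.
  rewrite -[X in `|X|]subr0 -[X in _ - X](@torus_mean_cst R n 0).
  apply: torus_mean_dist; [exact: continuous_G_field|exact: cst_continuous|].
  by move=> th; rewrite subr0; have [] := HL x y th i Bx By.
apply: torus_mean_dist; [exact: continuous_G_field|exact: continuous_G_field|].
by move=> th; have [] := HL x y th i Bx By.
Qed.

Lemma avg_field_continuous i : continuous (fun x => avg_field x ord0 i).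
Proof.
apply: near_dist_continuous => x e e0.
have [L L0 HL] := avg_field_bounds (`|x| + 1).
have d0 : 0 < Num.min 1 (e / L) by rewrite lt_min ltr01 divr_gt0.
apply: filterS (near_dist_lt x d0) => y; rewrite lt_min => /andP[xy1 xy2].
have x1 : `|x| <= `|x| + 1 by rewrite lerDl.
have y1 : `|y| <= `|x| + 1.
  rewrite -[y](subKr x) (le_trans (ler_normB _ _))// lerD2l.
  exact: ltW.
have [_ h] := HL x y i (cube_norm x1) (cube_norm y1); apply: (le_trans h).
by rewrite mulrC -ler_pdivlMr// ltW.
Qed.

Variables (rho kappa : 'rV[R]_n.+1 -> R).
Hypothesis rho_density : forall h : 'rV[R]_n.+1 -> R,
    [lipschitz h u | u in C] ->
    ((2 * pi) ^+ n.+1)^-1 *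
      \int[lebesgue_rV n.+1]_(theta in cube 0 (2 * pi)) h (dither phi theta) =
    \int[lebesgue_rV n.+1]_(u in C) (h u * rho u).
Hypothesis kappa_cont : {within C, continuous kappa}.
Hypothesis kappa_bnd : forall i u, C u ->
    u ord0 i = -1 \/ u ord0 i = 1 -> kappa u = 0.
Hypothesis kappa_ac : forall i u, C u ->
    abs_continuous (-1) 1 (fun s => kappa (set_coord u i s)).
Hypothesis kappa_partial : forall i, {ae lebesgue_rV n.+1, forall u, C u ->
    derivable kappa u (delta_mx ord0 i)}.
Hypothesis kappa_partial_int : forall i,
    lebesgue_integrable C (partial i kappa).
Hypothesis m_rho : forall i, {ae lebesgue_rV n.+1, forall u, C u ->
    m i u * rho u = - partial i kappa u}.

Lemma avg_fieldE x i :
  avg_field x ord0 i = - (a^-1 * \int[lebesgue_rV n.+1]_(u in C) (J (x + a *: u) *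
    partial i kappa u)).
Proof.
rewrite mxE; have hl := lipschitz_J_m x i.
rewrite (_ : (fun th => G x th ord0 i) = fun th =>
  a^-1 * (J (x + a *: dither phi th) * m i (dither phi th))); last first.
  by apply/funext => th; rewrite G_fieldE.
rewrite /torus_mean RintegralZl; last 2 first.
- exact: measurable_cube.
- by apply: continuous_cube_integrable; exact: (continuous_dither_comp hl).
rewrite mulrCA (rho_density hl) -mulrN; congr (_ * _).
have [kp ikp kpE] := kappa_partial_int i.
have cF : continuous (fun u : 'rV[R]_n.+1 => J (x + a *: u)).
  have cx : continuous (fun u : 'rV[R]_n.+1 => x + a *: u).
    apply: (@lipschitz_continuous _ _ _ _ a) => u v.
    by rewrite opprD addrACA subrr add0r -scalerBr normrZ gtr0_norm.
  by move=> u; apply: (@continuous_comp _ _ _ (fun u : 'rV[R]_n.+1 => x + a *: u) J u);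
    [exact: cx|exact: cJ].
have [M M0 hM] := continuous_cube_bounded (-1) 1 cF.
have iFk : (lebesgue_rV n.+1).-integrable C (EFin \o (fun u => J (x + a *: u) * kp u)).
  have := @integrableMr _ _ _ (lebesgue_rV n.+1) C (measurable_cube _ _) (fun u =>
    J (x + a *: u)) (EFin \o kp); apply.
  - by apply: measurable_funTS; exact: continuous_measurable_rV.
  - by exists M; split => [|N MN u Cu]; [exact: num_real|rewrite /= (le_trans (hM _
    Cu))// ltW].
  - exact: ikp.
(* The integrable representative [kp] stands in for the partial derivative of [kappa], so that the
   scalar can be pulled out of the integral. *)
transitivity (\int[lebesgue_rV n.+1]_(u in C) (- 1 * (J (x + a *: u) * kp u))).
  apply: ae_eq_Rintegral_nonmeasurable; apply: ae_imp2 (m_rho i) kpE => u h1 h2 Cu.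
  by rewrite -mulrA h1// h2//; ring.
rewrite RintegralZl//; last exact: measurable_cube.
rewrite mulN1r; congr (- _); apply: ae_eq_Rintegral_nonmeasurable.
by apply: ae_imp kpE => u h Cu; rewrite h.
Qed.

(** [|x| + a] bounds [x + a *: u] for [u] in the cube; the extra 1 makes [J] and [JB x] agree on a
    neighbourhood of these points and for all base points near [x], so derivatives agree as well. *)
Let B (x : 'rV[R]_n.+1) := `|x| + a + 1.
Let JB x := J \o clamp (- B x) (B x).

Let B0 x : - B x <= B x.
Proof. by have := a_gt0; have := normr_ge0 x; rewrite /B; lra. Qed.

Lemma clamp_J_lipschitz x : exists L, forall y z, `|JB x y - JB x z| <= L * `|y - z|.
Proof.
have [L L0 HL] := locally_lipschitz_cube (B x) J_lip; exists L => y z.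
apply: (le_trans (HL _ _ (clamp_cube _ (B0 x)) (clamp_cube _ (B0 x)))).
by rewrite ler_wpM2l ?(ltW L0)// lipschitz_clamp.
Qed.

Lemma clamp_J_eq x y u : `|x - y| < 1 -> C u -> J (y + a *: u) = JB x (y + a *: u).
Proof.
move=> xy Cu; rewrite /JB /= clamp_id//; apply: cube_norm.
have : `|y| <= `|x| + 1.
  by rewrite -[y](subKr x) (le_trans (ler_normB _ _))// lerD2l ltW.
have : `|a *: u| <= a.
  by rewrite normrZ gtr0_norm// ler_piMr ?(ltW a_gt0)// norm_cube.
have := ler_normD y (a *: u); rewrite /B; lra.
Qed.

Lemma partial_clamp_J x i u : C u -> partial i J (x + a *: u) = partial i (JB x) (x + a
  *: u).
Proof.
move=> Cu; apply: near_eq_derive.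
apply: filterS (near_dist_lt (x + a *: u) ltr01) => z xz.
have -> : z = (z - a *: u) + a *: u by rewrite subrK.
by apply: clamp_J_eq => //; rewrite opprB addrA.
Qed.

Lemma smoothed_clamp_J x : \forall y \near x, smoothed (JB x) a kappa y = smoothed J a
  kappa y.
Proof.
apply: filterS (near_dist_lt x ltr01) => y xy.
by apply: eq_Rintegral => u; rewrite inE => Cu; rewrite (clamp_J_eq xy Cu).
Qed.

Lemma integrable_partial_J_kappa x i :
  lebesgue_integrable C (fun u => partial i J (x + a *: u) * kappa u).
Proof.
have [L JL] := clamp_J_lipschitz x.
have [g ig gE] := integrable_partial_kappa JL a_gt0 kappa_cont x i.
exists g => //; apply: ae_imp gE => u h Cu.
by rewrite partial_clamp_J// h.
Qed.

Lemma integral_partial_J_kappa x i :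
  \int[lebesgue_rV n.+1]_(u in C) (kappa u * partial i J (x + a *: u)) = avg_field x
    ord0 i.
Proof.
have [L JL] := clamp_J_lipschitz x.
rewrite avg_fieldE (_ : \int[lebesgue_rV n.+1]_(u in C) (J (x + a *: u) * partial i
  kappa u) =
  \int[lebesgue_rV n.+1]_(u in C) (JB x (x + a *: u) * partial i kappa u)); last first.
  apply: eq_Rintegral => u; rewrite inE => Cu; rewrite (@clamp_J_eq x)// subrr normr0//.
rewrite -(partial_kappa_ibp JL a_gt0)//.
by apply: eq_Rintegral => u; rewrite inE => Cu; rewrite partial_clamp_J// mulrC.
Qed.

Lemma smoothed_is_derive_avg x i :
  is_derive x (delta_mx ord0 i) (smoothed J a kappa) (avg_field x ord0 i).
Proof.
have [L JL] := clamp_J_lipschitz x.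
apply: (near_eq_is_derive (smoothed_clamp_J x)).
rewrite -integral_partial_J_kappa.
have := smoothed_is_derive JL a_gt0 kappa_cont x i.
rewrite (_ : \int[lebesgue_rV n.+1]_(u in C) (partial i (JB x) (x + a *: u) * kappa u) =
  \int[lebesgue_rV n.+1]_(u in C) (kappa u * partial i J (x + a *: u)))//.
by apply: eq_Rintegral => u; rewrite inE => Cu; rewrite partial_clamp_J// mulrC.
Qed.

Lemma grad_smoothed x : grad (smoothed J a kappa) x = avg_field x.
Proof.
by apply/rowP => i; rewrite mxE; have [_ <-] := smoothed_is_derive_avg x i.
Qed.

Lemma smoothed_differentiable x : differentiable (smoothed J a kappa) x.
Proof.
apply: (@continuous_partials_differentiable _ _ _ (fun i x => avg_field x ord0 i)).
  by move=> i y; exact: smoothed_is_derive_avg.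
by move=> i; exact: avg_field_continuous.
Qed.

Lemma Rintegral_grad_J_kappa x :
  Rintegral_rV (lebesgue_rV n.+1) C (fun u => kappa u *: grad J (x + a *: u)) =
    avg_field x.
Proof.
apply/rowP => i; rewrite mxE -integral_partial_J_kappa.
by apply: eq_Rintegral => u _; rewrite !mxE.
Qed.

Variable nu : 'rV[R]_n.+1.
Hypothesis nu_indep : forall l : 'rV[int]_n.+1, l != 0 ->
  \sum_i (l ord0 i)%:~R * nu ord0 i != 0.

Lemma line_mean_avg_field x i e : 0 < e -> exists2 T0, 0 < T0 & forall t0 T, T0 <= T ->
  `|line_mean nu (fun th => G x th ord0 i) t0 T - avg_field x ord0 i| <= e.
Proof.
move=> e0; rewrite mxE; apply: line_mean_cvg => //; first exact: continuous_G_field.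
move=> d d0; have hl := lipschitz_J_m x i.
(* The precision [a * d] makes up for the factor [a^-1] in the field. *)
have [g tg Hg] := dither_trig_approx phi_range phi_lip phi_per hl (mulr_gt0 a_gt0 d0).
exists (fun th => a^-1 * g th); first by apply: trig_mul => //; exact: trig_cst.
move=> th; rewrite G_fieldE -mulrBr normrM gtr0_norm ?invr_gt0// mulrC ler_pdivrMr//.
by rewrite [_ * a]mulrC.
Qed.

(** Pointwise convergence becomes uniform on the compact cube because both means are Lipschitz in
    [x], with constants [L] and [K] independent of [t0] and [T]: a point within [e / 2 / (L + K)] of
    [x] loses only another [e / 2]. *)
Lemma line_mean_avg_field_cube (b e : R) : 0 < e -> exists2 T0, 0 < T0 &
  forall x t0 T i, cube (- b) b x -> T0 <= T ->
  `|line_mean nu (fun th => G x th ord0 i) t0 T - avg_field x ord0 i| <= e.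
Proof.
move=> e0; have [L L0 HL] := G_field_bounds b; have [K K0 HK] := avg_field_bounds b.
have e2 : 0 < e / 2 by rewrite divr_gt0.
have d0 : 0 < e / 2 / (L + K) by rewrite divr_gt0// addr_gt0.
have := (near_covering_withinP _).2 ((compact_near_coveringP _).1 (@compact_cube R n.+1
  (- b) b)) R (pinfty_nbhs R)
  (fun T0 (x : 'rV[R]_n.+1) => forall t0 T i, T0 <= T ->
    `|line_mean nu (fun th => G x th ord0 i) t0 T - avg_field x ord0 i| <= e) _.
case=> [x Bx|T0 [Tr HT]]; last first.
  exists (Num.max (T0 + 1) 1); first by rewrite lt_max ltr01 orbT.
  move=> x t0 T i Bx TT; apply: (HT (Num.max (T0 + 1) 1) _ x Bx) => //.
  by rewrite lt_max ltrDl ltr01.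
have [T0 T00 HT] : exists2 T0, 0 < T0 & forall i t0 T, T0 <= T ->
  `|line_mean nu (fun th => G x th ord0 i) t0 T - avg_field x ord0 i| <= e / 2.
  apply: (@finite_uniform_bound R _ (fun i T0 => forall t0 T, T0 <= T -> _)) =>
    [i M N MN H t0 T NT|i].
    by apply: H; exact: le_trans NT.
  exact: line_mean_avg_field.
exists ([set y : 'rV[R]_n.+1 | `|x - y| < e / 2 / (L + K)], [set S | T0 <= S]).
  split; first exact: (near_dist_lt x d0).
  exact: nbhs_pinfty_ge (num_real T0).
move=> [y S] [/= xy TS] By t0 T i ST.
have T1 : 0 < T by apply: lt_le_trans T00 _; exact: le_trans ST.
have h1 : `|line_mean nu (fun th => G x th ord0 i) t0 T - line_mean nu (fun th =>
  G y th ord0 i) t0 T| <= L * `|x - y|.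
  apply: line_mean_dist => //; [exact: continuous_G_field|exact: continuous_G_field|].
  by move=> th; have [] := HL x y th i Bx By.
have [_ h2] := HK x y i Bx By.
have h3 := HT i t0 T (le_trans TS ST).
have h4 : (L + K) * `|x - y| <= e / 2 by rewrite mulrC -ler_pdivlMr ?addr_gt0// ltW.
move: h1 h2 h3; set A := line_mean _ _ _ _; set A' := line_mean _ _ _ _.
set V := avg_field x _ _; set V' := avg_field y _ _ => h1 h2 h3.
have -> : A' - V' = - (A - A') + (A - V) + (V - V') by ring.
apply: (le_trans (ler_normD _ _)).
have := ler_normD (- (A - A')) (A - V); rewrite normrN.
move: h4; rewrite mulrDl; lra.
Qed.

End smoothed_gradient.

(** * Ordinary differential equations *)

Section enorm_theory.
Context {R : realType} {n : nat}.
Implicit Types x y : 'rV[R]_n.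

Let sumsq_ge0 x : 0 <= \sum_(i < n) x ord0 i ^+ 2.
Proof. by apply: sumr_ge0 => i _; exact: sqr_ge0. Qed.

Lemma enorm_ge0 x : 0 <= enorm x. Proof. exact: sqrtr_ge0. Qed.

Lemma enorm_sqr x : enorm x ^+ 2 = \sum_(i < n) x ord0 i ^+ 2.
Proof. by rewrite sqr_sqrtr. Qed.

Lemma norm_le_enorm x : `|x| <= enorm x.
Proof.
apply: rV_norm_le => [|i]; first exact: enorm_ge0.
rewrite -sqrtr_sqr ler_wsqrtr// (bigD1 i)//= lerDl.
by apply: sumr_ge0 => j _; exact: sqr_ge0.
Qed.

Lemma enorm_le_norm x : enorm x <= n.+1%:R * `|x|.
Proof.
have h0 : 0 <= n.+1%:R * `|x| by rewrite mulr_ge0.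
rewrite -(ler_pXn2r (ltn0Sn 1)) ?nnegrE ?enorm_ge0// enorm_sqr.
apply: (@le_trans _ _ (\sum_(i < n) `|x| ^+ 2)).
  apply: ler_sum => i _; rewrite -[x ord0 i ^+ 2]real_normK ?num_real//.
  by rewrite ler_pXn2r ?nnegrE// rV_coord_le.
rewrite sumr_const card_ord exprMn -[_ *+ n]mulr_natl ler_wpM2r ?sqr_ge0//.
by rewrite -natrX ler_nat; nia.
Qed.

Lemma enorm_CS x y : \sum_(i < n) x ord0 i * y ord0 i <= enorm x * enorm y.
Proof.
have [x0|x0] := eqVneq (enorm x) 0.
  rewrite x0 mul0r big1// => i _; have := norm_le_enorm x; rewrite x0 normr_le0 =>
    /eqP ->.
  by rewrite mxE mul0r.
have [y0|y0] := eqVneq (enorm y) 0.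
  rewrite y0 mulr0 big1// => i _; have := norm_le_enorm y; rewrite y0 normr_le0 =>
    /eqP ->.
  by rewrite mxE mulr0.
have xp : 0 < enorm x by rewrite lt_def x0 enorm_ge0.
have yp : 0 < enorm y by rewrite lt_def y0 enorm_ge0.
have ex := enorm_sqr x; have ey := enorm_sqr y.
move: (enorm x) (enorm y) xp yp ex ey => A B A0 B0 ex ey.
have -> : A * B = (B / A * A ^+ 2 + A / B * B ^+ 2) / 2 by field; rewrite !gt_eqF.
rewrite ex ey !mulr_sumr -big_split mulr_suml; apply: ler_sum => i _ /=.
move: (x ord0 i) (y ord0 i) => s t.
rewrite -subr_ge0 (_ : _ - _ = (B * s - A * t) ^+ 2 / (2 * A * B)); last by field;
  rewrite !gt_eqF.
by rewrite divr_ge0 ?sqr_ge0// !mulr_ge0// ltW.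
Qed.

Lemma enormD x y : enorm (x + y) <= enorm x + enorm y.
Proof.
have h0 : 0 <= enorm x + enorm y by rewrite addr_ge0 ?enorm_ge0.
rewrite -(ler_pXn2r (ltn0Sn 1)) ?nnegrE ?enorm_ge0// enorm_sqr sqrrD !enorm_sqr.
apply: (@le_trans _ _ (\sum_(i < n) x ord0 i ^+ 2 + (\sum_(i < n) x ord0 i * y ord0 i)
  *+ 2 + \sum_(i < n) y ord0 i ^+ 2)).
  rewrite -sumrMnl -!big_split; apply: ler_sum => i _ /=.
  by rewrite mxE sqrrD.
by rewrite lerD2r lerD2l lerMn2r enorm_CS.
Qed.

End enorm_theory.

(** The intervals of radius [2 * c / 2 ^ k] around [u k] are nested, since the radius shrinks by
    [c / 2 ^ k] at step [k]; the supremum of their left ends lies in all of them. *)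
Lemma geometric_limit (R : realType) (u : nat -> R) (c : R) : 0 <= c ->
  (forall k, `|u k.+1 - u k| <= c * 2^-1 ^+ k) ->
  exists l, forall k, `|l - u k| <= 2 * c * 2^-1 ^+ k.
Proof.
move=> c0 uc; pose r k := 2 * c * 2^-1 ^+ k.
have r0 k : 0 <= r k by rewrite !mulr_ge0// exprn_ge0.
have rS k : r k = r k.+1 + c * 2^-1 ^+ k by rewrite /r exprS; field.
have vw j k : u j - r j <= u k + r k.
  have vS i : u i.+1 + r i.+1 <= u i + r i.
    by have := uc i; rewrite ler_norml (rS i) => /andP[_ ?]; lra.
  have wS i : u i - r i <= u i.+1 - r i.+1.
    by have := uc i; rewrite ler_norml (rS i) => /andP[? _]; lra.
  have v d i : u (i + d)%N + r (i + d)%N <= u i + r i.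
    by elim: d => [|d IH]; rewrite ?addn0// addnS (le_trans (vS _)).
  have w d i : u i - r i <= u (i + d)%N - r (i + d)%N.
    by elim: d => [|d IH]; rewrite ?addn0// addnS (le_trans IH).
  have := w k j; have := v j k; rewrite addnC; have := r0 (j + k)%N; lra.
pose A := range (fun k => u k - r k).
have Aub k : ubound A (u k + r k) by move=> _ [j _ <-].
exists (sup A) => k; rewrite ler_distl; apply/andP; split.
  apply: ub_le_sup; first by exists (u k + r k); exact: Aub.
  by exists k.
by apply: ge_sup; [exists (u k - r k), k|exact: Aub].
Qed.

Lemma le0_of_geometric (R : realType) (c d : R) : 0 <= c -> (forall k,
  d <= c * 2^-1 ^+ k) -> d <= 0.
Proof.
move=> c0 H; rewrite leNgt; apply/negP => d0.
have c1 : 0 < c + 1 by rewrite ltr_wpDl.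
have [k hk] : exists k : nat, 2^-1 ^+ k < d / (c + 1).
  have : \forall k \near \oo, `|0 - 2^-1 ^+ k| < d / (c + 1).
    apply: cvgr_dist_lt; last by rewrite divr_gt0.
    by apply: cvg_expr; rewrite ger0_norm// invf_lt1 // ltr1n.
  by case=> N _ /(_ N (leqnn N)) /=; rewrite sub0r normrN ger0_norm ?exprn_ge0// => h;
    exists N.
have h := H k; have : c * 2^-1 ^+ k < d.
  apply: (@le_lt_trans _ _ ((c + 1) * 2^-1 ^+ k)).
    by rewrite ler_wpM2r ?exprn_ge0// lerDl.
  by rewrite mulrC -ltr_pdivlMr.
by rewrite ltNge h.
Qed.

Section comparison.
Context {R : realType}.
Implicit Types u v du dv : R -> R.

Lemma nondecreasing_derive u du (t0 t1 : R) : t0 <= t1 ->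
  {within `[t0, t1], continuous u} ->
  (forall t, t0 < t < t1 -> is_derive t 1 u (du t) /\ 0 <= du t) -> u t0 <= u t1.
Proof.
rewrite le_eqVlt => /predU1P[->//|t01] cu hu.
have [||c cI cE] := @MVT R u du t0 t1 t01 => //.
  by move=> t; rewrite in_itv /= => /hu[].
move: cI; rewrite in_itv/= => /hu[_ d0].
by rewrite -subr_ge0 cE mulr_ge0// subr_ge0 ltW.
Qed.

(** Both [v - u] and [v + u] are nondecreasing. This yields integral-type estimates for solutions
    directly from their derivatives, without integrating the field along them. *)
Lemma derivative_comparison u v du dv (t0 t1 : R) : t0 <= t1 ->
  {within `[t0, t1], continuous u} -> {within `[t0, t1], continuous v} ->
  (forall t, t0 < t < t1 ->
    [/\ is_derive t 1 u (du t), is_derive t 1 v (dv t) & `|du t| <= dv t]) ->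
  `|u t0| <= v t0 -> `|u t1| <= v t1.
Proof.
move=> t01 cu cv duv; rewrite !ler_norml => /andP[h1 h2].
have d1 : v t0 - u t0 <= v t1 - u t1.
  apply: (@nondecreasing_derive (fun t => v t - u t) (fun t => dv t - du t)) => //.
    by move=> t; apply: cvgB; [exact: cv|exact: cu].
  move=> t /duv[hu hv]; rewrite ler_norml => /andP[_ ?]; split; first exact: is_deriveB.
  by rewrite subr_ge0.
have d2 : v t0 + u t0 <= v t1 + u t1.
  apply: (@nondecreasing_derive (fun t => v t + u t) (fun t => dv t + du t)) => //.
    by move=> t; apply: cvgD; [exact: cv|exact: cu].
  move=> t /duv[hu hv]; rewrite ler_norml => /andP[? _]; split; first exact: is_deriveD.
  by lra.
by apply/andP; split; lra.
Qed.

Lemma is_derive_expR_affine (c K t0 t : R) :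
  is_derive t 1 (fun t => c * expR (K * (t - t0))) (c * K * expR (K * (t - t0))).
Proof.
have A : is_derive t 1 (fun t => K * (t - t0)) K.
  have := is_deriveZ K (is_deriveB (is_derive_id t (1 : R)) (is_derive_cst t0 t (1 : R))).
  by rewrite subr0 -[K *: 1]/(K * 1) mulr1.
have B := @is_derive1_comp _ (@expR R) (fun t => K * (t - t0)) t _ _ (is_derive_expR _) A.
have := is_deriveZ c B; rewrite -[c *: _]/(c * _).
by rewrite (_ : c * _ = c * K * expR (K * (t - t0))) //; ring.
Qed.

Lemma is_derive_continuous u (d t : R) : is_derive t 1 u d -> {for t, continuous u}.
Proof. by move=> [du _]; apply/differentiable_continuous; rewrite -derivable1_diffP. Qed.

(* In the weighted norm sup_t exp(- 2 L (t - t0)) |u t|, integrating an L-Lipschitz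
   field is a contraction of ratio 1 / 2. *)
Lemma exp_contraction u du (t0 t1 L c : R) : 0 < L -> 0 <= c -> t0 <= t1 ->
  {within `[t0, t1], continuous u} -> u t0 = 0 ->
  (forall t, t0 < t < t1 -> is_derive t 1 u (du t) /\
    `|du t| <= L * (c * expR (2 * L * (t - t0)))) ->
  `|u t1| <= c / 2 * expR (2 * L * (t1 - t0)).
Proof.
move=> L0 c0 t01 cu u0 hu.
apply: (@derivative_comparison u (fun t => c / 2 * expR (2 * L * (t - t0))) du
  (fun t => c / 2 * (2 * L) * expR (2 * L * (t - t0))) t0 t1) => //.
- by apply: continuous_subspaceT => t; exact: is_derive_continuous
  (is_derive_expR_affine _ _ _ _).
- move=> t /hu[h1 h2]; split => //; first exact: is_derive_expR_affine.
  by apply: (le_trans h2); rewrite le_eqVlt; apply/orP; left; apply/eqP; field.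
by rewrite u0 normr0 mulr_ge0 ?divr_ge0// ltW// expR_gt0.
Qed.

End comparison.

Section primitive.
Context {R : realType}.
Notation mu := (@lebesgue_measure R).
Implicit Types (g : R -> R).

Definition primitive (t0 : R) g (t : R) : R := \int[mu]_(s in `[t0, t]) g s.

Lemma primitive_base t0 g : primitive t0 g t0 = 0.
Proof. by rewrite /primitive set_itv1 Rintegral_set1. Qed.

Lemma is_derive_primitive (t0 : R) g (t : R) : continuous g -> t0 < t ->
  is_derive t (1 : R) (primitive t0 g) (g t).
Proof.
move=> cg t0t; have tt : t < t + 1 by rewrite ltrDl.
have ig : mu.-integrable `[t0, t + 1] (EFin \o g) by exact: continuous_segment_integrable.
have [dF F'] := continuous_FTC1_closed tt ig t0t (cg t).
by apply: DeriveDef; [exact: dF|rewrite -derive1E].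
Qed.

Lemma segment_integral_le g (s t M : R) : continuous g -> (forall t, `|g t| <= M) ->
  s <= t -> `|\int[mu]_(r in `[s, t]) g r| <= M * (t - s).
Proof.
move=> cg gM st; rewrite -[X in `|X|]subr0.
have <- : \int[mu]_(r in `[s, t]) (0 : R) = 0.
  by rewrite Rintegral_cst ?mul0r//; exact: measurable_itv.
apply: Rintegral_dist_le.
- exact: measurable_itv.
- by have := @lebesgue_segment R s (t - s); rewrite [s + _]addrC subrK subr_ge0; apply.
- exact: continuous_segment_integrable.
- by apply: continuous_segment_integrable; exact: cst_continuous.
- by move=> r _; rewrite subr0.
Qed.

Lemma primitive_lipschitz t0 g M : continuous g -> (forall t, `|g t| <= M) ->
  forall s t, `|primitive t0 g s - primitive t0 g t| <= M * `|s - t|.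
Proof.
move=> cg gM s t; wlog st : s t / s <= t.
  by move=> H; case: (leP s t) => [/H//|/ltW /H]; rewrite distrC [`|t - s|]distrC.
have M0 : 0 <= M by apply: le_trans (gM 0).
rewrite distrC [`|s - t|]distrC [`|t - s|]ger0_norm ?subr_ge0//.
(* Left of [t0] the segment is empty and the primitive is zero, so the bound holds on the whole
   line. *)
have [tt0|t0t] := ltP t t0.
  rewrite /primitive !set_itv_ge ?bnd_simp -?ltNge//; last exact: le_lt_trans tt0.
  by rewrite Rintegral_set0 subrr normr0 mulr_ge0// subr_ge0.
have [st0|t0s] := ltP s t0.
  rewrite [X in _ - X](_ : _ = 0); last first.
    by rewrite /primitive set_itv_ge ?Rintegral_set0// bnd_simp -ltNge.
  rewrite subr0; apply: (@le_trans _ _ (M * (t - t0))); last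
    by rewrite ler_wpM2l// lerB// ltW.
  exact: segment_integral_le.
rewrite /primitive Rintegral_itvB ?bnd_simp//; last exact: continuous_segment_integrable.
rewrite Rintegral_itv_obnd_cbnd; first exact: segment_integral_le.
by apply: integrableS (continuous_segment_integrable s t cg) => //;
  exact: subset_itv_oc_cc.
Qed.

Lemma primitive_continuous t0 g M : continuous g -> (forall t, `|g t| <= M) ->
  continuous (primitive t0 g).
Proof. by move=> cg gM; apply: lipschitz_continuous (primitive_lipschitz t0 cg gM). Qed.

End primitive.

Section vector_derivative.
Context {R : realType} {n : nat}.
Implicit Types (z : R -> 'rV[R]_n).

Lemma is_derive_coord z (t : R) d i : is_derive t (1 : R) z d ->
  is_derive t (1 : R) (fun t => z t ord0 i) (d ord0 i).
Proof.
move=> [dz <-]; rewrite derive_mx// mxE; apply: DeriveDef => //.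
exact: ((derivable_mxP _ _ _).1 dz).
Qed.

Lemma is_derive_row z (t : R) (d : 'rV[R]_n) :
  (forall i, is_derive t (1 : R) (fun t => z t ord0 i) (d ord0 i)) ->
    is_derive t (1 : R) z d.
Proof.
move=> H; have dz : derivable z t (1 : R).
  by apply/derivable_mxP => j i; rewrite (ord1 j); case: (H i).
apply: DeriveDef => //; rewrite derive_mx//; apply/rowP => i; rewrite mxE.
by case: (H i) => _ ->.
Qed.

Lemma within_continuous_coord (A : set R) z i : {within A, continuous z} ->
  {within A, continuous (fun t => z t ord0 i)}.
Proof.
move=> cz t; apply: (@continuous_comp _ _ _ (z : subspace A -> _) (fun u : 'rV[R]_n =>
  u ord0 i)).
  exact: cz.
exact: coord_continuous.
Qed.

End vector_derivative.

(** * Existence and uniqueness of solutions (Picard-Lindelof) *)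

Section picard.
Context {R : realType} {n : nat}.
Variables (f : R -> 'rV[R]_n -> 'rV[R]_n) (L M t0 : R) (x0 : 'rV[R]_n).
Hypothesis L_gt0 : 0 < L.
Hypothesis fL : forall t x y, `|f t x - f t y| <= L * `|x - y|.
Hypothesis fM : forall t x, `|f t x| <= M.
Hypothesis cf : forall x i, continuous (fun t => f t x ord0 i).

Let M0 : 0 <= M. Proof. exact: le_trans (fM 0 0). Qed.

Let fMi t x i : `|f t x ord0 i| <= M.
Proof. exact: le_trans (rV_coord_le _ _) (fM _ _). Qed.

Lemma continuous_along (z : R -> 'rV[R]_n) i : continuous z ->
  continuous (fun s => f s (z s) ord0 i).
Proof.
move=> cz; apply: near_dist_continuous => s e e0.
have e2 : 0 < e / 2 by rewrite divr_gt0.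
have e2L : 0 < e / 2 / L by rewrite divr_gt0.
have n1 := @continuous_near_dist _ _ _ _ s (@cz s) _ e2L.
have n2 := @continuous_near_dist _ _ _ _ s (@cf (z s) i s) _ e2.
apply: filterS2 n1 n2 => r h1 h2.
have h3 : `|f r (z s) ord0 i - f r (z r) ord0 i| <= e / 2.
  apply: (@le_trans _ _ (L * `|z s - z r|)); last by rewrite mulrC -ler_pdivlMr.
  apply: le_trans (fL r _ _).
  by have := rV_coord_le (f r (z s) - f r (z r)) i; rewrite !mxE.
rewrite -(subrKA (f r (z s) ord0 i)) (le_trans (ler_normD _ _))//.
by rewrite [e]splitr lerD.
Qed.

Definition picard_step (z : R -> 'rV[R]_n) (t : R) : 'rV[R]_n :=
  x0 + \row_i primitive t0 (fun s => f s (z s) ord0 i) t.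

Lemma picard_stepE z t i :
  picard_step z t ord0 i = x0 ord0 i + primitive t0 (fun s => f s (z s) ord0 i) t.
Proof. by rewrite !mxE. Qed.

Lemma picard_step_base z : picard_step z t0 = x0.
Proof. by apply/rowP => i; rewrite picard_stepE primitive_base addr0. Qed.

Lemma picard_step_lipschitz z s t : continuous z ->
  `|picard_step z s - picard_step z t| <= M * `|s - t|.
Proof.
move=> cz; apply: rV_norm_le => [|i]; first by rewrite mulr_ge0.
rewrite mxE [X in _ + X]mxE !picard_stepE opprD addrACA subrr add0r.
by apply: primitive_lipschitz => [|r]; [exact: continuous_along|exact: fMi].
Qed.

Lemma picard_step_continuous z : continuous z -> continuous (picard_step z).
Proof.
move=> cz; apply: (@lipschitz_continuous _ _ _ _ M) => s t; exact: picard_step_lipschitz.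
Qed.

Lemma picard_step_derive z (t : R) i : continuous z -> t0 < t ->
  is_derive t (1 : R) (fun t => picard_step z t ord0 i) (f t (z t) ord0 i).
Proof.
move=> cz tt; rewrite (_ : (fun _ => _) = fun t => x0 ord0 i + primitive t0 (fun s =>
  f s (z s) ord0 i) t).
  have := is_deriveD (is_derive_cst (x0 ord0 i) t (1 : R)) (is_derive_primitive
    (continuous_along (i := i) cz) tt).
  by rewrite add0r.
by apply/funext => s; rewrite picard_stepE.
Qed.

Lemma picard_step_contract z w c : 0 <= c -> continuous z -> continuous w ->
  (forall t, t0 <= t -> `|z t - w t| <= c * expR (2 * L * (t - t0))) ->
  forall t, t0 <= t -> `|picard_step z t - picard_step w t| <= c / 2 * expR (2 * L * (t
    - t0)).
Proof.
move=> c0 cz cw zw t tt; apply: rV_norm_le => [|i].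
  by rewrite mulr_ge0 ?divr_ge0// ltW// expR_gt0.
rewrite mxE [X in _ + X]mxE.
apply: (@exp_contraction _ (fun t => picard_step z t ord0 i - picard_step w t ord0 i)
  (fun t => f t (z t) ord0 i - f t (w t) ord0 i)) => //.
- apply: continuous_subspaceT; apply: continuous_subf.
    by move=> s; apply: (@continuous_comp _ _ _ (picard_step z) (fun u : 'rV[R]_n =>
      u ord0 i)); [exact: picard_step_continuous|exact: coord_continuous].
  by move=> s; apply: (@continuous_comp _ _ _ (picard_step w) (fun u : 'rV[R]_n =>
    u ord0 i)); [exact: picard_step_continuous|exact: coord_continuous].
- by rewrite !picard_step_base subrr.
move=> s /andP[s0 st]; split; first by apply: is_deriveB; exact: picard_step_derive.
apply: (@le_trans _ _ (L * `|z s - w s|)); last by rewrite ler_wpM2l ?(ltW L_gt0)//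
  zw// ltW.
apply: le_trans (fL s _ _).
by have := rV_coord_le (f s (z s) - f s (w s)) i; rewrite !mxE.
Qed.

Let z_ k := iter k picard_step (fun=> x0).

Let cz_ k : continuous (z_ k).
Proof.
elim: k => [|k IH] /=; first exact: cst_continuous.
exact: picard_step_continuous.
Qed.

(** The first iterate moves by at most [M * (t - t0)], which [1 + y <= exp y] bounds by
    [M / (2 * L)] times the exponential weight; each further step halves the constant. *)
Let zS k t : t0 <= t ->
  `|z_ k.+1 t - z_ k t| <= M / (2 * L) * 2^-1 ^+ k * expR (2 * L * (t - t0)).
Proof.
have c0 : 0 <= M / (2 * L) by rewrite divr_ge0// mulr_ge0// ltW.
elim: k t => [|k IH] t tt.
  have := @picard_step_lipschitz (fun=> x0) t t0 (@cz_ 0).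
  rewrite picard_step_base expr0 mulr1 => /le_trans; apply.
  rewrite ger0_norm ?subr_ge0//.
  have L2 : 0 < 2 * L by rewrite mulr_gt0.
  rewrite -mulrA ler_wpM2l// mulrC ler_pdivlMr// mulrC.
  by apply: le_trans (expR_ge1Dx _); rewrite lerDr.
have := @picard_step_contract (z_ k.+1) (z_ k) (M / (2 * L) * 2^-1 ^+ k) _ (@cz_ k.+1)
  (@cz_ k) IH t tt.
by rewrite exprSr mulrA; apply; rewrite mulr_ge0// exprn_ge0.
Qed.

Lemma picard_exists : exists z, solves f t0 x0 +oo%E z.
Proof.
pose E t := M / (2 * L) * expR (2 * L * (t - t0)).
have E0 t : 0 <= E t.
  by rewrite /E mulr_ge0 ?divr_ge0 ?mulr_ge0 ?(ltW L_gt0)// ltW// expR_gt0.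
have lim_ex t i : exists l, t0 <= t -> forall k, `|l - z_ k t ord0 i| <= 2 * E t * 2^-1
  ^+ k.
  have [tt|tt] := leP t0 t; last by exists 0.
  have [|l Hl] := @geometric_limit R (fun k => z_ k t ord0 i) (E t) (E0 t); last
    by exists l.
  move=> k; have := rV_coord_le (z_ k.+1 t - z_ k t) i; rewrite mxE [X in _ + X]mxE =>
    /le_trans; apply.
  by apply: (le_trans (zS k tt)); rewrite /E mulrAC.
have /choice[l Hl] : forall ti : R * 'I_n, exists l, t0 <= ti.1 -> forall k,
  `|l - z_ k ti.1 ord0 ti.2| <= 2 * E ti.1 * 2^-1 ^+ k.
  by move=> [t i]; exact: lim_ex.
(* The limit is held constant before [t0], which makes it Lipschitz on the whole line; the lemmas on
   [picard_step] take curves that are continuous everywhere. *)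
pose z t : 'rV[R]_n := \row_i l (Num.max t0 t, i).
have zk t k : t0 <= t -> `|z t - z_ k t| <= 2 * E t * 2^-1 ^+ k.
  move=> tt; apply: rV_norm_le => [|i]; first by rewrite mulr_ge0 ?exprn_ge0// mulr_ge0.
  by rewrite mxE [X in _ + X]mxE /z mxE (max_r tt); exact: (Hl (t, i) tt k).
have p2 (c : R) k : 2 * c * 2^-1 ^+ k.+1 = c * 2^-1 ^+ k.
  by rewrite exprS; move: (_ ^+ k) => p; field.
have zmax t : z t = z (Num.max t0 t).
  by apply/rowP => i; rewrite !mxE [Num.max t0 (Num.max t0 t)]max_r// le_max lexx.
have z_base k : z_ k t0 = x0 by case: k => [//|k]; exact: picard_step_base.
have z0 : z t0 = x0.
  apply/eqP; rewrite -subr_eq0 -normr_le0; apply: (@le0_of_geometric _ (2 * E t0)).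
    by rewrite mulr_ge0.
  by move=> k; rewrite -[X in _ - X](z_base k); exact: zk.
have zlip0 s t : t0 <= s -> t0 <= t -> `|z s - z t| <= M * `|s - t|.
  move=> ts tt; rewrite -subr_le0; apply: (@le0_of_geometric _ (E s + E t)).
    exact: addr_ge0.
  move=> k; have h1 := zk s k.+1 ts; have h2 := zk t k.+1 tt.
  have h3 := picard_step_lipschitz s t (@cz_ k).
  rewrite lerBlDl; have -> : z s - z t = (z_ k.+1 s - z_ k.+1 t) + ((z s - z_ k.+1 s) -
    (z t - z_ k.+1 t)).
    by apply/rowP => j; rewrite !mxE; ring.
  apply: (le_trans (ler_normD _ _)); apply: lerD; first exact: h3.
  apply: (le_trans (ler_normB _ _)); rewrite mulrDl.
  by apply: lerD; [rewrite -p2|rewrite -p2].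
have zlip s t : `|z s - z t| <= M * `|s - t|.
  rewrite (zmax s) (zmax t); apply: le_trans (zlip0 _ _ _ _) _; rewrite ?le_max ?lexx//.
  rewrite ler_wpM2l//; case: (leP t0 s) => ?; case: (leP t0 t) => ? //.
  - by rewrite !ger0_norm ?subr_ge0 ?lerB// ?ltW// (lt_le_trans _ (_ : t0 <= s)).
  - by rewrite distrC [`|s - t|]distrC !ger0_norm ?subr_ge0 ?lerB// ?ltW// (lt_le_trans
    _ (_ : t0 <= t)).
  - by rewrite subrr normr0.
have cz : continuous z by exact: lipschitz_continuous zlip.
have zE t : t0 <= t -> z t = picard_step z t.
  move=> tt; apply/eqP; rewrite -subr_eq0 -normr_le0;
    apply: (@le0_of_geometric _ (2 * E t)).
    by rewrite mulr_ge0.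
  move=> k; have h1 := zk t k.+1 tt.
  have h2 : `|picard_step (z_ k) t - picard_step z t| <= E t * 2^-1 ^+ k.
    have -> : E t * 2^-1 ^+ k = (2 * (M / (2 * L)) * 2^-1 ^+ k) / 2 * expR (2 * L * (t
      - t0)).
      by rewrite /E; field; rewrite gt_eqF.
    apply: picard_step_contract => //.
      by rewrite !mulr_ge0 ?invr_ge0 ?exprn_ge0// mulr_ge0// ltW.
    by move=> s ts; rewrite distrC; apply: (le_trans (zk s k ts)); rewrite /E le_eqVlt;
      apply/orP; left; apply/eqP; ring.
  rewrite -(subrKA (z_ k.+1 t)) (le_trans (ler_normD _ _))//.
  rewrite p2 in h1; apply: (le_trans (lerD h1 h2)).
  by rewrite -mulrDl ler_wpM2r ?exprn_ge0//; have := E0 t; lra.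
exists z; split; first exact: z0.
  exact: continuous_subspaceT.
move=> t tt _; apply: is_derive_row => i.
apply: near_eq_is_derive (picard_step_derive i cz tt).
apply: filterS (lt_nbhsr tt) => s ts.
by rewrite [in RHS]zE// ltW.
Qed.

End picard.

Section uniqueness.
Context {R : realType} {n : nat}.
Variable g : R -> 'rV[R]_n -> 'rV[R]_n.
Hypothesis g_lip : forall B : R, exists2 L, 0 < L & forall t x y,
  cube (- B) B x -> cube (- B) B y -> `|g t x - g t y| <= L * `|x - y|.

Lemma segment_bounded (z : R -> 'rV[R]_n) (a b : R) : {within `[a, b], continuous z} ->
  exists2 B, 0 < B & forall t, a <= t <= b -> `|z t| <= B.
Proof.
move=> cz; have : compact (z @` `[a, b]).
  by apply: continuous_compact => //; exact: segment_compact.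
move=> /compact_bounded[B [_ hB]]; exists (`|B| + 1) => [|t tab]; first
  by rewrite ltr_wpDl.
apply: hB; first by rewrite (le_lt_trans (ler_norm _))// ltrDl.
by exists t => //=; rewrite in_itv.
Qed.

Lemma solves_within t0 x0 b z (t : R) : solves g t0 x0 b z -> (t%:E < b)%E ->
  {within `[t0, t], continuous z}.
Proof.
move=> [_ cz _] tb; apply: continuous_subspaceW cz => s /=.
rewrite in_itv/= => /andP[-> st]; split => //.
by apply: le_lt_trans tb; rewrite lee_fin.
Qed.

(** On the segment up to [t] both curves stay in a cube on which [g] is Lipschitz. Their distance is
    at most [2 * B] there, and each application of [exp_contraction] halves the weighted bound. *)
Lemma ode_unique t0 x0 b z w (t : R) : solves g t0 x0 b z -> solves g t0 x0 b w ->
  t0 <= t -> (t%:E < b)%E -> z t = w t.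
Proof.
move=> zs ws tt tb; have cz := solves_within zs tb; have cw := solves_within ws tb.
have [Bz Bz0 zB] := segment_bounded cz; have [Bw Bw0 wB] := segment_bounded cw.
have [z0 _ dz] := zs; have [w0 _ dw] := ws.
pose B := Bz + Bw.
have B0 : 0 < B by exact: addr_gt0.
have {}zB s : t0 <= s <= t -> cube (- B) B (z s).
  by move=> st; apply: cube_norm; apply: (le_trans (zB _ st)); rewrite lerDl ltW.
have {}wB s : t0 <= s <= t -> cube (- B) B (w s).
  by move=> st; apply: cube_norm; apply: (le_trans (wB _ st)); rewrite lerDr ltW.
have [L L0 HL] := g_lip B.
have H k s : t0 <= s <= t -> `|z s - w s| <= (2 * B) * 2^-1 ^+ k * expR (2 * L * (s -
  t0)).
  elim: k s => [|k IH] s st.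
    have h1 : `|z s| <= B by apply: norm_cube; [exact: ltW|exact: zB].
    have h2 : `|w s| <= B by apply: norm_cube; [exact: ltW|exact: wB].
    rewrite expr0 mulr1; apply: (@le_trans _ _ (2 * B)).
      by apply: (le_trans (ler_normB _ _)); lra.
    rewrite ler_peMr ?mulr_ge0 ?(ltW B0)// -expR0 ler_expR mulr_ge0//.
      by rewrite mulr_ge0// ltW.
    by rewrite subr_ge0; case/andP: st.
  have c0 : 0 <= (2 * B) * 2^-1 ^+ k by rewrite mulr_ge0 ?exprn_ge0// mulr_ge0// ltW.
  apply: rV_norm_le => [|i].
    by rewrite mulr_ge0 ?(ltW (expR_gt0 _))// exprS mulrCA mulr_ge0.
  rewrite exprSr mulrA mxE [X in _ + X]mxE; have /andP[ts0 st1] := st.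
  have sub : `[t0, s] `<=` `[t0, t].
    by move=> r /=; rewrite !in_itv/= => /andP[-> /le_trans]; apply.
  apply: (@exp_contraction _ (fun s => z s ord0 i - w s ord0 i)
    (fun s => g s (z s) ord0 i - g s (w s) ord0 i)) => //.
  - have c1 := within_continuous_coord (i := i) (continuous_subspaceW sub cz).
    have c2 := within_continuous_coord (i := i) (continuous_subspaceW sub cw).
    by move=> r; apply: cvgB; [exact: c1|exact: c2].
  - by rewrite z0 w0 subrr.
  move=> r /andP[r0 rs].
  have rt : t0 <= r <= t by rewrite ltW//= ltW// (lt_le_trans rs).
  have rb : (r%:E < b)%E by apply: lt_trans tb; rewrite lte_fin (lt_le_trans rs).
  split; first by apply: is_deriveB; apply: is_derive_coord; [exact: dz|exact: dw].
  apply: (@le_trans _ _ (L * `|z r - w r|)); last by rewrite ler_wpM2l ?(ltW L0)// IH.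
  apply: (le_trans _ (HL r _ _ (zB _ rt) (wB _ rt))).
  by have := rV_coord_le (g r (z r) - g r (w r)) i; rewrite !mxE.
apply/eqP; rewrite -subr_eq0 -normr_le0.
apply: (@le0_of_geometric _ (2 * B * expR (2 * L * (t - t0)))).
  by rewrite !mulr_ge0 ?(ltW B0)// ltW// expR_gt0.
by move=> k; rewrite mulrAC; apply: H; rewrite tt lexx.
Qed.

End uniqueness.

(** * Averaging and practical stability *)

Section averaging.
Context {R : realType} {n : nat}.
Variables (h : R -> 'rV[R]_n -> 'rV[R]_n) (hb : 'rV[R]_n -> 'rV[R]_n) (L M : R).
Hypothesis L_gt0 : 0 < L.
Hypothesis M_gt0 : 0 < M.
Hypothesis hL : forall t x y, `|h t x - h t y| <= L * `|x - y|.
Hypothesis hM : forall t x, `|h t x| <= M.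
Hypothesis ch : forall x i, continuous (fun t => h t x ord0 i).
Hypothesis hbL : forall x y, `|hb x - hb y| <= L * `|x - y|.
Hypothesis hbM : forall x, `|hb x| <= M.
Hypothesis havg : forall e, 0 < e -> exists2 T0, 0 < T0 & forall x t0 T i, T0 <= T ->
  `|T^-1 * primitive t0 (fun s => h s x ord0 i) (t0 + T) - hb x ord0 i| <= e.

(** Unlike [solves], this records no initial value, so that a solution can be restricted to any
    later window and compared afresh there. *)
Definition solves_on (f : R -> 'rV[R]_n -> 'rV[R]_n) (t0 t1 : R) (z : R -> 'rV[R]_n) :=
  {within `[t0, t1], continuous z} /\
  forall t, t0 < t < t1 -> is_derive t (1 : R) z (f t (z t)).

Lemma solves_on_lipschitz f t0 t1 z s t : (forall t x, `|f t x| <= M) ->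
  solves_on f t0 t1 z -> t0 <= s -> s <= t -> t <= t1 -> `|z t - z s| <= M * (t - s).
Proof.
move=> fM [cz dz] ts st tt; apply: rV_norm_le => [|i].
  by rewrite mulr_ge0 ?(ltW M_gt0)// subr_ge0.
rewrite mxE [X in _ + X]mxE.
have sub : `[s, t] `<=` `[t0, t1].
  move=> r /=; rewrite !in_itv/= => /andP[sr rt].
  by rewrite (le_trans ts sr) (le_trans rt tt).
apply: (@derivative_comparison _ (fun r => z r ord0 i - z s ord0 i) (fun r => M * (r - s))
  (fun r => f r (z r) ord0 i) (fun=> M) s t) => //.
- have c1 := within_continuous_coord (i := i) (continuous_subspaceW sub cz).
  by move=> r; apply: cvgB; [exact: c1|exact: cvg_cst].
- apply: continuous_subspaceT; apply: continuous_scalef; apply: continuous_subf.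
    by move=> r; exact: cvg_id.
  exact: cst_continuous.
- move=> r /andP[sr rt]; have rI : t0 < r < t1 by rewrite (le_lt_trans ts sr)
  (lt_le_trans rt tt).
  split.
  + have := is_deriveB (is_derive_coord i (dz r rI)) (is_derive_cst (z s ord0 i) r (1 :
    R)).
    by rewrite subr0.
  + have := is_deriveZ M (is_deriveB (is_derive_id r (1 : R)) (is_derive_cst s r (1 :
    R))).
    by rewrite subr0 -[M *: 1]/(M * 1) mulr1.
  + exact: le_trans (rV_coord_le _ _) (fM _ _).
by rewrite !subrr normr0 mulr0.
Qed.

Lemma solves_on_sub f t0 t1 s t z : t0 <= s -> t <= t1 -> solves_on f t0 t1 z ->
  solves_on f s t z.
Proof.
move=> ts tt [cz dz]; split.
  apply: continuous_subspaceW cz => r /=; rewrite !in_itv/= => /andP[sr rt].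
  by rewrite (le_trans ts sr) (le_trans rt tt).
by move=> r /andP[sr rt]; apply: dz; rewrite (le_lt_trans ts sr) (lt_le_trans rt tt).
Qed.

Lemma is_derive_scaled_primitive (g : R -> R) (eps s t : R) : continuous g ->
  0 < eps -> s < t ->
  is_derive t (1 : R) (fun t => eps * primitive (s / eps) g (t / eps)) (g (t / eps)).
Proof.
move=> cg e0 st.
have A : is_derive t (1 : R) (fun t => t / eps) eps^-1.
  have := is_deriveZ eps^-1 (is_derive_id t (1 : R)).
  rewrite -[eps^-1 *: 1]/(eps^-1 * 1) mulr1.
  by rewrite (_ : (eps^-1 \*: id) = (fun t => t / eps))//; apply/funext => r;
    rewrite mulrC.
have st' : s / eps < t / eps by rewrite ltr_pM2r ?invr_gt0.
have B := @is_derive1_comp _ (primitive (s / eps) g) (fun t =>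
  t / eps) t _ _ (is_derive_primitive cg st') A.
have := is_deriveZ eps B; rewrite -[eps *: _]/(eps * _).
by rewrite (_ : eps * _ = g (t / eps))//; field; rewrite gt_eqF.
Qed.

Lemma averaging_step (eps gam eta s t1 : R) x z :
  0 < eps -> 0 < eta -> 0 <= gam ->
  (forall y i, `|(eta / eps)^-1 * primitive (s / eps) (fun r =>
    h r y ord0 i) (s / eps + eta / eps) -
    hb y ord0 i| <= gam) ->
  solves_on (fun t => h (t / eps)) s t1 x -> solves_on (fun _ => hb) s t1 z ->
    s + eta <= t1 ->
  `|x (s + eta) - z (s + eta)| <=
    `|x s - z s| + eta * (gam + 2 * L * M * eta + L * `|x s - z s|).
Proof.
move=> eps0 eta0 gam0 Hg xs zs st1; set e := `|x s - z s|.
have se : s <= s + eta by rewrite lerDl ltW.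
have e0 : 0 <= e by exact: normr_ge0.
have [cx dx] := solves_on_sub (lexx s) st1 xs; have [cz dz] :=
  solves_on_sub (lexx s) st1 zs.
pose y := x s.
have xl t : s <= t -> t <= s + eta -> `|x t - y| <= M * eta.
  move=> st tt; apply: (le_trans (@solves_on_lipschitz _ s t1 x s t _ xs (lexx s) st
    (le_trans tt st1))).
    by move=> r v; exact: hM.
  by rewrite ler_wpM2l ?(ltW M_gt0)// lerBlDl.
have zl t : s <= t -> t <= s + eta -> `|z t - y| <= M * eta + e.
  move=> st tt; have := @solves_on_lipschitz _ s t1 z s t _ zs (lexx s) st (le_trans tt
    st1).
  move=> /(_ (fun _ => hbM)) h1; rewrite -(subrKA (z s)) (le_trans (ler_normD _ _))//
    lerD//.
    by apply: (le_trans h1); rewrite ler_wpM2l ?(ltW M_gt0)// lerBlDl.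
  by rewrite distrC.
pose C := L * (M * eta) + L * (M * eta + e).
have coordb i : `|x (s + eta) ord0 i - z (s + eta) ord0 i| <= C * eta + eta * gam + e.
  pose g (r : R) : R := h r y ord0 i; have cg : continuous g by exact: ch.
  pose Q t := eps * primitive (s / eps) g (t / eps).
  have cQ : continuous Q.
    apply: continuous_scalef.
    have cp : continuous (primitive (s / eps) g).
      by apply: (primitive_continuous (M := M)) => // r;
        exact: le_trans (rV_coord_le _ _) (hM _ _).
    have cm : continuous (fun t : R => t / eps) by exact: mulrr_continuous.
    by move=> t; exact: (@continuous_comp _ _ _ (fun t : R =>
      t / eps) (primitive (s / eps) g) t (cm t) (cp _)).
  have Q0 : Q s = 0 by rewrite /Q primitive_base mulr0.
  have Qe : `|Q (s + eta) - eta * hb y ord0 i| <= eta * gam.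
    have -> : Q (s + eta) = eta * ((eta / eps)^-1 * primitive (s / eps) g (s / eps +
      eta / eps)).
      by rewrite /Q mulrDl; field; rewrite !gt_eqF.
    by rewrite -mulrBr normrM gtr0_norm// ler_wpM2l ?(ltW eta0)//; exact: Hg.
  (* x - z minus the integral of the field oscillating at the frozen point y has
     a derivative of size O(eta + e). *)
  pose u t := (x t ord0 i - z t ord0 i) - (Q t - (t - s) * hb y ord0 i) - (x s ord0 i -
    z s ord0 i).
  have hu : `|u (s + eta)| <= C * (s + eta - s).
    apply: (@derivative_comparison _ u (fun t => C * (t - s))
      (fun t => (h (t / eps) (x t) ord0 i - hb (z t) ord0 i) - (g (t / eps) - hb y ord0
        i)) (fun=> C) s (s + eta)) => //.
    - have c1 := within_continuous_coord (i := i) cx; have c2 :=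
      within_continuous_coord (i := i) cz.
      have c3 : continuous (fun t => Q t - (t - s) * hb y ord0 i).
        apply: continuous_subf => //; apply: continuous_mulf; last exact: cst_continuous.
        by apply: continuous_subf; [move=> r; exact: cvg_id|exact: cst_continuous].
      have c4 := continuous_subspaceT (A := `[s, s + eta]%classic) c3.
      by move=> r; apply: cvgB; [apply: cvgB; [apply: cvgB;
        [exact: c1|exact: c2]|exact: c4]|exact: cvg_cst].
    - apply: continuous_subspaceT; apply: continuous_scalef; apply: continuous_subf.
        by move=> r; exact: cvg_id.
      exact: cst_continuous.
    - move=> t tI; have /andP[st te] := tI; split.
      + have d1 := is_deriveB (is_derive_coord i (dx t tI)) (is_derive_coord i (dz t tI)).
        have d2 := is_derive_scaled_primitive cg eps0 st.
        have d3 : is_derive t (1 : R) (fun t => (t - s) * hb y ord0 i) (hb y ord0 i).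
          have := is_deriveZ (hb y ord0 i) (is_deriveB (is_derive_id t (1 : R))
            (is_derive_cst s t (1 : R))).
          rewrite subr0 -[_ *: 1]/(_ * 1) mulr1.
          rewrite (_ : (hb y ord0 i \*: _) = (fun t => (t - s) * hb y ord0 i))//.
          by apply/funext => r; rewrite [RHS]mulrC.
        have := is_deriveB (is_deriveB d1 (is_deriveB d2 d3)) (is_derive_cst (x s ord0
          i - z s ord0 i) t (1 : R)).
        by rewrite subr0.
      + have := is_deriveZ C (is_deriveB (is_derive_id t (1 : R)) (is_derive_cst s t (1
        : R))).
        by rewrite subr0 -[C *: 1]/(C * 1) mulr1.
      + have -> : h (t / eps) (x t) ord0 i - hb (z t) ord0 i - (g (t / eps) - hb y ord0
        i) =
          (h (t / eps) (x t) ord0 i - h (t / eps) y ord0 i) - (hb (z t) ord0 i - hb y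
            ord0 i) by rewrite /g; ring.
        apply: (le_trans (ler_normB _ _)); rewrite /C lerD//.
          apply: (@le_trans _ _ (L * `|x t - y|)); last
            by rewrite ler_wpM2l ?(ltW L_gt0)// xl// ltW.
          apply: le_trans (hL (t / eps) _ _).
          by have := rV_coord_le (h (t / eps) (x t) - h (t / eps) y) i; rewrite !mxE.
        apply: (@le_trans _ _ (L * `|z t - y|)); last
          by rewrite ler_wpM2l ?(ltW L_gt0)// zl// ltW.
        apply: le_trans (hbL _ _).
        by have := rV_coord_le (hb (z t) - hb y) i; rewrite !mxE.
    by rewrite /u Q0 !subrr mul0r !subr0 subrr normr0 mulr0.
  have -> : x (s + eta) ord0 i - z (s + eta) ord0 i = u (s + eta) + (Q (s + eta) - eta
    * hb y ord0 i) +
    (x s ord0 i - z s ord0 i) by rewrite /u; ring.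
  apply: (le_trans (ler_normD _ _)); apply: lerD; last first.
    by have := rV_coord_le (x s - z s) i; rewrite !mxE.
  apply: (le_trans (ler_normD _ _)); apply: lerD => //.
  by move: hu; rewrite addrAC subrr add0r.
have eE : e + eta * (gam + 2 * L * M * eta + L * e) = C * eta + eta * gam + e
  by rewrite /C; ring.
have L0 := ltW L_gt0; have M0 := ltW M_gt0; have eta1 := ltW eta0.
have C0 : 0 <= C by apply: addr_ge0; rewrite !mulr_ge0// addr_ge0// mulr_ge0.
rewrite eE; apply: rV_norm_le => [|i].
  by rewrite addr_ge0// addr_ge0// mulr_ge0.
by rewrite mxE [X in _ + X]mxE.
Qed.

Lemma discrete_gronwall (e : nat -> R) (q eta : R) N : 0 <= q -> 0 <= eta ->
  e 0%N <= 0 -> (forall j, (j < N)%N -> e j.+1 <= e j + eta * (q + L * e j)) ->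
  forall j, (j <= N)%N -> e j <= q * (j%:R * eta) * expR (L * (j%:R * eta)).
Proof.
move=> q0 eta0 e0 He; elim=> [_|j IH jN]; first by rewrite mul0r mulr0 mul0r.
have L0 := ltW L_gt0.
apply: (le_trans (He j jN)).
have j0 : 0 <= j%:R * eta by rewrite mulr_ge0.
have h1 := IH (ltnW jN).
have h2 : 1 + L * eta <= expR (L * eta) by exact: expR_ge1Dx.
have -> : expR (L * (j.+1%:R * eta)) = expR (L * (j%:R * eta)) * expR (L * eta).
  by rewrite -expRD -mulrDr -natr1 mulrDl mul1r.
have E1 : 1 <= expR (L * (j%:R * eta)) by rewrite -[X in X <= _]expR0 ler_expR;
  apply: mulr_ge0.
have F1 : 1 <= expR (L * eta) by rewrite -[X in X <= _]expR0 ler_expR; apply: mulr_ge0.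
rewrite -natr1; move: (expR (L * eta)) (expR (L * _)) h1 h2 E1 F1 => F E h1 h2 E1 F1.
have -> : q * ((j%:R + 1) * eta) * (E * F) = (q * (j%:R * eta) * E) * F + eta * q * (E
  * F) by ring.
have -> : e j + eta * (q + L * e j) = e j * (1 + L * eta) + eta * q * 1 by ring.
apply: lerD.
  apply: (@le_trans _ _ ((q * (j%:R * eta) * E) * (1 + L * eta))).
    by rewrite ler_wpM2r// addr_ge0// mulr_ge0.
  by rewrite ler_wpM2l// !mulr_ge0// (le_trans ler01).
by rewrite ler_wpM2l ?mulr_ge0//; nra.
Qed.

Lemma averaging_theorem (tau del : R) : 0 < tau -> 0 < del ->
  exists2 epss, 0 < epss & forall eps t0 x z, 0 < eps -> eps < epss ->
    solves_on (fun t => h (t / eps)) t0 (t0 + tau) x ->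
    solves_on (fun _ => hb) t0 (t0 + tau) z -> x t0 = z t0 ->
    forall t, t0 <= t <= t0 + tau -> `|x t - z t| <= del.
Proof.
move=> tau0 del0; have L0 := ltW L_gt0; have M0 := ltW M_gt0.
(* [K] is the Gronwall factor over the horizon. Half of [del] goes to [gam * K]; the other half
   covers the freezing error [2 * L * M * eta * K] and the drift [2 * M * eta] between grid points,
   which fixes the number [N] of steps. *)
pose K := tau * expR (L * tau); have K0 : 0 < K by rewrite mulr_gt0// expR_gt0.
pose gam := del / (2 * K); have gam0 : 0 < gam by rewrite divr_gt0// mulr_gt0.
pose A := (2 * L * M * K + 2 * M) * tau / (del / 2).
pose N := (Num.trunc A).+1; have NA : A < N%:R by exact: truncnS_gt.
have N0 : 0 < N%:R :> R by rewrite ltr0n.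
pose eta := tau / N%:R; have eta0 : 0 < eta by rewrite divr_gt0.
have etaN : N%:R * eta = tau by rewrite /eta mulrC divfK// gt_eqF.
have small : eta * (2 * L * M * K + 2 * M) <= del / 2.
  have : (2 * L * M * K + 2 * M) * tau <= N%:R * (del / 2).
    by rewrite -ler_pdivrMr ?divr_gt0// ltW.
  rewrite (_ : eta * _ = (2 * L * M * K + 2 * M) * tau / N%:R); last by rewrite /eta;
    ring.
  by rewrite ler_pdivrMr// [N%:R * _]mulrC.
have [T0 T00 HT] := havg gam0.
(* For [eps] below [eta / T0] a step of slow length [eta] lasts at least [T0] in fast time, long
   enough for the mean to be [gam]-accurate. *)
exists (eta / T0) => [|eps t0 x z eps0 epsT xs zs xz]; first exact: divr_gt0.
have etaT : T0 <= eta / eps.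
  by rewrite ler_pdivlMr// mulrC -ler_pdivlMr// ltW.
pose q := gam + 2 * L * M * eta.
have q0 : 0 <= q by rewrite addr_ge0 ?(ltW gam0)// !mulr_ge0// ltW.
pose s j := t0 + j%:R * eta.
have sS j : s j.+1 = s j + eta by rewrite /s -natr1; ring.
have s_ge j : t0 <= s j by rewrite /s lerDl mulr_ge0// ltW.
have s_le j : (j <= N)%N -> s j <= t0 + tau.
  by move=> jN; rewrite /s -etaN lerD2l ler_wpM2r ?(ltW eta0)// ler_nat.
have He j : (j < N)%N -> `|x (s j.+1) - z (s j.+1)| <=
    `|x (s j) - z (s j)| + eta * (q + L * `|x (s j) - z (s j)|).
  move=> jN; have st := s_le j.+1 jN; rewrite sS in st *.
  apply: (@averaging_step eps gam eta (s j) (t0 + tau)) => //.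
  - exact: ltW.
  - by move=> y i; exact: HT.
  - exact: solves_on_sub xs.
  - exact: solves_on_sub zs.
have E j : (j <= N)%N -> `|x (s j) - z (s j)| <= q * K.
  move=> jN; have := @discrete_gronwall (fun j => `|x (s j) - z (s j)|) q eta N q0 (ltW
    eta0) _ He j jN.
  have -> : s 0%N = t0 by rewrite /s mul0r addr0.
  rewrite xz subrr normr0 => /(_ (lexx _)) /le_trans; apply.
  rewrite -mulrA ler_wpM2l//.
  have jt : j%:R * eta <= tau by rewrite -etaN ler_wpM2r ?(ltW eta0)// ler_nat.
  apply: ler_pM => //; first by rewrite mulr_ge0// ltW.
  by rewrite ler_expR ler_wpM2l.
move=> t /andP[tt0 tt1].
pose j := Num.trunc ((t - t0) / eta).
have d0 : 0 <= (t - t0) / eta by rewrite divr_ge0 ?subr_ge0// ltW.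
have /andP[j1 j2] := truncn_itv d0.
have sj : s j <= t by rewrite /s -lerBrDl -ler_pdivlMr.
have jN : (j <= N)%N.
  rewrite -(ler_nat R) (le_trans j1)// ler_pdivrMr// etaN lerBlDl.
  exact: tt1.
have tj : t - s j <= eta.
  move: j2; rewrite -natr1 ltr_pdivrMr// mulrDl mul1r => /ltW.
  by rewrite /s; lra.
have xl := @solves_on_lipschitz _ t0 (t0 + tau) x (s j) t (fun r v =>
  hM (r / eps) v) xs (s_ge j) sj tt1.
have zl := @solves_on_lipschitz _ t0 (t0 + tau) z (s j) t (fun _ =>
  hbM) zs (s_ge j) sj tt1.
have -> : x t - z t = (x t - x (s j)) - (z t - z (s j)) + (x (s j) - z (s j)).
  by apply/rowP => i; rewrite !mxE; ring.
apply: (le_trans (ler_normD _ _)).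
have Mt : M * (t - s j) <= M * eta by rewrite ler_wpM2l.
have h1 : `|(x t - x (s j)) - (z t - z (s j))| <= 2 * M * eta.
  by apply: (le_trans (ler_normB _ _)); lra.
apply: (le_trans (lerD h1 (E j jN))).
have -> : 2 * M * eta + q * K = eta * (2 * L * M * K + 2 * M) + gam * K by rewrite /q;
  ring.
have -> : gam * K = del / 2 by rewrite /gam; field; rewrite gt_eqF.
lra.
Qed.

End averaging.

(** * From averaging on finite windows to practical stability *)

Section practical_stability.
Context {R : realType} {n : nat}.
Variables (g : R -> 'rV[R]_n -> 'rV[R]_n) (gb : 'rV[R]_n -> 'rV[R]_n) (p : 'rV[R]_n).
Hypothesis g_bounds : forall B : R, exists2 L, 0 < L & forall t x y,
  cube (- B) B x -> cube (- B) B y -> `|g t x| <= L /\ `|g t x - g t y| <= L * `|x - y|.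
Hypothesis g_cont : forall x i, continuous (fun t => g t x ord0 i).
Hypothesis gb_bounds : forall B : R, exists2 L, 0 < L & forall x y,
  cube (- B) B x -> cube (- B) B y -> `|gb x| <= L /\ `|gb x - gb y| <= L * `|x - y|.
Hypothesis g_avg : forall B e : R, 0 < e -> exists2 T0, 0 < T0 & forall x t0 T i,
  cube (- B) B x -> T0 <= T ->
  `|T^-1 * primitive t0 (fun s => g s x ord0 i) (t0 + T) - gb x ord0 i| <= e.

Lemma averaging_cube (B tau del : R) : 0 < B -> 0 < tau -> 0 < del ->
  exists2 epss, 0 < epss & forall eps t0 x z, 0 < eps -> eps < epss ->
    solves_on (fun t x => g (t / eps) (clamp (- B) B x)) t0 (t0 + tau) x ->
    solves_on (fun _ x => gb (clamp (- B) B x)) t0 (t0 + tau) z -> x t0 = z t0 ->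
    forall t, t0 <= t <= t0 + tau -> `|x t - z t| <= del.
Proof.
move=> B0 tau0 del0; have [L1 L10 H1] := g_bounds B; have [L2 L20 H2] := gb_bounds B.
have BB : - B <= B by rewrite ge0_cp ?ltW.
have cl (x : 'rV[R]_n) : cube (- B) B (clamp (- B) B x) by exact: clamp_cube.
have L0 : 0 < L1 + L2 by exact: addr_gt0.
apply: (@averaging_theorem R n (fun t x => g t (clamp (- B) B x)) (fun x =>
  gb (clamp (- B) B x))
  (L1 + L2) (L1 + L2)) => //.
- move=> t x y; have [_ h] := H1 t _ _ (cl x) (cl y); apply: (le_trans h).
  by rewrite ler_pM ?(ltW L10)// ?lipschitz_clamp// lerDl ltW.
- by move=> t x; have [h _] := H1 t _ _ (cl x) (cl x); rewrite (le_trans h)// lerDl ltW.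
- move=> x y; have [_ h] := H2 _ _ (cl x) (cl y); apply: (le_trans h).
  by rewrite ler_pM ?(ltW L20)// ?lipschitz_clamp// lerDr ltW.
- by move=> x; have [h _] := H2 _ _ (cl x) (cl x); rewrite (le_trans h)// lerDr ltW.
- move=> e e0; have [T0 T00 HT] := g_avg B e0; exists T0 => // x t0 T i TT.
  exact: HT.
Qed.

Lemma clamped_exists (B eps t0 : R) x0 : 0 < B -> 0 < eps ->
  exists x, solves (fun t x => g (t / eps) (clamp (- B) B x)) t0 x0 +oo%E x.
Proof.
move=> B0 eps0; have [L L0 HL] := g_bounds B.
have BB : - B <= B by rewrite ge0_cp ?ltW.
have cl (x : 'rV[R]_n) : cube (- B) B (clamp (- B) B x) by exact: clamp_cube.
apply: (@picard_exists R n _ L L t0 x0 L0).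
- move=> t x y; have [_ h] := HL (t / eps) _ _ (cl x) (cl y); apply: (le_trans h).
  by rewrite ler_wpM2l ?(ltW L0)// lipschitz_clamp.
- by move=> t x; have [] := HL (t / eps) _ _ (cl x) (cl x).
- move=> x i; have cm : continuous (fun t : R => t / eps) by exact: mulrr_continuous.
  have cg := @g_cont (clamp (- B) B x) i.
  by move=> t; exact: (@continuous_comp _ _ _ (fun t : R => t / eps) (fun t =>
    g t (clamp (- B) B x) ord0 i) t (cm t) (cg _)).
Qed.

Lemma solves_solves_on (f : R -> 'rV[R]_n -> 'rV[R]_n) t0 x0 z (s t : R) : solves f t0
  x0 +oo%E z -> t0 <= s ->
  solves_on f s t z.
Proof.
move=> [_ cz dz] ts; split; last by move=> r /andP[sr _]; apply: dz;
  rewrite ?ltry// (le_lt_trans ts).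
apply: continuous_subspaceW cz => r /=; rewrite in_itv/= => /andP[sr _].
by rewrite (le_trans ts sr) ltry.
Qed.

Variable beta : R -> R -> R.
Hypothesis betaKL : class_KL beta.
Hypothesis gb_stable : forall t0 x0, solutions_global (fun _ z => gb z) t0 x0
  (fun t z => enorm (z - p) <= beta (enorm (x0 - p)) (t - t0)).

Lemma KL_mono r r' s : 0 <= r -> r <= r' -> 0 <= s -> beta r s <= beta r' s.
Proof.
move=> r0; rewrite le_eqVlt => /predU1P[->//|rr] s0; case: betaKL => _ _ H _.
by have [_ h] := H s s0; exact: ltW (h r r' r0 rr).
Qed.

Lemma KL_ge0 r s : 0 <= r -> 0 <= s -> 0 <= beta r s.
Proof. by case: betaKL => H _ _ _; exact: H. Qed.

Lemma KL_decr r s s' : 0 <= r -> 0 <= s -> s <= s' -> beta r s' <= beta r s.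
Proof.
rewrite le_eqVlt => /predU1P[<-|r0] s0 ss; case: betaKL => _ _ H1 H2.
  by rewrite (H1 s s0).1 (H1 s' (le_trans s0 ss)).1.
by have [h _] := H2 r r0; exact: h.
Qed.

Lemma KL_small_radius nu : 0 < nu -> exists2 r, 0 < r & beta r 0 <= nu.
Proof.
move=> nu0; case: betaKL => _ cb H1 _; have [b0 _] := H1 0 (lexx _).
have c0 : beta q.1 q.2 @[q --> within [set q : R * R | 0 <= q.1 /\ 0 <= q.2] (nbhs (0,
  0))] --> (0 : R).
  rewrite -[X in _ --> X]b0.
  exact: (subspace_continuousP _ _).1 cb ((0 : R), (0 : R)) (conj (lexx _) (lexx _)).
have /cvgrPdist_le /(_ _ nu0) [[U V] [U0 V0] UV] := c0.
have /nbhs_ballP[e /= e0 He] := U0.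
have e2 : 0 < e / 2 by rewrite divr_gt0.
exists (e / 2) => //.
have Ue : U (e / 2).
  by apply: He; rewrite -ball_normE /= sub0r normrN gtr0_norm//; lra.
have := UV (e / 2, 0) (conj Ue (nbhs_singleton V0)) (conj (ltW e2) (lexx _)).
by rewrite sub0r normrN /= => /(le_trans (ler_norm _)).
Qed.

Lemma KL_small_time r nu : 0 < r -> 0 < nu -> exists2 T, 0 < T & beta r T <= nu.
Proof.
move=> r0 nu0; case: betaKL => _ _ _ H; have [_ cb] := H r r0.
have /cvgrPdist_le /(_ _ nu0)[T [_ HT]] := cb.
have T1 : 0 < Num.max (T + 1) 1 by rewrite lt_max ltr01 orbT.
exists (Num.max (T + 1) 1) => //.
have := HT (Num.max (T + 1) 1); rewrite lt_max ltrDl ltr01 => /(_ isT).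
by rewrite sub0r normrN => /(le_trans (ler_norm _)).
Qed.

Lemma practical_stability (Delta nu : R) : 0 < Delta -> 0 < nu ->
  exists2 epss, 0 < epss & forall eps t0 x0, 0 < eps -> eps < epss ->
    enorm (x0 - p) <= Delta ->
    solutions_global (fun t x => g (t / eps) x) t0 x0 (fun t x =>
      enorm (x - p) <= beta (enorm (x0 - p)) (t - t0) + nu).
Proof.
move=> D0 nu0; have nu2 : 0 < nu / 2 by rewrite divr_gt0.
have [r' r'0 hr'] := KL_small_radius nu2.
(* Points of the ball of radius [r] must also be admissible starting points for the next window,
   hence the minimum with [Delta]. *)
pose r := Num.min r' Delta.
have r0 : 0 < r by rewrite lt_min r'0.
have rD : r <= Delta by rewrite ge_min lexx orbT.
have br : beta r 0 <= nu / 2.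
  by apply: le_trans hr'; apply: KL_mono; rewrite ?(ltW r0)// ge_min lexx.
have r2 : 0 < r / 2 by rewrite divr_gt0.
have [T T0 bT] := KL_small_time D0 r2.
have bD0 : 0 <= beta Delta 0 by apply: KL_ge0 => //; exact: ltW.
(* Averaged and perturbed trajectories from the [Delta]-ball remain in the cube of this radius, so
   that the clamping is never felt. *)
pose B := `|p| + (beta Delta 0 + nu).
have B0 : 0 < B by rewrite ltr_wpDl// ltr_wpDl.
have inB (y : 'rV[R]_n) : enorm (y - p) <= beta Delta 0 + nu -> cube (- B) B y.
  move=> hy; apply: cube_norm; rewrite -[y](subrK p) addrC (le_trans (ler_normD _ _))//
    lerD2l.
  exact: le_trans (norm_le_enorm _) hy.
(* The averaging error [d] has to fit beside [beta Delta T <= r / 2] at a restart, and beside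
   [beta r 0 <= nu / 2] in between. Division by [n + 1] below pays for the passage from the sup norm
   to the Euclidean one. *)
pose d := Num.min (nu / 2) (r / 2).
have d0 : 0 < d by rewrite lt_min nu2.
have dnu : d <= nu / 2 by rewrite ge_min lexx.
have dr : d <= r / 2 by rewrite ge_min lexx orbT.
have del0 : 0 < d / n.+1%:R by rewrite divr_gt0.
have [epss epss0 Hav] := averaging_cube B0 T0 del0.
exists epss => // eps t0 x0 eps0 epse x0D.
(* The averaged solution is restarted at [x s], so only the error of one window enters. *)
have core s x : enorm (x s - p) <= Delta ->
    solves_on (fun t x => g (t / eps) (clamp (- B) B x)) s (s + T) x ->
    forall t, s <= t <= s + T -> enorm (x t - p) <= beta (enorm (x s - p)) (t - s) + d.
  move=> xD xs t st; have [[z zs] _ Pz] := gb_stable s (x s).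
  have zP := Pz z zs; have [z0 _ _] := zs.
  have zB q : s <= q -> cube (- B) B (z q).
    move=> sq; apply: inB; apply: (le_trans (zP q sq)).
    apply: (@le_trans _ _ (beta Delta 0)); last by rewrite lerDl ltW.
    apply: (@le_trans _ _ (beta Delta (q - s))).
      by apply: KL_mono => //; rewrite ?enorm_ge0 ?subr_ge0.
    by apply: KL_decr => //; rewrite ?subr_ge0// ltW.
  have zs' : solves_on (fun _ x => gb (clamp (- B) B x)) s (s + T) z.
    have [cz dz] := solves_solves_on (s + T) zs (lexx s); split => // q qI.
    by rewrite clamp_id; [exact: dz|apply: zB; case/andP: qI => /ltW].
  have xz := Hav eps s x z eps0 epse xs zs' (esym z0) t st.
  have -> : x t - p = (z t - p) + (x t - z t) by apply/rowP => i; rewrite !mxE; ring.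
  apply: (le_trans (enormD _ _)); apply: lerD; first by apply: zP; case/andP: st.
  apply: (le_trans (enorm_le_norm _)).
  by rewrite mulrC -ler_pdivlMr.
have [x xs] := clamped_exists t0 x0 B0 eps0.
have [x00 cx dx] := xs.
pose s j := t0 + j%:R * T.
have sS j : s j.+1 = s j + T by rewrite /s -natr1; ring.
have s_ge j : t0 <= s j by rewrite /s lerDl mulr_ge0// ltW.
have xon j : solves_on (fun t x => g (t / eps) (clamp (- B) B x)) (s j) (s j + T) x.
  exact: solves_solves_on xs (s_ge j).
have next j : enorm (x (s j) - p) <= Delta -> enorm (x (s j.+1) - p) <= r.
  move=> h; have := core (s j) x h (xon j) (s j.+1).
  rewrite sS lexx lerDl (ltW T0) => /(_ isT) /le_trans; apply.
  rewrite [r]splitr lerD// addrAC subrr add0r; apply: le_trans bT.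
  by apply: KL_mono => //; [exact: enorm_ge0|exact: ltW].
have s0 : s 0%N = t0 by rewrite /s mul0r addr0.
have xr j : enorm (x (s j.+1) - p) <= r.
  elim: j => [|j IH]; first by apply: next; rewrite s0 x00.
  by apply: next; exact: le_trans rD.
have xP t : t0 <= t -> enorm (x t - p) <= beta (enorm (x0 - p)) (t - t0) + nu.
  move=> tt; have [tT|tT] := leP t (t0 + T).
    have := core t0 x; rewrite x00 => /(_ x0D); rewrite -{1 2}s0 => /(_ (xon 0%N) t).
    rewrite tt tT => /(_ isT) /le_trans; apply; rewrite lerD2l (le_trans dnu)//.
    by rewrite ler_pdivrMr// ler_peMr ?(ltW nu0)// ler1n.
  pose j := Num.trunc ((t - t0) / T).
  have q0 : 0 <= (t - t0) / T by rewrite divr_ge0 ?subr_ge0// ltW.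
  have /andP[j1 j2] := truncn_itv q0.
  have j0 : (0 < j)%N.
    by rewrite truncn_gt0 ler_pdivlMr// mul1r lerBrDl ltW.
  have sj : s j <= t by rewrite /s -lerBrDl -ler_pdivlMr.
  have tj : t <= s j + T.
    by move: j2; rewrite -natr1 ltr_pdivrMr// mulrDl mul1r => /ltW; rewrite /s; lra.
  have hj : enorm (x (s j) - p) <= r by case: (j) j0 => // k _; exact: xr.
  have := core (s j) x (le_trans hj rD) (xon j) t; rewrite sj tj => /(_ isT) /le_trans;
    apply.
  (* After the first window the distance is already at most [nu / 2 + nu / 2]; of the [beta] term in
     the goal only nonnegativity is used. *)
  apply: ler_wpDl; first by apply: KL_ge0; rewrite ?enorm_ge0 ?subr_ge0.
  rewrite [nu]splitr lerD//; apply: le_trans br.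
  apply: (@le_trans _ _ (beta r (t - s j))).
    by apply: KL_mono; rewrite ?enorm_ge0 ?subr_ge0.
  by apply: KL_decr; rewrite ?(ltW r0) ?subr_ge0.
have xB t : t0 <= t -> cube (- B) B (x t).
  move=> tt; apply: inB; apply: (le_trans (xP t tt)); rewrite lerD2r.
  apply: (@le_trans _ _ (beta Delta (t - t0))).
    by apply: KL_mono => //; rewrite ?enorm_ge0 ?subr_ge0.
  by apply: KL_decr => //; rewrite ?subr_ge0// ltW.
(* The bound just proved keeps [x] in the cube, so it solves the original system too; uniqueness
   then carries the bound and global existence over to every solution. *)
have xg b : solves (fun t x => g (t / eps) x) t0 x0 b x.
  split => //.
    by apply: continuous_subspaceW cx => q /= [? _]; split=> //; exact: ltry.
  move=> t tt _; have := dx t tt (ltry t); rewrite clamp_id//.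
  by apply: xB; exact: ltW.
have lip (b : R) : exists2 L, 0 < L & forall t x y, cube (- b) b x -> cube (- b) b y ->
    `|g (t / eps) x - g (t / eps) y| <= L * `|x - y|.
  have [L L0 HL] := g_bounds b; exists L => // t y z hy hz.
  by have [] := HL (t / eps) y z hy hz.
split.
- by exists x.
- move=> b z tb zs; exists x => // t tt tb'.
  exact: (ode_unique lip (xg b) zs tt tb').
- move=> z zs t tt; rewrite -(ode_unique lip (xg +oo%E) zs tt (ltry t)).
  exact: xP.
Qed.

End practical_stability.

(** * Passage between slow time and original time *)

Section rescaling.
Context {R : realType} {n : nat}.
Implicit Types (F S : R -> 'rV[R]_n -> 'rV[R]_n).

Lemma solves_rescale (k : R) F S t0 x0 b z : 0 < k ->
  (forall t x, F t x = k *: S (k * t) x) ->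
  solves S (k * t0) x0 (k%:E * b)%E z -> solves F t0 x0 b (fun t => z (k * t)).
Proof.
move=> k0 FS [z0 cz dz].
have kb (t : R) : (t%:E < b)%E -> ((k * t)%:E < k%:E * b)%E.
  by move=> tb; rewrite EFinM lte_pmul2l.
split => //.
- apply/subspace_continuousP => t [tt tb].
  have h := (subspace_continuousP _ _).1 cz (k * t) (conj _ (kb t tb)).
  have {}h := h (ler_wpM2l (ltW k0) tt).
  apply: (@cvg_comp _ _ _ (fun t => k * t) z _ (within [set s |
    k * t0 <= s /\ (s%:E < k%:E * b)%E] (nbhs (k * t)))).
    move=> U /=; rewrite /within /= => hU.
    have : \forall s \near t, k * t0 <= k * s /\ ((k * s)%:E < k%:E * b)%E -> U (k * s).
      exact: (@mulrl_continuous R k t _ hU).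
    by apply: filterS => s hs [ts sb]; apply: hs; split;
      [exact: ler_wpM2l (ltW k0) _ _ ts|exact: kb].
  exact: h.
- move=> t tt tb; apply: is_derive_row => i.
  have kt : k * t0 < k * t by rewrite ltr_pM2l.
  have d := is_derive_coord i (dz (k * t) kt (kb t tb)).
  have A : is_derive t (1 : R) (fun t => k * t) k.
    by have := is_deriveZ k (is_derive_id t (1 : R)); rewrite -[k *: 1]/(k * 1) mulr1.
  have := @is_derive1_comp _ (fun s => z s ord0 i) (fun t => k * t) t _ _ d A.
  by rewrite FS mxE mulrC.
Qed.

(** The claim concerns every solution of [F], so time is also rescaled backwards, with [k^-1], to
    view such a solution as one of [S]. *)
Lemma solutions_global_rescale (k : R) F S t0 x0 (P Q : R -> 'rV[R]_n -> Prop) : 0 < k ->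
  (forall t x, F t x = k *: S (k * t) x) ->
  (forall t x, P (k * t) x -> Q t x) ->
  solutions_global S (k * t0) x0 P -> solutions_global F t0 x0 Q.
Proof.
move=> k0 FS PQ [[z zs] ext HP]; have k1 : k != 0 by rewrite gt_eqF.
have oo : (k%:E * +oo = +oo)%E by rewrite gt0_muley ?lte_fin.
have SF t x : S t x = k^-1 *: F (k^-1 * t) x.
  by rewrite FS scalerA mulVf// scale1r mulrA divff// mul1r.
have ki0 : 0 < k^-1 by rewrite invr_gt0.
have back b w : solves F t0 x0 b w -> solves S (k * t0) x0 (k%:E * b)%E (fun s =>
  w (k^-1 * s)).
  move=> ws; apply: (@solves_rescale k^-1 S F) => //.
  by rewrite mulKf// muleA -EFinM mulVf// mul1e.
split.
- exists (fun t => z (k * t)); apply: (solves_rescale k0 FS).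
  by rewrite oo.
- move=> b w tb ws; have [|w' ws' ww'] := ext _ _ _ (back b w ws).
    by rewrite EFinM lte_pmul2l.
  exists (fun t => w' (k * t)); first by apply: (solves_rescale k0 FS); rewrite oo.
  move=> t tt tb'; rewrite ww' ?mulKf//; first by rewrite ler_pM2l.
  by rewrite EFinM lte_pmul2l.
- move=> w ws t tt; apply: PQ.
  have := HP _ _ (k * t) (ler_wpM2l (ltW k0) tt).
  move=> /(_ (fun s => w (k^-1 * s))); rewrite mulKf//; apply.
  by have := back _ _ ws; rewrite oo.
Qed.

End rescaling.

(** * Application to the extremum seeking system *)

Section extremum_seeking.
Context {R : realType} {n : nat}.
Variables (J : 'rV[R]_n.+1 -> R) (a : R) (homega : 'rV[R]_n.+1) (phi : R -> R).
Variables (m : 'I_n.+1 -> 'rV[R]_n.+1 -> R).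
Notation G := (G_field J a phi m).

Lemma time_averageE (omega T t0 : R) x i :
  time_average J a homega phi m omega T t0 x ord0 i =
  line_mean (omega *: homega) (fun th => G x th ord0 i) t0 T.
Proof.
rewrite !mxE; congr (_ * _); apply: eq_Rintegral => t _.
rewrite !mxE /signal_S /signal_u scalerA [t * omega]mulrC; ring.
Qed.

Lemma slow_fieldE s x eps : slow_field J a homega phi m s x eps =
  - G x ((s / eps) *: homega).
Proof. by []. Qed.

Lemma fast_fieldE (k omega t : R) x : 0 < k -> 0 < omega ->
  fast_field J a homega phi m k omega t x =
  k *: slow_field J a homega phi m (k * t) x (k / omega).
Proof.
move=> k0 o0; rewrite slow_fieldE /fast_field scalerN; congr (- _).
have -> : k * t / (k / omega) = omega * t by field; rewrite !gt_eqF.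
apply/rowP => i; rewrite !mxE /signal_S /signal_u; ring.
Qed.

Lemma int_independent (omega : R) : 0 < omega -> rationally_independent homega ->
  forall l : 'rV[int]_n.+1, l != 0 ->
  \sum_i (l ord0 i)%:~R * (omega *: homega) ord0 i != 0.
Proof.
move=> o0 indep l l0; pose lq : 'rV[rat]_n.+1 := \row_i (l ord0 i)%:~R.
have lq0 : lq != 0.
  apply: contraNneq l0 => lq0; apply/eqP/rowP => i.
  by move/rowP : lq0 => /(_ i); rewrite !mxE => /eqP; rewrite intr_eq0 => /eqP.
have := indep lq lq0; rewrite (_ : \sum_i (l ord0 i)%:~R * _ = omega * \sum_i ratr (lq
  ord0 i) * homega ord0 i).
  by move=> h; rewrite mulf_neq0// gt_eqF.
by rewrite mulr_sumr; apply: eq_bigr => i _; rewrite !mxE ratr_int; ring.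
Qed.

Hypothesis J_lip : locally_lipschitz J.
Hypothesis a_gt0 : 0 < a.
Hypothesis homega_indep : rationally_independent homega.
Hypothesis phi_range : forall s, -1 <= phi s <= 1.
Hypothesis phi_lip : [lipschitz phi s | s in [set: R]].
Hypothesis phi_per : forall s, phi (s + 2 * pi) = phi s.
Hypothesis m_lip : forall i, [lipschitz m i u | u in cube (-1) 1].
Notation avg := (avg_field J a phi m).

Lemma time_average_cube (omega b e : R) : 0 < omega -> 0 < e -> exists2 T0, 0 < T0 &
  forall x t0 T, cube (- b) b x -> T0 <= T ->
    `|time_average J a homega phi m omega T t0 x - avg x| <= e.
Proof.
move=> o0 e0; have indep := int_independent o0 homega_indep.
have [T0 T00 HT] := line_mean_avg_field_cube J_lip a_gt0 phi_range phi_lip phi_per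
  m_lip indep b e0.
exists T0 => // x t0 T xb TT; apply: rV_norm_le => [|i]; first exact: ltW.
by rewrite mxE [X in _ + X]mxE time_averageE; exact: HT.
Qed.

Lemma time_average_cvg (omega t0 : R) x : 0 < omega ->
  time_average J a homega phi m omega T t0 x @[T --> +oo] --> avg x.
Proof.
move=> o0; apply/cvgrPdist_le => e e0.
have [T0 T00 HT] := time_average_cube `|x| o0 e0.
apply: filterS (nbhs_pinfty_ge (num_real T0)) => T TT.
by rewrite distrC; apply: HT => //; exact: cube_norm.
Qed.

Lemma time_average_uniform (omega : R) (K : set 'rV[R]_n.+1) : 0 < omega -> compact K ->
  forall e : R, 0 < e -> \forall T \near +oo, forall x t0, K x ->
    enorm (time_average J a homega phi m omega T t0 x - avg x) < e.
Proof.
move=> o0 /compact_bounded[B [_ HB]] e e0.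
have e1 : 0 < e / 2 / n.+2%:R by rewrite !divr_gt0.
have [T0 T00 HT] := time_average_cube (`|B| + 1) o0 e1.
apply: filterS (nbhs_pinfty_ge (num_real T0)) => T TT x t0 Kx.
have xB : cube (- (`|B| + 1)) (`|B| + 1) x.
  by apply: cube_norm; apply: HB => //; rewrite (le_lt_trans (ler_norm _))// ltrDl.
apply: (@le_lt_trans _ _ (e / 2)); last by rewrite ltr_pdivrMr// ltr_pMr// ltr1n.
by apply: (le_trans (enorm_le_norm _)); rewrite mulrC -ler_pdivlMr//; exact: HT.
Qed.

Lemma slow_practical_stability p beta : class_KL beta ->
  (forall t0 x0, solutions_global (fun _ z => - avg z) t0 x0
    (fun t z => enorm (z - p) <= beta (enorm (x0 - p)) (t - t0))) ->
  forall Delta nu : R, 0 < Delta -> 0 < nu -> exists2 epss, 0 < epss &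
    forall eps t0 x0, 0 < eps -> eps < epss -> enorm (x0 - p) <= Delta ->
    solutions_global (fun t x => slow_field J a homega phi m t x eps) t0 x0
      (fun t x => enorm (x - p) <= beta (enorm (x0 - p)) (t - t0) + nu).
Proof.
(* [g] is the field in fast time at unit frequency: the slow field at [s] is [g] at [s / eps], so
   averaging is checked along [homega] itself and [omega] enters only through [eps]. *)
move=> bKL stable; pose g (t : R) x := - G x (t *: homega).
have cG x i : continuous (fun t : R => G x (t *: homega) ord0 i).
  exact: continuous_line (@continuous_G_field _ _ _ _ _ _ J_lip a_gt0 phi_range phi_lip
    m_lip x i).
apply: (@practical_stability R n.+1 g (fun x => - avg x) p) => //.
- move=> B; have [L L0 HL] := G_field_bounds J_lip a_gt0 phi_range m_lip B.
  exists L => // t x y Bx By; rewrite /g -opprD !normrN.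
  split; apply: rV_norm_le => [|i]; rewrite ?mulr_ge0 ?(ltW L0)//.
    by have [] := HL x y (t *: homega) i Bx By.
  by rewrite mxE [X in _ + X]mxE; have [] := HL x y (t *: homega) i Bx By.
- move=> x i; rewrite (_ : (fun _ => _) = (fun t => - G x (t *: homega) ord0 i)).
    by move=> t; apply: cvgN; exact: cG.
  by apply/funext => t; rewrite /g mxE.
- move=> B; have [L L0 HL] := avg_field_bounds J_lip a_gt0 phi_range phi_lip m_lip B.
  exists L => // x y Bx By; rewrite -opprD !normrN.
  split; apply: rV_norm_le => [|i]; rewrite ?mulr_ge0 ?(ltW L0)//.
    by have [] := HL x y i Bx By.
  by rewrite mxE [X in _ + X]mxE; have [] := HL x y i Bx By.
- move=> B e e0; have indep := int_independent ltr01 homega_indep.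
  rewrite scale1r in indep.
  have [T0 T00 HT] := line_mean_avg_field_cube J_lip a_gt0 phi_range phi_lip phi_per
    m_lip indep B e0.
  exists T0 => // x t0 T i Bx TT; have := HT x t0 T i Bx TT.
  rewrite /line_mean /primitive.
  rewrite (_ : \int[lebesgue_measure]_(s in `[t0, (t0 + T)%R]) g s x ord0 i =
    - 1 * \int[lebesgue_measure]_(s in `[t0, (t0 + T)%R]) G x (s *: homega) ord0 i).
    by rewrite [(- avg x) _ _]mxE mulN1r mulrN -opprD normrN.
  rewrite -RintegralZl//; last exact: continuous_segment_integrable.
  by apply: eq_Rintegral => s _; rewrite /g mxE mulN1r.
Qed.

End extremum_seeking.

Theorem theorem5 (R : realType) (n : nat) (n_ge1 : (1 <= n)%N)
  (J : 'rV[R]_n -> R) (J_lip : locally_lipschitz J)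
  (a : R) (a_gt0 : 0 < a)
  (homega : 'rV[R]_n) (homega_gt0 : forall i, 0 < homega ord0 i)
  (homega_indep : rationally_independent homega)
  (phi : R -> R) (phi_range : forall s, -1 <= phi s <= 1)
  (phi_lip : [lipschitz phi s | s in [set: R]])
  (phi_per : forall s, phi (s + 2 * pi) = phi s)
  (m : 'I_n -> 'rV[R]_n -> R)
  (m_lip : forall i, [lipschitz m i u | u in cube (-1) 1])
  (rho : 'rV[R]_n -> R)
  (rho_ge0 : forall u, cube (-1) 1 u -> 0 <= rho u)
  (rho_int : lebesgue_integrable (cube (-1) 1) rho)
  (rho_density : forall h : 'rV[R]_n -> R,
    [lipschitz h u | u in cube (-1) 1] ->
    ((2 * pi) ^+ n)^-1 *
      \int[lebesgue_rV n]_(theta in cube 0 (2 * pi)) h (dither phi theta) =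
    \int[lebesgue_rV n]_(u in cube (-1) 1) (h u * rho u))
  (kappa : 'rV[R]_n -> R)
  (kappa_ge0 : forall u, cube (-1) 1 u -> 0 <= kappa u)
  (kappa_cont : {within cube (-1) 1, continuous kappa})
  (kappa_mass : \int[lebesgue_rV n]_(u in cube (-1) 1) kappa u = 1)
  (kappa_bnd : forall i u, cube (-1) 1 u ->
    u ord0 i = -1 \/ u ord0 i = 1 -> kappa u = 0)
  (kappa_ac : forall i u, cube (-1) 1 u ->
    abs_continuous (-1) 1 (fun s => kappa (set_coord u i s)))
  (kappa_partial : forall i, {ae lebesgue_rV n, forall u, cube (-1) 1 u ->
    derivable kappa u (delta_mx ord0 i)})
  (kappa_partial_int : forall i,
    lebesgue_integrable (cube (-1) 1) (partial i kappa))
  (m_rho : forall i, {ae lebesgue_rV n, forall u, cube (-1) 1 u ->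
    m i u * rho u = - partial i kappa u}) :
  (forall omega : R, 0 < omega ->
     (forall x,
        [/\ forall i, lebesgue_integrable (cube (-1) 1)
              (fun u => partial i J (x + a *: u) * kappa u),
            forall t0, time_average J a homega phi m omega T t0 x @[T --> +oo]
              --> Rintegral_rV (lebesgue_rV n) (cube (-1) 1)
                    (fun u => kappa u *: grad J (x + a *: u)),
            differentiable (smoothed J a kappa) x &
            Rintegral_rV (lebesgue_rV n) (cube (-1) 1)
              (fun u => kappa u *: grad J (x + a *: u)) =
            grad (smoothed J a kappa) x]) /\
     (forall K : set 'rV[R]_n, compact K -> forall e : R, 0 < e ->
        \forall T \near +oo, forall x t0, K x ->
          enorm (time_average J a homega phi m omega T t0 x -
                 grad (smoothed J a kappa) x) < e)) /\
  (forall xa : 'rV[R]_n,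
     grad (smoothed J a kappa) xa = 0 ->
     GUAS (fun _ z => - grad (smoothed J a kappa) z) xa ->
     (forall eps0 : R, 0 < eps0 ->
        PGUAS eps0 (slow_field J a homega phi m) xa) /\
     exists2 beta, class_KL beta &
       forall Delta nu : R, 0 < Delta -> 0 < nu ->
       exists2 epss, 0 < epss & forall k omega : R,
         0 < k -> 0 < omega -> k / omega < epss ->
         forall t0 x0, enorm (x0 - xa) <= Delta ->
         solutions_global (fast_field J a homega phi m k omega) t0 x0
           (fun t x => enorm (x - xa) <=
              beta (enorm (x0 - xa)) (k * (t - t0)) + nu)).
Proof.
case: n n_ge1 J J_lip homega homega_gt0 homega_indep m m_lip rho rho_ge0 rho_int
  rho_density kappa kappa_ge0 kappa_cont kappa_mass kappa_bnd kappa_ac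
  kappa_partial kappa_partial_int m_rho => [//|{}n] _ J J_lip homega homega_gt0
  homega_indep m m_lip rho rho_ge0 rho_int rho_density kappa kappa_ge0 kappa_cont
  kappa_mass kappa_bnd kappa_ac kappa_partial kappa_partial_int m_rho.
have gradE x : grad (smoothed J a kappa) x = avg_field J a phi m x.
  exact: (grad_smoothed J_lip a_gt0 phi_range phi_lip m_lip rho_density).
have intE x : Rintegral_rV (lebesgue_rV n.+1) (cube (-1) 1)
    (fun u => kappa u *: grad J (x + a *: u)) = avg_field J a phi m x.
  exact: (Rintegral_grad_J_kappa J_lip a_gt0 phi_range phi_lip m_lip rho_density).
split=> [omega omega_gt0|xa _ [beta betaKL stable]].
  split=> [x|K cK e e0].
    split.
    - by move=> i; exact: integrable_partial_J_kappa.
    - by move=> t0; rewrite intE; exact: time_average_cvg.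
    - exact: (smoothed_differentiable J_lip a_gt0 phi_range phi_lip m_lip rho_density).
    - by rewrite intE gradE.
  have := time_average_uniform J_lip a_gt0 homega_indep phi_range phi_lip phi_per
    m_lip omega_gt0 cK e0.
  by apply: filterS => T h x t0 Kx; rewrite gradE; exact: h.
have field_eq : (fun (_ : R) z => - grad (smoothed J a kappa) z) =
    (fun _ z => - avg_field J a phi m z).
  by apply/funext => t; apply/funext => z; rewrite gradE.
rewrite field_eq in stable.
have slow := slow_practical_stability J_lip a_gt0 homega_indep phi_range phi_lip
  phi_per m_lip betaKL stable.
split=> [eps0 eps0_gt0|]; exists beta => // Delta nu Delta0 nu0.
  have [epss epss0 H] := slow Delta nu Delta0 nu0.
  exists (Num.min epss eps0); first by rewrite lt_min epss0 eps0_gt0 ge_min lexx orbT.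
  move=> t0 x0 eps x0D eps_gt0; rewrite lt_min => /andP[epsl _].
  exact: H.
have [epss epss0 H] := slow Delta nu Delta0 nu0.
exists epss => // k omega k0 omega0 keps t0 x0 x0D.
apply: (solutions_global_rescale k0 (fun t x => fast_fieldE _ _ _ _ _ t x k0 omega0)
  _ (H (k / omega) (k * t0) x0 (divr_gt0 k0 omega0) keps x0D)) => t x.
by rewrite mulrBr.
Qed.
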